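(* Let $c_1>c_2>0$ and let $\Phi_t:\mathbb{S}^2\rightarrow\mathbb{S}^2_{c_1}\times\mathbb{S}^2_{c_2}$, $t\in\mathbb{R}$, be the family of Lagrangian immersions defined in the context. Then the Lagrangian variation $\Phi_t$ of $\Phi_0$ is Hamiltonian, and if $A(t)$ denotes the area of the metric induced on $\mathbb{S}^2$ by $\Phi_t$, then $A(t)$ has a global maximum at $t=0$ and $\lim_{t\rightarrow\infty}A(t)=0$. Consequently, the Hamiltonian stationary Lagrangian immersion $\Phi_0$ is unstable, and there are no minimizers for the area in its Hamiltonian isotopy class.
   Context: For $c>0$, $\mathbb{S}^2_c=\{(z,x)\in\mathbb{C}\times\mathbb{R} : |z|^2+x^2=1/c\}$ with the induced metric, and $\mathbb{S}^2=\mathbb{S}^2_1$. $\mathbb{S}^2_{c_1}\times\mathbb{S}^2_{c_2}$ carries the product metric and product Kähler structure $J=(J^1,J^2)$, $\omega=\pi_1^*\omega_1+\pi_2^*\omega_2$, where $J^i,\omega_i$ are the complex structure and Kähler 2-form of $\mathbb{S}^2_{c_i}$ and $\pi_i$ the projections. An immersion $\Phi$ of a surface is Lagrangian if $\Phi^*\omega=0$. It is Hamiltonian stationary if $\mathrm{div}\,JH=0$ on the surface, where $H$ is its mean curvature vector; these are the critical points of area under Hamiltonian deformations. The immersions $\Phi_t=(\phi_t,\psi_t)$, $t\in\mathbb{R}$, are given, with $s_t=\sinh t$, $c_t=\cosh t$, and $$D_t(x)=(c_1c_t^2-c_2s_t^2)+(c_1s_t^2-c_2c_t^2)\,x^2,$$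 by $$\phi_t(z,x)=\frac{2\sqrt{c_1-c_2}}{D_t(x)}\left((s_t+i\,c_t\,x)\,z,\ \frac{(c_1c_t^2-2c_1-c_2s_t^2)+(c_1s_t^2+2c_1-c_2c_t^2)\,x^2}{2\sqrt{c_1}\sqrt{c_1-c_2}}\right),$$ $$\psi_t(z,x)=\frac{2\sqrt{c_1-c_2}}{D_t(x)}\left((c_t+i\,s_t\,x)\,\bar z,\ \frac{(c_1c_t^2-2c_2-c_2s_t^2)+(c_1s_t^2+2c_2-c_2c_t^2)\,x^2}{2\sqrt{c_2}\sqrt{c_1-c_2}}\right),$$ for $(z,x)\in\mathbb{S}^2$. A smooth variation of a Lagrangian immersion through Lagrangian immersions $F_t:\Sigma\rightarrow M$ of a Kähler surface $M$ is Hamiltonian if, for each $t$, the normal component of $\frac{dF_t}{dt}$ is $J\nabla f_t$ for some smooth function $f_t:\Sigma\rightarrow\mathbb{R}$ (gradient taken in the metric induced by $F_t$). The Hamiltonian isotopy class of a Lagrangian immersion is the set of Lagrangian immersions that can be joined to it by a Hamiltonian variation. A Hamiltonian stationary Lagrangian immersion is unstable if the second variation of the area is negative for some Hamiltonian variation. *)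

(* Defs.v *)
From mathcomp Require Import all_boot all_order all_algebra.
From mathcomp Require Import complex.
From mathcomp Require Import all_classical all_reals all_analysis.
Set Implicit Arguments.
Unset Strict Implicit.
Unset Printing Implicit Defensive.
Import Order.TTheory GRing.Theory Num.Theory.
Import numFieldNormedType.Exports.
Local Open Scope classical_set_scope.
Local Open Scope ring_scope.

(* C x R is identified with R^3 through (z, x) |-> (Re z, Im z, x). *)
Notation E3 R := ('rV[R]_3).
Notation E6 R := ('rV[R]_3 * 'rV[R]_3)%type.

Section Euclidean.
Context {R : realType}.

Definition vec (z : R[i]) (x : R) : E3 R :=
  \row_(j < 3) [:: complex.Re z; complex.Im z; x]`_j.

Definition zcoord (p : E3 R) : R[i] := (p 0 0 +i* p 0 1)%C.
Definition xcoord (p : E3 R) : R := p 0 2.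

(* The library norm on row vectors is the max norm, hence an explicit dot
   product. *)
Definition dot (u v : E3 R) : R := \sum_(j < 3) u 0 j * v 0 j.
Definition dot2 (U V : E6 R) : R := dot U.1 V.1 + dot U.2 V.2.

Definition cross (u v : E3 R) : E3 R :=
  \row_(j < 3) [:: u 0 1 * v 0 2 - u 0 2 * v 0 1;
                   u 0 2 * v 0 0 - u 0 0 * v 0 2;
                   u 0 0 * v 0 1 - u 0 1 * v 0 0]`_j.

Definition sphere (c : R) : set (E3 R) := [set p | dot p p = c^-1].

(* T_p S^2_c, for p on S^2_c. *)
Definition tangent (p : E3 R) : set (E3 R) := [set v | dot p v = 0].

End Euclidean.

(* C^infinity on an open set U: every iterated directional derivative is
   differentiable at every point of U. *)
Definition smooth_on (R : realType) (V W : normedModType R)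
    (U : set V) (f : V -> W) : Prop :=
  forall (vs : seq V) (x : V), U x ->
    differentiable (foldr (fun v g => 'D_v g) f vs) x.

Section CalculusOnSphere.
Context {R : realType}.

Definition normalize (q : E3 R) : E3 R := (Num.sqrt (dot q q))^-1 *: q.

(* Maps on S^2 are represented by functions on R^3, of which only the values on
   the unit sphere matter: they are differentiated through their extension to
   R^3 \ {0} which is constant along rays. *)
Definition radial (W : Type) (F : E3 R -> W) : E3 R -> W :=
  fun q => F (normalize q).

Definition smoothS (W : normedModType R) (F : E3 R -> W) : Prop :=
  smooth_on [set q | q != 0] (radial F).

(* dF_p(v), for p in S^2 and v in T_p S^2. *)
Definition dS (W : normedModType R) (F : E3 R -> W) (p v : E3 R) : W :=
  'D_v (radial F) p.

(* Second derivative of F at p along tangent vectors v, w; as radial F is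
   constant along rays, for v = w it is the second derivative at 0 of F along
   the geodesic of S^2 through p with velocity v. *)
Definition d2S (W : normedModType R) (F : E3 R -> W) (p v w : E3 R) : W :=
  'D_v ('D_w (radial F)) p.

Definition smooth_family (F : R -> E3 R -> E6 R) : Prop :=
  @smooth_on R (R^o * E3 R)%type (E6 R) [set u | u.2 != 0]
    (fun u => radial (F u.1) u.2).

End CalculusOnSphere.

Section Lagrangian.
Context {R : realType}.
Variables c1 c2 : R.

(* M = S^2_c1 x S^2_c2, inside R^6. *)
Definition M : set (E6 R) := [set P | sphere c1 P.1 /\ sphere c2 P.2].

(* Orthogonal projection of R^6 onto T_P M, for P in M. *)
Definition projTM (P V : E6 R) : E6 R :=
  (V.1 - (c1 * dot P.1 V.1) *: P.1, V.2 - (c2 * dot P.2 V.2) *: P.2).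

(* J = (J^1, J^2) at P in M: both factors are oriented by their outward
   normals. *)
Definition J (P V : E6 R) : E6 R :=
  (Num.sqrt c1 *: cross P.1 V.1, Num.sqrt c2 *: cross P.2 V.2).

Definition omega (P U V : E6 R) : R := dot2 (J P U) V.

Definition immersion (F : E3 R -> E6 R) : Prop :=
  [/\ smoothS F,
      forall p, sphere 1 p -> M (F p) &
      forall p v, sphere 1 p -> tangent p v -> dS F p v = 0 -> v = 0].

Definition lagrangian_immersion (F : E3 R -> E6 R) : Prop :=
  immersion F /\
  forall p v w, sphere 1 p -> tangent p v -> tangent p w ->
    omega (F p) (dS F p v) (dS F p w) = 0.

(* X is the gradient of f at p in the metric induced by F. *)
Definition is_gradient (F : E3 R -> E6 R) (f : E3 R -> R) (p X : E3 R) : Prop :=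
  tangent p X /\
  forall v, tangent p v -> dot2 (dS F p X) (dS F p v) = dS (f : _ -> R^o) p v.

(* N is the component of W normal to the surface, where W is in T_(F p) M. *)
Definition is_normal_part (F : E3 R -> E6 R) (p : E3 R) (W N : E6 R) : Prop :=
  (exists2 X, tangent p X & W - N = dS F p X) /\
  forall v, tangent p v -> dot2 N (dS F p v) = 0.

(* Variations are parametrized by the whole real line.  This loses nothing: from
   a variation parametrized by an interval I one obtains such a variation by
   composing with a smooth map R -> I, which keeps it Hamiltonian and may be
   chosen to reach given end points or to be the identity near 0. *)
Definition hamiltonian_variation (F : R -> E3 R -> E6 R) : Prop :=
  [/\ smooth_family F,
      forall t, lagrangian_immersion (F t) &
      forall t, exists2 f : E3 R -> R, smoothS (f : _ -> R^o) &
        forall p, sphere 1 p -> exists2 X, is_gradient (F t) f p X &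
          is_normal_part (F t) p (derive1 (fun s => F s p) t)
            (J (F t p) (dS (F t) p X))].

Definition isotopy_class (Phi : E3 R -> E6 R) : set (E3 R -> E6 R) :=
  [set Psi | lagrangian_immersion Psi /\
    exists2 F, hamiltonian_variation F &
      forall p, sphere 1 p -> F 0 p = Phi p /\ F 1 p = Psi p].

(* (e1, e2) is an orthonormal basis of T_p S^2 for the metric induced by F. *)
Definition frame (F : E3 R -> E6 R) (p e1 e2 : E3 R) : Prop :=
  [/\ tangent p e1, tangent p e2, dot2 (dS F p e1) (dS F p e1) = 1,
      dot2 (dS F p e2) (dS F p e2) = 1 & dot2 (dS F p e1) (dS F p e2) = 0].

(* The second fundamental form h(v, w) of F in M at p. *)
Definition is_second_form (F : E3 R -> E6 R) (p v w : E3 R) (h : E6 R) : Prop :=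
  is_normal_part F p (projTM (F p) (d2S F p v w)) h.

Definition is_mean_curvature (F H : E3 R -> E6 R) : Prop :=
  forall p e1 e2, sphere 1 p -> frame F p e1 e2 ->
    exists h1 h2, [/\ is_second_form F p e1 e1 h1, is_second_form F p e2 e2 h2 &
      H p = 2^-1 *: (h1 + h2)].

(* The divergence, in the metric induced by F, of a vector field V tangent to
   the surface, given a frame at p: the Levi-Civita connection of the surface
   is the tangential part of the derivative in R^6. *)
Definition divergence (F V : E3 R -> E6 R) (p e1 e2 : E3 R) : R :=
  dot2 (dS V p e1) (dS F p e1) + dot2 (dS V p e2) (dS F p e2).

Definition hamiltonian_stationary (F : E3 R -> E6 R) : Prop :=
  exists2 H, is_mean_curvature F H &
    forall p e1 e2, sphere 1 p -> frame F p e1 e2 ->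
      divergence F (fun q => J (F q) (H q)) p e1 e2 = 0.

End Lagrangian.

Section Area.
Context {R : realType}.

Definition spherical (a b : R) : E3 R :=
  vec (sin a * cos b +i* (sin a * sin b))%C (cos a).

(* Area of the metric induced by F, i.e. the integral of sqrt (EG - F^2) in the
   coordinates a (colatitude) and b (longitude). *)
Definition area_density (F : E3 R -> E6 R) (a b : R) : R :=
  let Fa := derive1 (fun s => F (spherical s b)) a in
  let Fb := derive1 (fun s => F (spherical a s)) b in
  Num.sqrt (dot2 Fa Fa * dot2 Fb Fb - dot2 Fa Fb ^+ 2).

Definition area (F : E3 R -> E6 R) : R :=
  \int[lebesgue_measure]_(b in `[0, 2 * pi])
    \int[lebesgue_measure]_(a in `[0, pi]) area_density F a b.

Definition unstable (c1 c2 : R) (Phi : E3 R -> E6 R) : Prop :=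
  exists F, [/\ hamiltonian_variation c1 c2 F,
    forall p, sphere 1 p -> F 0 p = Phi p &
    derive1n 2 (fun t => area (F t)) 0 < 0].

Definition is_minimizer (C : set (E3 R -> E6 R)) (Psi : E3 R -> E6 R) : Prop :=
  C Psi /\ forall Psi', C Psi' -> area Psi <= area Psi'.

End Area.

Section Family.
Context {R : realType}.
Variables c1 c2 : R.

Definition sinh (t : R) : R := (expR t - expR (- t)) / 2.
Definition cosh (t : R) : R := (expR t + expR (- t)) / 2.

Definition Dfun (t x : R) : R :=
  (c1 * cosh t ^+ 2 - c2 * sinh t ^+ 2) +
  (c1 * sinh t ^+ 2 - c2 * cosh t ^+ 2) * x ^+ 2.

Definition phi (t : R) (p : E3 R) : E3 R :=
  let z := zcoord p in let x := xcoord p in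
  let st := sinh t in let ct := cosh t in
  (2 * Num.sqrt (c1 - c2) / Dfun t x) *:
    vec ((st +i* (ct * x))%C * z)
      (((c1 * ct ^+ 2 - 2 * c1 - c2 * st ^+ 2) +
        (c1 * st ^+ 2 + 2 * c1 - c2 * ct ^+ 2) * x ^+ 2) /
       (2 * Num.sqrt c1 * Num.sqrt (c1 - c2))).

Definition psi (t : R) (p : E3 R) : E3 R :=
  let z := zcoord p in let x := xcoord p in
  let st := sinh t in let ct := cosh t in
  (2 * Num.sqrt (c1 - c2) / Dfun t x) *:
    vec ((ct +i* (st * x))%C * conjc z)
      (((c1 * ct ^+ 2 - 2 * c2 - c2 * st ^+ 2) +
        (c1 * st ^+ 2 + 2 * c2 - c2 * ct ^+ 2) * x ^+ 2) /
       (2 * Num.sqrt c2 * Num.sqrt (c1 - c2))).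

Definition Phi (t : R) (p : E3 R) : E6 R := (phi t p, psi t p).

End Family.

(* Main.v *)
From HB Require Import structures.
Require Import Defs.
From mathcomp Require Import all_boot all_order all_algebra.
From mathcomp Require Import complex ring lra.
From mathcomp Require Import all_classical all_reals all_analysis.
Import Order.TTheory GRing.Theory Num.Theory.
Import numFieldNormedType.Exports.
Local Open Scope classical_set_scope.
Local Open Scope ring_scope.
Set Implicit Arguments.
Unset Strict Implicit.
Unset Printing Implicit Defensive.

(** Identify C x R with R^3 and write x for the height on the unit sphere,
    u = 1 + x^2, v = 1 - x^2, sg = c1 + c2, s = sinh t, c = cosh t and
    k = (c1 - c2) cosh (2 t).  Then 2 D_t = k u + sg v, and each immersion of
    the family is equivariant under rotations: it maps (z, x) to
    (alpha(x) z, h(x); beta(x) conj(z), l(x)) with alpha, beta complex and h, l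
    real functions of the height.  Every geometric statement about such a map
    is an identity between functions of x alone.

    The map is conformal, with factor m = 4 k u / D^2 ([profile_ode],
    [conformal_phimap]).  It is Lagrangian because the two area forms pull back
    to opposite multiples of that of the sphere: for factors of radius r1 and
    r2 the multiples are r1 h' and - r2 l' ([det3_rot], [omega_drot]).  Its
    velocity in t decomposes as dF(Y) + J dF(X), where X = (v / u) E is the
    multiple (v / u) of the height gradient E (lemmas [profile_dtA1] to
    [profile_dtK]).  Since the metric is conformal, X is the gradient of any
    function P(x) of the height with P' = 4 k v / D^2; hence the variation is
    Hamiltonian ([hamiltonian_variation_Phi]).

    In polar coordinates the area of the immersion at time t is
    32 pi times the integral of k u sin(th) / (k u + sg v)^2 over [0, pi].  The
    derivative of x / (k u + sg v) is (k v + sg u) / (k u + sg v)^2, which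
    trades this integral for (1 / sg) (1 - I(k)), where I(k) is the integral of
    k^2 v sin(th) / (k u + sg v)^2 ([int_area_integrand]).  The function
    k / (k u + sg v) increases with k, and k is smallest at t = 0: this is the
    global maximum ([area_Phi_max]).  As I'(k) > 0 and k has a nondegenerate
    minimum at 0, the second derivative of the area there is negative
    ([area_Phi_derive2]).  The integrand is at most 16 / k, so the area tends
    to 0 ([area_Phi_cvg0]).

    At t = 0 the conformality makes the mean curvature vector the multiple
    1 / (2 m) of the Laplacian of the immersion projected onto the tangent
    space of the product.  Then JH is the image of
    a rotation field D / (4 u) (i z, 0), whose coefficient depends on x only, so
    its divergence vanishes ([hamiltonian_stationary_Phi0]).

    Finally, an immersed sphere has positive area ([area_gt0]) while the
    variations t -> Phi_{T t} join Phi_0 to immersions Phi_T of arbitrarily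
    small area: no minimizer exists ([no_minimizer]). *)

(** * Calculus of smooth functions *)

Section SmoothCalculus.
Context {R : realType} {V : normedModType R}.
Implicit Types (U : set V) (n : nat).

(** Differentiability of order n by recursion on n, so that closure
    under products and compositions can be proved by induction: the
    derivative of a product is again a sum of products. *)
Fixpoint Cn (W : normedModType R) n U (f : V -> W) : Prop :=
  (forall x, U x -> differentiable f x) /\
  if n is m.+1 then forall v, Cn m U ('D_v f) else True.

Lemma Cn_diff (W : normedModType R) n U (f : V -> W) x :
  Cn n U f -> U x -> differentiable f x.
Proof. by case: n => [|n] [+ _]; exact. Qed.

Lemma Cn_smooth (W : normedModType R) U (f : V -> W) :
  (forall n, Cn n U f) -> smooth_on U f.
Proof.
move=> Cf vs x Ux; elim/last_ind: vs f Cf => [|vs v IH] f Cf /=.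
  exact: Cn_diff (Cf 0%N) Ux.
by rewrite foldr_rcons; apply: IH => n; have [_] := Cf n.+1; exact.
Qed.

Lemma near_eq_differentiable (W : normedModType R) (f g : V -> W) x :
  (\near x, f x = g x) -> differentiable f x -> differentiable g x.
Proof.
move=> fg df.
have expg : g \o shift x = cst (g x) + 'd f x +o_ (0 : V) id.
  apply/eqaddoP => e e0.
  have /eqaddoP/(_ _ e0) := diff_locally df.
  have := fg; rewrite (near_shift 0) /= => fg0.
  apply: filterS2 fg0 => y /=; rewrite subr0 => fgy.
  rewrite -![(_ + _ : _ -> _) _]/(_ + _) -![(- _ : _ -> _) _]/(- _) /=.
  by rewrite /shift fgy (nbhs_singleton fg).
have dfc := diff_continuous df.
by apply/diff_locallyP; rewrite (diff_unique dfc expg).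
Qed.

Lemma Cn_eq_on (W : normedModType R) n U (f g : V -> W) : open U ->
  (forall x, U x -> f x = g x) -> Cn n U f -> Cn n U g.
Proof.
move=> oU; elim: n f g => [|n IH] f g fg [df Cf].
all: have nfg x : U x -> \near x, f x = g x
  by move=> Ux; apply: filterS (open_nbhs_nbhs (conj oU Ux)).
all: have dg x : U x -> differentiable g x
  by move=> Ux; apply: near_eq_differentiable (nfg x Ux) (df x Ux).
  by split.
split=> // v; apply: IH (Cf v) => x Ux.
by rewrite (near_eq_derive _ (nfg x Ux)).
Qed.

Lemma Cn_le (W : normedModType R) n U (f : V -> W) : Cn n.+1 U f -> Cn n U f.
Proof.
elim: n f => [|n IH] f [df Cf]; split=> // v.
exact/IH/Cf.
Qed.

Lemma Cn_cst (W : normedModType R) n U (w : W) : Cn n U (cst w : V -> W).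
Proof.
elim: n w => [|n IH] w; split=> [x _|]//; [exact: differentiable_cst..|] => v.
have -> : 'D_v (cst w : V -> W) = cst 0 by apply/funext => x; rewrite derive_cst.
exact: IH.
Qed.

Lemma Cn_lin (W : normedModType R) n U (f : {linear V -> W}) :
  continuous f -> Cn n U f.
Proof.
move=> cf; have df x : differentiable f x by exact: linear_differentiable.
case: n => [|n]; split=> // v.
have -> : 'D_v f = cst (f v) by apply/funext => x; rewrite deriveE// diff_lin.
exact: Cn_cst.
Qed.

Lemma CnD (W : normedModType R) n U (f g : V -> W) : open U ->
  Cn n U f -> Cn n U g -> Cn n U (fun x => f x + g x).
Proof.
move=> oU; elim: n f g => [|n IH] f g [df Cf] [dg Cg]; split=> //.
- by move=> x Ux; apply: differentiableD; [exact: df|exact: dg].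
- by move=> x Ux; apply: differentiableD; [exact: df|exact: dg].
move=> v; apply: Cn_eq_on (IH _ _ (Cf v) (Cg v)) => // x Ux.
by rewrite deriveD//; apply: diff_derivable; [exact: df|exact: dg].
Qed.

Lemma CnM n U (f g : V -> R) : open U ->
  @Cn R^o n U f -> @Cn R^o n U g -> @Cn R^o n U (fun x => f x * g x).
Proof.
move=> oU; elim: n f g => [|n IH] f g Cf Cg; split=> //;
  try by move=> x Ux; apply: differentiableM; [exact: Cn_diff Cf Ux|exact: Cn_diff Cg Ux].
move=> v; apply: Cn_eq_on
  (CnD oU (IH _ _ (Cn_le Cf) (Cg.2 v)) (IH _ _ (Cn_le Cg) (Cf.2 v))) => // x Ux.
rewrite deriveM//; apply: diff_derivable;
  [exact: Cn_diff Cf Ux|exact: Cn_diff Cg Ux].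
Qed.

Lemma CnZl (W : normedModType R) n U (f : V -> R) (w : W) : open U ->
  @Cn R^o n U f -> Cn n U (fun x => f x *: w).
Proof.
move=> oU; elim: n f => [|n IH] f [df Cf]; split=> //;
  try by move=> x Ux; apply: differentiableZl; exact: df.
move=> v; apply: Cn_eq_on (IH _ (Cf v)) => // x Ux.
rewrite [RHS]deriveE; last by apply: differentiableZl; exact: df.
by rewrite diffZl ?deriveE//; exact: df.
Qed.

(** As D(F o f) = (F' o f) D f, one more order for F o f costs one
    order of F' o f. *)
Lemma Cn_comp n U (F g : R -> R) (f : V -> R) : open U ->
  (forall x, U x -> is_derive (f x) 1 F (g (f x))) ->
  @Cn R^o n.+1 U f -> @Cn R^o n U (g \o f) -> @Cn R^o n.+1 U (F \o f).
Proof.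
move=> oU dF Cf Cg.
have dif x : U x -> differentiable F (f x).
  by move=> Ux; apply/derivable1_diffP; have := dF x Ux; case.
split=> [x Ux|v].
  by apply: differentiable_comp; [exact: Cn_diff Cf Ux|exact: dif].
apply: Cn_eq_on (CnM oU Cg (Cf.2 v)) => // x Ux /=.
have dfx := Cn_diff Cf Ux.
rewrite [RHS]deriveE; last by apply: differentiable_comp; [|exact: dif].
rewrite diff_comp//; last exact: dif.
rewrite /= deriveE//.
have [dFx dFv] := dF x Ux.
by rewrite deriv1E// derive1E dFv /= mulrC.
Qed.

End SmoothCalculus.

Section SmoothFunctions.
Context {R : realType} {V : normedModType R} (U : set V) (oU : open U).
Implicit Types f g : V -> R.

Definition smoothR f := forall n, @Cn R V R^o n U f.

Lemma smoothR_eq f g :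
  (forall x, U x -> f x = g x) -> smoothR f -> smoothR g.
Proof. by move=> fg sf n; apply: Cn_eq_on (sf n). Qed.

Lemma smoothR_cst (r : R) : smoothR (fun=> r).
Proof. by move=> n; exact: Cn_cst. Qed.

Lemma smoothRD f g : smoothR f -> smoothR g -> smoothR (fun x => f x + g x).
Proof. by move=> sf sg n; exact: CnD. Qed.

Lemma smoothRM f g : smoothR f -> smoothR g -> smoothR (fun x => f x * g x).
Proof. by move=> sf sg n; exact: CnM. Qed.

Lemma smoothRN f : smoothR f -> smoothR (fun x => - f x).
Proof.
by move=> sf; apply: smoothR_eq (smoothRM (smoothR_cst (-1)) sf) => x _; ring.
Qed.

Lemma smoothRB f g : smoothR f -> smoothR g -> smoothR (fun x => f x - g x).
Proof. by move=> sf sg; apply: smoothRD => //; exact: smoothRN. Qed.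

Lemma smoothRX f k : smoothR f -> smoothR (fun x => f x ^+ k).
Proof.
move=> sf; elim: k => [|k IH]; first exact: smoothR_cst.
by apply: smoothR_eq (smoothRM sf IH) => x _; rewrite exprS.
Qed.

(** For the inverse, the square root and the exponential, F' is a
    smooth expression in F itself; the last hypothesis then closes the
    induction on the order. *)
Lemma smoothR_comp (F g : R -> R) f :
  (forall x, U x -> is_derive (f x) 1 F (g (f x))) ->
  smoothR f ->
  (forall n, @Cn R V R^o n U (F \o f) -> @Cn R V R^o n U (g \o f)) ->
  smoothR (F \o f).
Proof.
move=> dF sf sg; elim=> [|n IH]; last by apply: Cn_comp dF (sf _) (sg _ IH).
split=> // x Ux; apply: differentiable_comp; first exact: Cn_diff (sf 0%N) Ux.
by apply/derivable1_diffP; have := dF x Ux; case.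
Qed.

Lemma smoothRV f :
  (forall x, U x -> f x != 0) -> smoothR f -> smoothR (fun x => (f x)^-1).
Proof.
move=> f0 sf; apply: (@smoothR_comp GRing.inv (fun y => - (y^-1 * y^-1))) => //.
  move=> x /f0 fx0; apply: is_derive_eq.
    by apply: (@is_deriveV R id (f x) 1 1).
  by rewrite /= /GRing.scale /= mulr1 -exprVn expr2.
move=> n Cf; apply: Cn_eq_on (CnM oU (@Cn_cst _ _ R^o n U (-1)) (CnM oU Cf Cf)) => //.
by move=> x _ /=; ring.
Qed.

Lemma smoothR_sqrt f :
  (forall x, U x -> 0 < f x) -> smoothR f -> smoothR (fun x => Num.sqrt (f x)).
Proof.
move=> f0 sf.
apply: (@smoothR_comp Num.sqrt (fun y => 2^-1 * (y^-1 * Num.sqrt y))) => //.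
  move=> x /f0 fx0; apply: is_derive_eq; first exact: is_derive1_sqrt.
  have s0 : Num.sqrt (f x) != 0 by rewrite gt_eqF// sqrtr_gt0.
  rewrite -{2}[f x]sqr_sqrtr ?ltW//; field.
  by rewrite s0.
move=> n Cf.
apply: Cn_eq_on (CnM oU (@Cn_cst _ _ R^o n U 2^-1)
  (CnM oU (smoothRV _ sf n) Cf)) => // x Ux.
by rewrite gt_eqF// f0.
Qed.

Lemma smoothR_exp f : smoothR f -> smoothR (fun x => expR (f x)).
Proof. by move=> sf; apply: (@smoothR_comp expR expR). Qed.

End SmoothFunctions.

(** * Coordinates on R^3 and R^6 *)

Section Coordinates.
Context {R : realType}.
Implicit Types (p q u v w : E3 R).

Lemma ord3P (i : 'I_3) : [\/ i = 0, i = 1 | i = 2].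
Proof.
by case: i => -[|[|[|//]]] ?; [constructor 1|constructor 2|constructor 3];
  apply/val_inj.
Qed.

Lemma sum3 (F : 'I_3 -> R) : \sum_(j < 3) F j = F 0 + F 1 + F 2.
Proof.
rewrite !big_ord_recr big_ord0 /= add0r.
by congr (F _ + F _ + F _); apply/val_inj.
Qed.

Lemma dotE u v : dot u v = u 0 0 * v 0 0 + u 0 1 * v 0 1 + u 0 2 * v 0 2.
Proof. exact: sum3. Qed.

Lemma vec0 (z : R[i]) (x : R) : vec z x 0 0 = complex.Re z.
Proof. by rewrite mxE. Qed.
Lemma vec1 (z : R[i]) (x : R) : vec z x 0 1 = complex.Im z.
Proof. by rewrite mxE. Qed.
Lemma vec2 (z : R[i]) (x : R) : vec z x 0 2 = x.
Proof. by rewrite mxE. Qed.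

Lemma E3P u v : u 0 0 = v 0 0 -> u 0 1 = v 0 1 -> u 0 2 = v 0 2 -> u = v.
Proof.
by move=> h0 h1 h2; apply/rowP => j; have [] := ord3P j => ->.
Qed.

Definition pt3 (a b c : R) : E3 R := vec (a +i* b)%C c.

Lemma pt3_0 (a b c : R) : pt3 a b c 0 0 = a. Proof. exact: vec0. Qed.
Lemma pt3_1 (a b c : R) : pt3 a b c 0 1 = b. Proof. exact: vec1. Qed.
Lemma pt3_2 (a b c : R) : pt3 a b c 0 2 = c. Proof. exact: vec2. Qed.
Definition pt3E := (pt3_0, pt3_1, pt3_2).

Lemma E3_pt3 u : u = pt3 (u 0 0) (u 0 1) (u 0 2).
Proof. by apply: E3P; rewrite pt3E. Qed.

Lemma crossE u v : cross u v =
  pt3 (u 0 1 * v 0 2 - u 0 2 * v 0 1) (u 0 2 * v 0 0 - u 0 0 * v 0 2)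
      (u 0 0 * v 0 1 - u 0 1 * v 0 0).
Proof. by apply: E3P; rewrite [LHS]mxE pt3E. Qed.

Lemma pt3D a b c a' b' c' :
  pt3 a b c + pt3 a' b' c' = pt3 (a + a') (b + b') (c + c').
Proof. by apply: E3P; rewrite !mxE. Qed.
Lemma pt3N a b c : - pt3 a b c = pt3 (- a) (- b) (- c).
Proof. by apply: E3P; rewrite !mxE. Qed.
Lemma pt3Z k a b c : k *: pt3 a b c = pt3 (k * a) (k * b) (k * c).
Proof. by apply: E3P; rewrite !mxE. Qed.

(** The point of C x R x C x R with the given real coordinates. *)
Definition pt (a b c d e f : R) : E6 R := (pt3 a b c, pt3 d e f).

Lemma E6_pt (P : E6 R) : P = pt (P.1 0 0) (P.1 0 1) (P.1 0 2)
  (P.2 0 0) (P.2 0 1) (P.2 0 2).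
Proof. by rewrite /pt -!E3_pt3; case: P. Qed.

Lemma ptD a b c d e f a' b' c' d' e' f' : pt a b c d e f + pt a' b' c' d' e' f'
  = pt (a + a') (b + b') (c + c') (d + d') (e + e') (f + f').
Proof. by rewrite /pt -!pt3D. Qed.
Lemma ptN a b c d e f :
  - pt a b c d e f = pt (- a) (- b) (- c) (- d) (- e) (- f).
Proof. by rewrite /pt -!pt3N. Qed.
Lemma ptZ k a b c d e f :
  k *: pt a b c d e f = pt (k * a) (k * b) (k * c) (k * d) (k * e) (k * f).
Proof. by rewrite /pt -!pt3Z. Qed.
Lemma pt0 : 0 = pt 0 0 0 0 0 0.
Proof.
by transitivity ((0, 0) : E6 R) => //; congr pair; apply: E3P; rewrite [LHS]mxE pt3E.
Qed.

Lemma dot2_pt a b c d e f a' b' c' d' e' f' :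
  dot2 (pt a b c d e f) (pt a' b' c' d' e' f')
  = a * a' + b * b' + c * c' + (d * d' + e * e' + f * f').
Proof. by rewrite /dot2 /pt /= !dotE !pt3E. Qed.

Lemma pt_sum a b c d e f : pt a b c d e f =
  a *: pt 1 0 0 0 0 0 + b *: pt 0 1 0 0 0 0 + c *: pt 0 0 1 0 0 0 +
  d *: pt 0 0 0 1 0 0 + e *: pt 0 0 0 0 1 0 + f *: pt 0 0 0 0 0 1.
Proof. by rewrite !ptZ !ptD; congr pt; ring. Qed.

End Coordinates.

Section VectorValued.
Context {R : realType} {V : normedModType R}.

Lemma is_deriveZl (W : normedModType R) (f : V -> R) (w : W) (x v : V) (df : R) :
  is_derive x v (f : V -> R^o) df -> is_derive x v (fun y => f y *: w) (df *: w).
Proof.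
move=> [fx <-].
have cv : h^-1 *: (f (h *: v + x) *: w - f x *: w) @[h --> 0^'] -->
    'D_v (f : V -> R^o) x *: w.
  under eq_fun do rewrite -scalerBl scalerA.
  exact: cvgZr_tmp.
by apply: DeriveDef; [apply/cvg_ex; exists ('D_v (f : V -> R^o) x *: w)|apply: cvg_lim].
Qed.

Lemma is_derive_pt (x v : V) (f1 f2 f3 f4 f5 f6 : V -> R) (d1 d2 d3 d4 d5 d6 : R) :
  is_derive x v (f1 : V -> R^o) d1 -> is_derive x v (f2 : V -> R^o) d2 ->
  is_derive x v (f3 : V -> R^o) d3 -> is_derive x v (f4 : V -> R^o) d4 ->
  is_derive x v (f5 : V -> R^o) d5 -> is_derive x v (f6 : V -> R^o) d6 ->
  is_derive x v (fun y => pt (f1 y) (f2 y) (f3 y) (f4 y) (f5 y) (f6 y))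
    (pt d1 d2 d3 d4 d5 d6).
Proof.
move=> *; under eq_fun do rewrite pt_sum.
rewrite [X in is_derive _ _ _ X]pt_sum.
by repeat apply: is_deriveD; exact: is_deriveZl.
Qed.

Lemma smooth_pt (U : set V) (f1 f2 f3 f4 f5 f6 : V -> R) : open U ->
  smoothR U f1 -> smoothR U f2 -> smoothR U f3 -> smoothR U f4 ->
  smoothR U f5 -> smoothR U f6 ->
  smooth_on U (fun y => pt (f1 y) (f2 y) (f3 y) (f4 y) (f5 y) (f6 y)).
Proof.
move=> oU *; apply: Cn_smooth => n; under eq_fun do rewrite pt_sum.
by apply: (CnD oU (CnD oU (CnD oU (CnD oU (CnD oU _ _) _) _) _) _); apply: CnZl.
Qed.

Lemma smooth_on_eq (W : normedModType R) (U : set V) (f g : V -> W) : open U ->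
  (forall x, U x -> f x = g x) -> smooth_on U f -> smooth_on U g.
Proof.
move=> oU fg sf.
suff D vs x : U x ->
    foldr (fun v g => 'D_v g) f vs x = foldr (fun v g => 'D_v g) g vs x.
  move=> vs x Ux; apply: near_eq_differentiable (sf vs x Ux).
  by apply: filterS (open_nbhs_nbhs (conj oU Ux)) => y; exact: D.
elim: vs x => [|v vs IH] x Ux /=; first exact: fg.
apply: near_eq_derive; apply: filterS (open_nbhs_nbhs (conj oU Ux)).
exact: IH.
Qed.

Lemma derive_line (W : normedModType R) (f : V -> W) (x v : V) (s : R) :
  'D_v f (x + s *: v) = 'D_1 (fun r : R => f (x + r *: v)) s.
Proof.
apply: (congr1 (fun g : R -> W => lim (g @ 0^'))); apply/funext => h /=.
by rewrite [h%:A]mulr1 scalerDl addrCA.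
Qed.

End VectorValued.

(** * Derivatives on the sphere along great circles *)

Section Sphere.
Context {R : realType}.
Implicit Types (p q u v w : E3 R).

Lemma dot_ge0 u : 0 <= dot u u.
Proof. by rewrite dotE -!expr2 !addr_ge0// sqr_ge0. Qed.

Lemma dot_eq0 u : dot u u = 0 -> u = 0.
Proof.
rewrite dotE => h; have a0 := sqr_ge0 (u 0 0); have a1 := sqr_ge0 (u 0 1).
have a2 := sqr_ge0 (u 0 2); rewrite !expr2 in a0 a1 a2.
by apply: E3P; rewrite mxE; apply/eqP; rewrite -sqrf_eq0 expr2; apply/eqP; lra.
Qed.

Lemma dot_gt0 u : u != 0 -> 0 < dot u u.
Proof.
move=> u0; rewrite lt_neqAle dot_ge0 andbT eq_sym.
by apply: contra_neq u0; exact: dot_eq0.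
Qed.

Lemma dotZ k u : dot (k *: u) (k *: u) = k ^+ 2 * dot u u.
Proof. by rewrite !dotE !mxE; ring. Qed.

Lemma normalize_sphere q : q != 0 -> sphere 1 (normalize q).
Proof.
move=> q0; rewrite /sphere /= /normalize dotZ invr1 exprVn sqr_sqrtr ?dot_ge0//.
by rewrite mulVf// gt_eqF// dot_gt0.
Qed.

Lemma normalize_id p : sphere 1 p -> normalize p = p.
Proof.
by rewrite /sphere /= invr1 /normalize => ->; rewrite sqrtr1 invr1 scale1r.
Qed.

Lemma sphereE p : sphere 1 p -> p 0 0 ^+ 2 + p 0 1 ^+ 2 + p 0 2 ^+ 2 = 1.
Proof. by rewrite /sphere /= invr1 dotE !expr2. Qed.

Lemma sphere_neq0 p : sphere 1 p -> p != 0.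
Proof.
move=> /sphereE h; apply/eqP => p0; move: h; rewrite p0 !mxE.
by rewrite expr0n /= !addr0 => /eqP; rewrite eq_sym oner_eq0.
Qed.

Lemma open_neq0 (V : normedModType R) : open [set q : V | q != 0].
Proof.
have -> : [set q : V | q != 0] = ~` [set 0].
  by apply/seteqP; split=> q /=; [move/eqP|move=> h; apply/eqP].
by rewrite openC; exact: accessible_closed_set1 (hausdorff_accessible (@norm_hausdorff _ V)) _.
Qed.

Lemma near_neq0 p : sphere 1 p -> \forall q \near p, q != 0.
Proof.
move=> /sphere_neq0 p0; exact: (open_nbhs_nbhs (conj (@open_neq0 _) p0)).
Qed.

Lemma radial_eq W (F G : E3 R -> W) q :
  (forall p, sphere 1 p -> F p = G p) -> q != 0 -> radial F q = radial G q.
Proof. by move=> FG q0; apply: FG; exact: normalize_sphere. Qed.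

Lemma dS_eq (W : normedModType R) (F G : E3 R -> W) p v :
  (forall p, sphere 1 p -> F p = G p) -> sphere 1 p -> dS F p v = dS G p v.
Proof.
move=> FG Sp; apply: near_eq_derive; apply: filterS (near_neq0 Sp).
by move=> q; exact: radial_eq.
Qed.

Lemma d2S_eq (W : normedModType R) (F G : E3 R -> W) p v w :
  (forall p, sphere 1 p -> F p = G p) -> sphere 1 p -> d2S F p v w = d2S G p v w.
Proof.
move=> FG Sp; apply: near_eq_derive; apply: filterS (near_neq0 Sp) => q q0.
apply: near_eq_derive.
apply: filterS (open_nbhs_nbhs (conj (@open_neq0 _) q0)) => r.
exact: radial_eq.
Qed.

Definition great_circle (p v : E3 R) (s : R) : E3 R := normalize (p + s *: v).

(** The radial extension at p + s v is the value of F at the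
    point of the great circle in the direction p + s v, so radial derivatives
    are derivatives of functions of one real variable. *)
Lemma dS_great_circle (W : normedModType R) (F : E3 R -> W) p v :
  dS F p v = 'D_1 (fun s : R => F (great_circle p v s)) 0.
Proof. by rewrite /dS -[p in LHS]addr0 -(scale0r v) derive_line. Qed.

Lemma d2S_great_circle (W : normedModType R) (F : E3 R -> W) p v :
  d2S F p v v = 'D_1 (fun r : R => 'D_1 (fun s : R => F (great_circle p v s)) r) 0.
Proof.
rewrite /d2S -[p in LHS]addr0 -(scale0r v) derive_line.
by apply: (congr1 (fun g : R -> W => 'D_1 g 0)); apply/funext => s; rewrite derive_line.
Qed.

(** The inverse of the norm of p + s v, for a unit vector p orthogonal to
    v and nu = |v|^2. *)
Definition rho (nu s : R) := (Num.sqrt (1 + nu * s ^+ 2))^-1.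

Lemma rho0 nu : rho nu 0 = 1.
Proof. by rewrite /rho expr0n mulr0 addr0 sqrtr1 invr1. Qed.

Lemma is_derive_rho (nu s : R) : 0 <= nu ->
  is_derive s (1 : R) (rho nu) (- nu * s * rho nu s ^+ 3).
Proof.
move=> nu0.
have D0 : 0 < 1 + nu * s ^+ 2 by rewrite ltr_pwDl// mulr_ge0// sqr_ge0.
have S0 : Num.sqrt (1 + nu * s ^+ 2) != 0 by rewrite gt_eqF// sqrtr_gt0.
have dq : is_derive s (1 : R) (fun s : R => 1 + nu * s ^+ 2) (nu * (2 * s)).
  by apply: is_derive_eq; rewrite /GRing.scale /=; ring.
have ds := @is_derive1_comp _ Num.sqrt _ s _ _ (is_derive1_sqrt D0) dq.
apply: is_derive_eq; first exact: (@is_deriveV _ (fun s => Num.sqrt (1 + nu * s ^+ 2)) s _ 1 S0 ds).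
by rewrite /rho /GRing.scale /=; field.
Qed.

Lemma great_circle_coord p v (s : R) j : sphere 1 p -> tangent p v ->
  great_circle p v s 0 j = rho (dot v v) s * (p 0 j + s * v 0 j).
Proof.
move=> Sp Tv; rewrite /great_circle /normalize !mxE; congr (_^-1 * _); congr Num.sqrt.
have := sphereE Sp; rewrite /tangent /= in Tv; move: Tv; rewrite !dotE !mxE.
move=> t n; rewrite -n; transitivity
 (p 0 0 ^+ 2 + p 0 1 ^+ 2 + p 0 2 ^+ 2 + 2 * s * (p 0 0 * v 0 0 + p 0 1 * v 0 1 + p 0 2 * v 0 2) +
  (v 0 0 * v 0 0 + v 0 1 * v 0 1 + v 0 2 * v 0 2) * s ^+ 2); first by ring.
by rewrite t mulr0 addr0.
Qed.

Definition dgreat_circle (p v : E3 R) (j : 'I_3) (s : R) :=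
  - dot v v * s * rho (dot v v) s ^+ 3 * (p 0 j + s * v 0 j)
  + rho (dot v v) s * v 0 j.

Lemma is_derive_great_circle p v (s : R) j : sphere 1 p -> tangent p v ->
  is_derive s (1 : R) (fun s => great_circle p v s 0 j) (dgreat_circle p v j s).
Proof.
move=> Sp Tv; under eq_fun do rewrite great_circle_coord//.
have dr := is_derive_rho s (dot_ge0 v).
apply: is_derive_eq.
by rewrite /dgreat_circle /GRing.scale /=; ring.
Qed.

Lemma great_circle0 p v j : sphere 1 p -> tangent p v -> great_circle p v 0 0 j = p 0 j.
Proof. by move=> Sp Tv; rewrite great_circle_coord// rho0 mul0r addr0 mul1r. Qed.

Lemma dgreat_circle0 p v j : dgreat_circle p v j 0 = v 0 j.
Proof. by rewrite /dgreat_circle rho0; ring. Qed.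

Lemma is_derive_dgreat_circle p v j :
  is_derive (0 : R) (1 : R) (dgreat_circle p v j) (- dot v v * p 0 j).
Proof.
have dr := is_derive_rho 0 (dot_ge0 v).
rewrite /dgreat_circle; apply: is_derive_eq.
by rewrite /GRing.scale /= !rho0; ring.
Qed.

Lemma great_circle_sphere p v s : sphere 1 p -> tangent p v -> sphere 1 (great_circle p v s).
Proof.
move=> Sp Tv; apply: normalize_sphere; apply/eqP => h.
have : dot p (p + s *: v) = 1.
  transitivity (dot p p + s * dot p v); first by rewrite !dotE !mxE; ring.
  by rewrite Tv mulr0 addr0; move: Sp; rewrite /sphere /= invr1.
by rewrite h dotE !mxE !mulr0 !addr0 => /eqP; rewrite eq_sym oner_eq0.
Qed.

End Sphere.

(** * Rotationally equivariant maps *)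

Section RotationalMaps.
Context {R : realType}.
Implicit Types (p q u v w : E3 R).

(** The vector (alpha z, h; beta conj(z), k) for alpha = A1 + i A2,
    beta = B1 + i B2 and z = y0 + i y1. *)
Definition rotv (A1 A2 H B1 B2 K y0 y1 : R) : E6 R :=
  pt (A1 * y0 - A2 * y1) (A2 * y0 + A1 * y1) H
     (B1 * y0 + B2 * y1) (B2 * y0 - B1 * y1) K.

Lemma is_derive_rotv (A1 A2 H B1 B2 K y0 y1 : R -> R)
    (A1' A2' H' B1' B2' K' y0' y1' : R) (s : R) :
  is_derive s (1 : R) A1 A1' -> is_derive s (1 : R) A2 A2' ->
  is_derive s (1 : R) H H' -> is_derive s (1 : R) B1 B1' ->
  is_derive s (1 : R) B2 B2' -> is_derive s (1 : R) K K' ->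
  is_derive s (1 : R) y0 y0' -> is_derive s (1 : R) y1 y1' ->
  is_derive s (1 : R)
    (fun r => rotv (A1 r) (A2 r) (H r) (B1 r) (B2 r) (K r) (y0 r) (y1 r))
    (rotv A1' A2' H' B1' B2' K' (y0 s) (y1 s) +
     rotv (A1 s) (A2 s) 0 (B1 s) (B2 s) 0 y0' y1').
Proof.
move=> hA1 hA2 hH hB1 hB2 hK hy0 hy1; rewrite /rotv ptD.
by apply: is_derive_pt => //; apply: is_derive_eq; rewrite /GRing.scale /=; ring.
Qed.

Variables A1 A2 H B1 B2 K : R -> R.

Definition rotmap p := let x := p 0 2 in
  rotv (A1 x) (A2 x) (H x) (B1 x) (B2 x) (K x) (p 0 0) (p 0 1).

Variables A1' A2' H' B1' B2' K' : R -> R.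

(** The differential at (z, x) of a rotationally equivariant map, applied
    to (w, xi): the profiles contribute their derivatives times xi, and the
    factor z contributes w. *)
Definition drot p v := let x := p 0 2 in let xi := v 0 2 in
  rotv (A1' x * xi) (A2' x * xi) (H' x * xi) (B1' x * xi) (B2' x * xi)
    (K' x * xi) (p 0 0) (p 0 1)
  + rotv (A1 x) (A2 x) 0 (B1 x) (B2 x) 0 (v 0 0) (v 0 1).

Definition derives_on (f f' : R -> R) := forall x : R, -1 <= x -> x <= 1 ->
  is_derive x (1 : R) f (f' x).

Hypotheses (dA1 : derives_on A1 A1') (dA2 : derives_on A2 A2')
  (dH : derives_on H H') (dB1 : derives_on B1 B1') (dB2 : derives_on B2 B2')
  (dK : derives_on K K').

Lemma sphere_itv p : sphere 1 p -> -1 <= p 0 2 <= 1.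
Proof.
move=> /sphereE h.
have a0 := sqr_ge0 (p 0 0); have a1 := sqr_ge0 (p 0 1).
by apply/andP; split; nra.
Qed.

Lemma derives_curve (f f' g : R -> R) (s g' : R) : derives_on f f' ->
  -1 <= g s <= 1 -> is_derive s (1 : R) g g' ->
  is_derive s (1 : R) (fun r => f (g r)) (f' (g s) * g').
Proof.
move=> df /andP[g1 g2] dg; exact: is_derive1_comp (df _ g1 g2) dg.
Qed.

Lemma is_derive_rotmap (q : R -> E3 R) (q' : E3 R) (s : R) : sphere 1 (q s) ->
  (forall j, is_derive s (1 : R) (fun r => q r 0 j) (q' 0 j)) ->
  is_derive s (1 : R) (fun r => rotmap (q r)) (drot (q s) q').
Proof.
move=> /sphere_itv Sq dq.
by apply: is_derive_rotv; try exact: dq; apply: derives_curve => //; exact: dq.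
Qed.

Lemma dS_rotmap p v : sphere 1 p -> tangent p v -> dS rotmap p v = drot p v.
Proof.
move=> Sp Tv; rewrite dS_great_circle.
have Sg := great_circle_sphere 0 Sp Tv.
have := @is_derive_rotmap (great_circle p v) v 0 Sg.
have -> : great_circle p v 0 = p.
  by apply/rowP => j; rewrite great_circle0.
case=> // j; have := is_derive_great_circle 0 j Sp Tv.
by rewrite dgreat_circle0.
Qed.

Variables A1'' A2'' H'' B1'' B2'' K'' : R -> R.
Hypotheses (ddA1 : derives_on A1' A1'') (ddA2 : derives_on A2' A2'')
  (ddH : derives_on H' H'') (ddB1 : derives_on B1' B1'')
  (ddB2 : derives_on B2' B2'') (ddK : derives_on K' K'').

(** The second derivative along the great circle with velocity v, along
    which x'' = - |v|^2 x and z'' = - |v|^2 z. *)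
Definition d2rot p v := let x := p 0 2 in let xi := v 0 2 in
  let D2 (f' f'' : R -> R) := f'' x * xi ^+ 2 - f' x * dot v v * x in
  rotv (D2 A1' A1'') (D2 A2' A2'') (D2 H' H'') (D2 B1' B1'') (D2 B2' B2'')
    (D2 K' K'') (p 0 0) (p 0 1)
  + 2 *: rotv (A1' x * xi) (A2' x * xi) 0 (B1' x * xi) (B2' x * xi) 0
      (v 0 0) (v 0 1)
  - dot v v *: rotv (A1 x) (A2 x) 0 (B1 x) (B2 x) 0 (p 0 0) (p 0 1).

Lemma d2S_rotmap p v : sphere 1 p -> tangent p v -> d2S rotmap p v v = d2rot p v.
Proof.
move=> Sp Tv; rewrite d2S_great_circle.
pose x (s : R) := great_circle p v s 0 2; pose x' := dgreat_circle p v 2.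
have dx s : is_derive s (1 : R) x (x' s) by exact: is_derive_great_circle.
have x1 s : -1 <= x s <= 1 by exact: sphere_itv (great_circle_sphere _ Sp Tv).
have -> : (fun r : R => 'D_1 (fun s : R => rotmap (great_circle p v s)) r) =
  (fun s : R => rotv (A1' (x s) * x' s) (A2' (x s) * x' s) (H' (x s) * x' s)
    (B1' (x s) * x' s) (B2' (x s) * x' s) (K' (x s) * x' s)
      (great_circle p v s 0 0) (great_circle p v s 0 1)
  + rotv (A1 (x s)) (A2 (x s)) 0 (B1 (x s)) (B2 (x s)) 0
      (dgreat_circle p v 0 s) (dgreat_circle p v 1 s)).
  apply/funext => s; have Sg := great_circle_sphere s Sp Tv.
  have [] := @is_derive_rotmap (great_circle p v)
     (pt3 (dgreat_circle p v 0 s) (dgreat_circle p v 1 s) (dgreat_circle p v 2 s)) s Sg.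
    by move=> j; have [->|->|->] := ord3P j; rewrite pt3E; exact: is_derive_great_circle.
  by move=> _ ->; rewrite /drot !pt3E.
have x0 : x 0 = p 0 2 by exact: great_circle0.
have x'0 : x' 0 = v 0 2 by exact: dgreat_circle0.
have d1 f f' : derives_on f f' ->
    is_derive (0 : R) (1 : R) (fun s => f (x s)) (f' (p 0 2) * v 0 2).
  by move=> df; rewrite -x0 -x'0; exact: derives_curve.
have d2 f f' : derives_on f f' -> is_derive (0 : R) (1 : R) (fun s => f (x s) * x' s)
    (f' (p 0 2) * v 0 2 ^+ 2 - f (p 0 2) * dot v v * p 0 2).
  move=> df; have h := d1 _ _ df; have h' := is_derive_dgreat_circle p v 2.
  apply: is_derive_eq.
  by rewrite /GRing.scale /= -/x' x0 x'0; ring.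
have d3 : is_derive (0 : R) (1 : R) (cst 0 : R -> R) 0 by exact: is_derive_cst.
have dg j : is_derive (0 : R) (1 : R) (fun s => great_circle p v s 0 j) (v 0 j).
  by have := is_derive_great_circle 0 j Sp Tv; rewrite dgreat_circle0.
have r1 := is_derive_rotv (d2 _ _ ddA1) (d2 _ _ ddA2) (d2 _ _ ddH) (d2 _ _ ddB1)
  (d2 _ _ ddB2) (d2 _ _ ddK) (dg 0) (dg 1).
have r2 := is_derive_rotv (d1 _ _ dA1) (d1 _ _ dA2) d3 (d1 _ _ dB1)
  (d1 _ _ dB2) d3 (is_derive_dgreat_circle p v 0) (is_derive_dgreat_circle p v 1).
have [_ ->] := is_deriveD r1 r2.
rewrite /d2rot !great_circle0// !dgreat_circle0 x0 x'0 /rotv !ptD !ptZ ptN !ptD.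
by congr pt; ring.
Qed.

End RotationalMaps.

Section LinearCombinations.
Context {R : comPzRingType}.
Implicit Types (l r c x y : R).

(** These lemmas prove an equation that follows from others by
    exhibiting the difference of its sides as a linear combination of theirs. *)
Lemma lincomb1 c1 {x1 y1 l r} : x1 = y1 -> l - r = c1 * (x1 - y1) -> l = r.
Proof. by move=> -> h; apply/eqP; rewrite -subr_eq0 h subrr mulr0. Qed.

Lemma lincomb2 c1 c2 {x1 y1 x2 y2 l r} : x1 = y1 -> x2 = y2 ->
  l - r = c1 * (x1 - y1) + c2 * (x2 - y2) -> l = r.
Proof.
by move=> -> -> h; apply/eqP; rewrite -subr_eq0 h !subrr !mulr0 addr0.
Qed.

Lemma lincomb3 c1 c2 c3 {x1 y1 x2 y2 x3 y3 l r} : x1 = y1 -> x2 = y2 -> x3 = y3 ->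
  l - r = c1 * (x1 - y1) + c2 * (x2 - y2) + c3 * (x3 - y3) -> l = r.
Proof.
by move=> -> -> -> h; apply/eqP; rewrite -subr_eq0 h !subrr !mulr0 !addr0.
Qed.

Lemma lincomb4 c1 c2 c3 c4 {x1 y1 x2 y2 x3 y3 x4 y4 l r} :
  x1 = y1 -> x2 = y2 -> x3 = y3 -> x4 = y4 ->
  l - r = c1 * (x1 - y1) + c2 * (x2 - y2) + c3 * (x3 - y3) + c4 * (x4 - y4) ->
  l = r.
Proof.
by move=> -> -> -> -> h; apply/eqP; rewrite -subr_eq0 h !subrr !mulr0 !addr0.
Qed.

Lemma lincomb5 c1 c2 c3 c4 c5 {x1 y1 x2 y2 x3 y3 x4 y4 x5 y5 l r} :
  x1 = y1 -> x2 = y2 -> x3 = y3 -> x4 = y4 -> x5 = y5 ->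
  l - r = c1 * (x1 - y1) + c2 * (x2 - y2) + c3 * (x3 - y3) + c4 * (x4 - y4)
          + c5 * (x5 - y5) -> l = r.
Proof.
by move=> -> -> -> -> -> h; apply/eqP; rewrite -subr_eq0 h !subrr !mulr0 !addr0.
Qed.

End LinearCombinations.
Arguments lincomb1 {R} c1 {x1 y1 l r}.
Arguments lincomb2 {R} c1 c2 {x1 y1 x2 y2 l r}.
Arguments lincomb3 {R} c1 c2 c3 {x1 y1 x2 y2 x3 y3 l r}.
Arguments lincomb4 {R} c1 c2 c3 c4 {x1 y1 x2 y2 x3 y3 x4 y4 l r}.
Arguments lincomb5 {R} c1 c2 c3 c4 c5 {x1 y1 x2 y2 x3 y3 x4 y4 x5 y5 l r}.

Section RotationalGeometry.
Context {R : realType}.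
Implicit Types (p q u v w : E3 R).

Lemma tangentE p v : tangent p v ->
  p 0 0 * v 0 0 + p 0 1 * v 0 1 + p 0 2 * v 0 2 = 0.
Proof. by rewrite /tangent /= dotE. Qed.

(** Conformality.  In the expansion, Re (conj(z) w) = - x xi turns the
    mixed terms into multiples of xi chi, and the two Im (conj(z) w) terms
    cancel by the first hypothesis because the second factor carries
    conj(z). *)
Lemma dot_rot (a1 a2 b1 b2 a1' a2' h' b1' b2' k' p0 p1 x v0 v1 xi w0 w1 chi : R) :
  a1 * a2' - a2 * a1' = b1 * b2' - b2 * b1' ->
  (a1' ^+ 2 + a2' ^+ 2 + b1' ^+ 2 + b2' ^+ 2) * (1 - x ^+ 2)
  - 2 * x * (a1 * a1' + a2 * a2' + b1 * b1' + b2 * b2')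
  + h' ^+ 2 + k' ^+ 2 = a1 ^+ 2 + a2 ^+ 2 + b1 ^+ 2 + b2 ^+ 2 ->
  p0 ^+ 2 + p1 ^+ 2 + x ^+ 2 = 1 ->
  p0 * v0 + p1 * v1 + x * xi = 0 -> p0 * w0 + p1 * w1 + x * chi = 0 ->
  dot2 (rotv (a1' * xi) (a2' * xi) (h' * xi) (b1' * xi) (b2' * xi) (k' * xi) p0 p1
        + rotv a1 a2 0 b1 b2 0 v0 v1)
       (rotv (a1' * chi) (a2' * chi) (h' * chi) (b1' * chi) (b2' * chi) (k' * chi)
         p0 p1 + rotv a1 a2 0 b1 b2 0 w0 w1)
  = (a1 ^+ 2 + a2 ^+ 2 + b1 ^+ 2 + b2 ^+ 2) * (v0 * w0 + v1 * w1 + xi * chi).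
Proof.
move=> im ode hp hv hw; rewrite /rotv !ptD dot2_pt.
apply: (lincomb5
  ((a1' ^+ 2 + a2' ^+ 2 + b1' ^+ 2 + b2' ^+ 2) * xi * chi) (xi * chi)
  ((a1 * a1' + a2 * a2' + b1 * b1' + b2 * b2') * chi)
  ((a1 * a1' + a2 * a2' + b1 * b1' + b2 * b2') * xi)
  (xi * (p0 * w1 - p1 * w0) + chi * (p0 * v1 - p1 * v0)) hp ode hv hw im).
ring.
Qed.

Lemma dot2_drot (A1 A2 B1 B2 A1' A2' H' B1' B2' K' : R -> R) p v w :
  let x := p 0 2 in
  A1 x * A2' x - A2 x * A1' x = B1 x * B2' x - B2 x * B1' x ->
  (A1' x ^+ 2 + A2' x ^+ 2 + B1' x ^+ 2 + B2' x ^+ 2) * (1 - x ^+ 2)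
  - 2 * x * (A1 x * A1' x + A2 x * A2' x + B1 x * B1' x + B2 x * B2' x)
  + H' x ^+ 2 + K' x ^+ 2 = A1 x ^+ 2 + A2 x ^+ 2 + B1 x ^+ 2 + B2 x ^+ 2 ->
  sphere 1 p -> tangent p v -> tangent p w ->
  dot2 (drot A1 A2 B1 B2 A1' A2' H' B1' B2' K' p v)
       (drot A1 A2 B1 B2 A1' A2' H' B1' B2' K' p w)
  = (A1 x ^+ 2 + A2 x ^+ 2 + B1 x ^+ 2 + B2 x ^+ 2) * dot v w.
Proof.
move=> x im ode /sphereE hp /tangentE hv /tangentE hw.
by rewrite /drot (dot_rot im ode hp hv hw) dotE.
Qed.

Definition det3 (a0 a1 a2 b0 b1 b2 c0 c1 c2 : R) :=
  (a1 * b2 - a2 * b1) * c0 + (a2 * b0 - a0 * b2) * c1 + (a0 * b1 - a1 * b0) * c2.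

(** On a sphere of squared radius r, the form det (P, ., .) pulls back by
    (alpha z, h) to r h' times that of the unit sphere.  The last two hypotheses
    say that the image lies on the sphere, and the derivative of this fact. *)
Lemma det3_rot (a1 a2 h a1' a2' h' p0 p1 x v0 v1 xi w0 w1 chi r : R) :
  p0 ^+ 2 + p1 ^+ 2 + x ^+ 2 = 1 ->
  p0 * v0 + p1 * v1 + x * xi = 0 -> p0 * w0 + p1 * w1 + x * chi = 0 ->
  (a1 ^+ 2 + a2 ^+ 2) * (1 - x ^+ 2) + h ^+ 2 = r ->
  (a1 * a1' + a2 * a2') * (1 - x ^+ 2) - x * (a1 ^+ 2 + a2 ^+ 2) + h * h' = 0 ->
  det3 (a1 * p0 - a2 * p1) (a2 * p0 + a1 * p1) h
    (a1' * xi * p0 - a2' * xi * p1 + (a1 * v0 - a2 * v1))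
    (a2' * xi * p0 + a1' * xi * p1 + (a2 * v0 + a1 * v1)) (h' * xi)
    (a1' * chi * p0 - a2' * chi * p1 + (a1 * w0 - a2 * w1))
    (a2' * chi * p0 + a1' * chi * p1 + (a2 * w0 + a1 * w1)) (h' * chi)
  = r * h' * det3 p0 p1 x v0 v1 xi w0 w1 chi.
Proof.
move=> hp hv hw hr hd; rewrite /det3.
(* G, T and d are [w_v, w_w], xi [z, w_w] - chi [z, w_v] and det (p, v, w),
   for the planar determinant [_, _] *)
set G := v0 * w1 - v1 * w0.
set T := xi * (p0 * w1 - p1 * w0) - chi * (p0 * v1 - p1 * v0).
pose d := x * G - T.
have GE : G = d * x.
  apply: (lincomb3 (- G) (p0 * w1 - p1 * w0) (- (p0 * v1 - p1 * v0)) hp hv hw).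
  by rewrite /d /T /G; ring.
have TE : T = - d * (1 - x ^+ 2).
  by apply: (lincomb1 x GE); rewrite /d; ring.
transitivity (h * (a1 * a1' + a2 * a2') * T + h * (a1 ^+ 2 + a2 ^+ 2) * G
  - h' * (a1 ^+ 2 + a2 ^+ 2) * T).
  apply: (lincomb2 (h * (a1 * a2' - a2 * a1') * chi)
    (- (h * (a1 * a2' - a2 * a1') * xi)) hv hw).
  by rewrite /T /G; ring.
transitivity (r * h' * d); last by rewrite /d /T /G; ring.
rewrite TE GE.
by apply: (lincomb2 (h' * d) (- h * d) hr hd); ring.
Qed.

Lemma omegaE (c1 c2 : R) (P U V : E6 R) : omega c1 c2 P U V =
  Num.sqrt c1 * det3 (P.1 0 0) (P.1 0 1) (P.1 0 2) (U.1 0 0) (U.1 0 1) (U.1 0 2)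
    (V.1 0 0) (V.1 0 1) (V.1 0 2) +
  Num.sqrt c2 * det3 (P.2 0 0) (P.2 0 1) (P.2 0 2) (U.2 0 0) (U.2 0 1) (U.2 0 2)
    (V.2 0 0) (V.2 0 1) (V.2 0 2).
Proof.
rewrite /omega /dot2 /J /= !crossE !pt3Z !dotE !pt3E /det3; ring.
Qed.

(** The conjugation in the second factor reverses the orientation,
    so the two pull-backs cancel when sqrt(c1) r1 h' = sqrt(c2) r2 k'. *)
Lemma omega_drot (c1 c2 : R) (A1 A2 H B1 B2 K A1' A2' H' B1' B2' K' : R -> R)
    p v w (r1 r2 : R) : let x := p 0 2 in
  (A1 x ^+ 2 + A2 x ^+ 2) * (1 - x ^+ 2) + H x ^+ 2 = r1 ->
  (A1 x * A1' x + A2 x * A2' x) * (1 - x ^+ 2) - x * (A1 x ^+ 2 + A2 x ^+ 2)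
    + H x * H' x = 0 ->
  (B1 x ^+ 2 + B2 x ^+ 2) * (1 - x ^+ 2) + K x ^+ 2 = r2 ->
  (B1 x * B1' x + B2 x * B2' x) * (1 - x ^+ 2) - x * (B1 x ^+ 2 + B2 x ^+ 2)
    + K x * K' x = 0 ->
  Num.sqrt c1 * (r1 * H' x) = Num.sqrt c2 * (r2 * K' x) ->
  sphere 1 p -> tangent p v -> tangent p w ->
  omega c1 c2 (rotmap A1 A2 H B1 B2 K p)
    (drot A1 A2 B1 B2 A1' A2' H' B1' B2' K' p v)
    (drot A1 A2 B1 B2 A1' A2' H' B1' B2' K' p w) = 0.
Proof.
move=> x hr1 hd1 hr2 hd2 hk /sphereE hp /tangentE hv /tangentE hw.
rewrite /rotmap /drot /rotv !ptD omegaE /pt /= !pt3E -/x; rewrite -/x in hp hv hw.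
rewrite !addr0 (det3_rot hp hv hw hr1 hd1).
have hp' : p 0 0 ^+ 2 + (- p 0 1) ^+ 2 + x ^+ 2 = 1 by rewrite sqrrN.
have hv' : p 0 0 * v 0 0 + - p 0 1 * - v 0 1 + x * v 0 2 = 0 by rewrite mulrNN.
have hw' : p 0 0 * w 0 0 + - p 0 1 * - w 0 1 + x * w 0 2 = 0 by rewrite mulrNN.
have := det3_rot hp' hv' hw' hr2 hd2; rewrite !mulrN !opprK => ->.
rewrite /det3.
set d := (p 0 1 * _ - _) * _ + _ + _; set d' := (X in _ + _ * (_ * _ * X)).
have -> : d' = - d by rewrite /d /d'; ring.
by rewrite mulrN mulrN !mulrA; move: hk; rewrite !mulrA => ->; ring.
Qed.

(** The vectors sqrt(m) e1, sqrt(m) e2 and p are the rows of an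
    orthogonal matrix, whose columns are therefore orthonormal too. *)
Lemma frame_sum (F : E3 R -> E6 R) p e1 e2 (m : R) : 0 < m -> sphere 1 p ->
  (forall v w, tangent p v -> tangent p w ->
     dot2 (dS F p v) (dS F p w) = m * dot v w) ->
  frame F p e1 e2 -> forall j k,
  e1 0 j * e1 0 k + e2 0 j * e2 0 k = m^-1 * ((j == k)%:R - p 0 j * p 0 k).
Proof.
move=> m0 Sp conf [t1 t2 f11 f22 f12] j k.
have d11 := etrans (esym (conf _ _ t1 t1)) f11.
have d22 := etrans (esym (conf _ _ t2 t2)) f22.
have d12 := etrans (esym (conf _ _ t1 t2)) f12.
have s0 : Num.sqrt m != 0 by rewrite gt_eqF// sqrtr_gt0.
have ss : Num.sqrt m * Num.sqrt m = m by rewrite -expr2 sqr_sqrtr// ltW.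
(* the rows are orthonormal for the Euclidean product *)
pose Mx : 'M[R]_3 := \matrix_(i, j)
  [:: Num.sqrt m * e1 0 j; Num.sqrt m * e2 0 j; p 0 j]`_i.
have t1' := tangentE t1; have t2' := tangentE t2.
rewrite !dotE in d11 d22 d12; have hp := sphereE Sp; rewrite !expr2 in hp.
have MMt : Mx *m Mx^T = 1%:M.
  apply/matrixP => i l; rewrite !mxE sum3.
  have [->|->|->] := ord3P i; have [->|->|->] := ord3P l; rewrite !mxE /=.
  - by apply: (lincomb2 (e1 0 0 * e1 0 0 + e1 0 1 * e1 0 1 + e1 0 2 * e1 0 2) 1 ss d11); ring.
  - by apply: (lincomb2 (e1 0 0 * e2 0 0 + e1 0 1 * e2 0 1 + e1 0 2 * e2 0 2) 1 ss d12); ring.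
  - by apply: (lincomb1 (Num.sqrt m) t1'); ring.
  - by apply: (lincomb2 (e1 0 0 * e2 0 0 + e1 0 1 * e2 0 1 + e1 0 2 * e2 0 2) 1 ss d12); ring.
  - by apply: (lincomb2 (e2 0 0 * e2 0 0 + e2 0 1 * e2 0 1 + e2 0 2 * e2 0 2) 1 ss d22); ring.
  - by apply: (lincomb1 (Num.sqrt m) t2'); ring.
  - by apply: (lincomb1 (Num.sqrt m) t1'); ring.
  - by apply: (lincomb1 (Num.sqrt m) t2'); ring.
  - by apply: (lincomb1 1 hp); ring.
have := mulmx1C MMt => /matrixP/(_ j k); rewrite !mxE sum3 !mxE /= => h.
have m0' : m != 0 by rewrite gt_eqF.
by rewrite -h -[X in X^-1]ss; field.
Qed.

End RotationalGeometry.

(** * The profile functions of the family *)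

Section Profiles.
Context {R : realType}.
Variables a b e : R.
Hypotheses (a0 : 0 < a) (b0 : 0 < b) (e0 : 0 < e) (eE : e ^+ 2 = a ^+ 2 - b ^+ 2).
Variables s c : R.
Hypothesis cE : c ^+ 2 = 1 + s ^+ 2.

(** Here a, b and e stand for the square roots of c1, c2 and c1 - c2, and s
    and c for sinh t and cosh t. *)
Definition DD (x : R) := (a ^+ 2 * c ^+ 2 - b ^+ 2 * s ^+ 2)
  + (a ^+ 2 * s ^+ 2 - b ^+ 2 * c ^+ 2) * x ^+ 2.
Definition kap := a ^+ 2 * s ^+ 2 - b ^+ 2 * c ^+ 2.
(** The profiles of the family: alpha = profA1 + i profA2 equals
    (2 e / D) (s + i c x), and beta = profB1 + i profB2 equals
    (2 e / D) (c + i s x). *)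
Definition profA1 (x : R) := 2 * e * s / DD x.
Definition profA2 (x : R) := 2 * e * c * x / DD x.
(** The height of the first factor, rewritten with the help of D. *)
Definition profH (x : R) := a^-1 - 2 * a * (1 - x ^+ 2) / DD x.
Definition profB1 (x : R) := 2 * e * c / DD x.
Definition profB2 (x : R) := 2 * e * s * x / DD x.
Definition profK (x : R) := b^-1 - 2 * b * (1 - x ^+ 2) / DD x.

Definition profA1' (x : R) := - (4 * e * s * kap * x) / DD x ^+ 2.
Definition profA2' (x : R) := 2 * e * c * (DD x - 2 * kap * x ^+ 2) / DD x ^+ 2.
Definition profH' (x : R) := 4 * a * e ^+ 2 * (c ^+ 2 + s ^+ 2) * x / DD x ^+ 2.
Definition profB1' (x : R) := - (4 * e * c * kap * x) / DD x ^+ 2.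
Definition profB2' (x : R) := 2 * e * s * (DD x - 2 * kap * x ^+ 2) / DD x ^+ 2.
Definition profK' (x : R) := 4 * b * e ^+ 2 * (c ^+ 2 + s ^+ 2) * x / DD x ^+ 2.

(** This shows that D is positive for |x| <= 1, and is the form of D
    suited to the area. *)
Lemma DD_uv x : 2 * DD x = e ^+ 2 * (c ^+ 2 + s ^+ 2) * (1 + x ^+ 2)
  + (a ^+ 2 + b ^+ 2) * (1 - x ^+ 2).
Proof. by rewrite /DD cE eE; ring. Qed.

Lemma DD_kap x : DD x + kap * (1 - x ^+ 2) = (a ^+ 2 - b ^+ 2) * (c ^+ 2 + s ^+ 2).
Proof. by rewrite /DD /kap; ring. Qed.

Lemma DD_gt0 x : -1 <= x -> x <= 1 -> 0 < DD x.
Proof.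
move=> x1 x2; have := DD_uv x.
have C0 : 0 < c ^+ 2 + s ^+ 2.
  by rewrite cE; have := sqr_ge0 s; lra.
have x20 : 0 <= 1 - x ^+ 2 by nra.
have p1 : 0 < e ^+ 2 * (c ^+ 2 + s ^+ 2) * (1 + x ^+ 2).
  by rewrite !mulr_gt0 ?exprn_gt0//; have := sqr_ge0 x; lra.
have p2 : 0 <= (a ^+ 2 + b ^+ 2) * (1 - x ^+ 2).
  by rewrite mulr_ge0// addr_ge0 ?sqr_ge0.
lra.
Qed.

Lemma is_derive_quot (N N' : R -> R) (x : R) : -1 <= x -> x <= 1 ->
  is_derive x (1 : R) N (N' x) ->
  is_derive x (1 : R) (fun y => N y / DD y)
    ((N' x * DD x - N x * (2 * kap * x)) / DD x ^+ 2).
Proof.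
move=> x1 x2 dN; have D0 : DD x != 0 by rewrite gt_eqF// DD_gt0.
have dD : is_derive x (1 : R) DD (2 * kap * x).
  by rewrite /DD; apply: is_derive_eq; rewrite /GRing.scale /= /kap; ring.
have dV := @is_deriveV _ DD x _ 1 D0 dD.
by apply: is_derive_eq; rewrite /GRing.scale /=; field.
Qed.

Lemma derives_A1 : derives_on profA1 profA1'.
Proof.
move=> x x1 x2; have D0 : DD x != 0 by rewrite gt_eqF// DD_gt0.
have h := @is_derive_quot (fun=> 2 * e * s) (fun=> 0) x x1 x2 (is_derive_cst _ _ _).
by apply: (is_derive_eq (f := profA1) h); rewrite /profA1' /=; field.
Qed.

Lemma derives_B1 : derives_on profB1 profB1'.
Proof.
move=> x x1 x2; have D0 : DD x != 0 by rewrite gt_eqF// DD_gt0.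
have h := @is_derive_quot (fun=> 2 * e * c) (fun=> 0) x x1 x2 (is_derive_cst _ _ _).
by apply: (is_derive_eq (f := profB1) h); rewrite /profB1' /=; field.
Qed.

Lemma derives_A2 : derives_on profA2 profA2'.
Proof.
move=> x x1 x2; have D0 : DD x != 0 by rewrite gt_eqF// DD_gt0.
have d : is_derive x (1 : R) (fun x => 2 * e * c * x) (2 * e * c).
  by apply: is_derive_eq; rewrite /GRing.scale /=; ring.
have h := @is_derive_quot _ (fun=> 2 * e * c) x x1 x2 d.
by apply: (is_derive_eq (f := profA2) h); rewrite /profA2' /=; field.
Qed.

Lemma derives_B2 : derives_on profB2 profB2'.
Proof.
move=> x x1 x2; have D0 : DD x != 0 by rewrite gt_eqF// DD_gt0.
have d : is_derive x (1 : R) (fun x => 2 * e * s * x) (2 * e * s).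
  by apply: is_derive_eq; rewrite /GRing.scale /=; ring.
have h := @is_derive_quot _ (fun=> 2 * e * s) x x1 x2 d.
by apply: (is_derive_eq (f := profB2) h); rewrite /profB2' /=; field.
Qed.

Lemma derives_H : derives_on profH profH'.
Proof.
move=> x x1 x2; have D0 : DD x != 0 by rewrite gt_eqF// DD_gt0.
have d : is_derive x (1 : R) (fun x => 2 * a * (1 - x ^+ 2)) (- (4 * a * x)).
  by apply: is_derive_eq; rewrite /GRing.scale /=; ring.
have dq := @is_derive_quot _ (fun x => - (4 * a * x)) x x1 x2 d.
rewrite /profH; apply: is_derive_eq.
by apply: (lincomb2 (- (4 * a * (c ^+ 2 + s ^+ 2) * x / DD x ^+ 2))
  (4 * a * x / DD x ^+ 2) eE (DD_kap x)); rewrite /profH'; field.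
Qed.

Lemma derives_K : derives_on profK profK'.
Proof.
move=> x x1 x2; have D0 : DD x != 0 by rewrite gt_eqF// DD_gt0.
have d : is_derive x (1 : R) (fun x => 2 * b * (1 - x ^+ 2)) (- (4 * b * x)).
  by apply: is_derive_eq; rewrite /GRing.scale /=; ring.
have dq := @is_derive_quot _ (fun x => - (4 * b * x)) x x1 x2 d.
rewrite /profK; apply: is_derive_eq.
by apply: (lincomb2 (- (4 * b * (c ^+ 2 + s ^+ 2) * x / DD x ^+ 2))
  (4 * b * x / DD x ^+ 2) eE (DD_kap x)); rewrite /profK'; field.
Qed.

End Profiles.

Section ProfileIdentities.
Context {R : realType}.
Variables a b e : R.
Hypotheses (a0 : 0 < a) (b0 : 0 < b) (e0 : 0 < e) (eE : e ^+ 2 = a ^+ 2 - b ^+ 2).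
Variables s c : R.
Hypothesis cE : c ^+ 2 = 1 + s ^+ 2.
Variable x : R.
Hypotheses (x1 : -1 <= x) (x2 : x <= 1).

Let aE : a ^+ 2 = b ^+ 2 + e ^+ 2. Proof. by rewrite eE; ring. Qed.
Let D := DD a b s c x.
Let D0 : D != 0. Proof. by rewrite gt_eqF// (DD_gt0 e0 eE cE). Qed.
Let DE : D = b ^+ 2 * (1 - x ^+ 2) + e ^+ 2 * (1 + s ^+ 2) + (e * s * x) ^+ 2.
Proof. by rewrite /D /DD cE aE; ring. Qed.
Let kE : kap a b s c = e ^+ 2 * s ^+ 2 - b ^+ 2.
Proof. by rewrite /kap cE aE; ring. Qed.
Let an0 : a != 0. Proof. by rewrite gt_eqF. Qed.
Let bn0 : b != 0. Proof. by rewrite gt_eqF. Qed.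

Notation A1 := (profA1 a b e s c).
Notation A2 := (profA2 a b e s c).
Notation H := (profH a b s c).
Notation B1 := (profB1 a b e s c).
Notation B2 := (profB2 a b e s c).
Notation K := (profK a b s c).
Notation A1' := (profA1' a b e s c).
Notation A2' := (profA2' a b e s c).
Notation H' := (profH' a b e s c).
Notation B1' := (profB1' a b e s c).
Notation B2' := (profB2' a b e s c).
Notation K' := (profK' a b e s c).

(** The conformal factor of the induced metric. *)
Definition mfac (x : R) := 4 * e ^+ 2 * (c ^+ 2 + s ^+ 2) * (1 + x ^+ 2)
  / DD a b s c x ^+ 2.

Lemma profile_m : A1 x ^+ 2 + A2 x ^+ 2 + B1 x ^+ 2 + B2 x ^+ 2 = mfac x.
Proof. by rewrite /profA1 /profA2 /profB1 /profB2 /mfac -/D; field. Qed.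

Lemma profile_im : A1 x * A2' x - A2 x * A1' x = B1 x * B2' x - B2 x * B1' x.
Proof. by rewrite /profA1 /profA2 /profB1 /profB2 /profA1' /profA2' /profB1' /profB2' -/D; field. Qed.

Lemma profile_sphereA : (A1 x ^+ 2 + A2 x ^+ 2) * (1 - x ^+ 2) + H x ^+ 2 = (a ^+ 2)^-1.
Proof.
have h : e ^+ 2 * (s ^+ 2 + c ^+ 2 * x ^+ 2) + a ^+ 2 * (1 - x ^+ 2) - D = 0.
  by rewrite DE cE aE; ring.
rewrite /profA1 /profA2 /profH -/D.
apply: (lincomb1 (4 * (1 - x ^+ 2) / D ^+ 2) h).
field. by rewrite D0.
Qed.

Lemma profile_sphereB : (B1 x ^+ 2 + B2 x ^+ 2) * (1 - x ^+ 2) + K x ^+ 2 = (b ^+ 2)^-1.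
Proof.
have h : e ^+ 2 * (c ^+ 2 + s ^+ 2 * x ^+ 2) + b ^+ 2 * (1 - x ^+ 2) - D = 0.
  by rewrite DE cE; ring.
rewrite /profB1 /profB2 /profK -/D.
apply: (lincomb1 (4 * (1 - x ^+ 2) / D ^+ 2) h).
field. by rewrite D0.
Qed.

(** The derivative in x of the preceding kind of identity, as
    needed for the pull-back of the area form. *)
Lemma profile_dsphereA : (A1 x * A1' x + A2 x * A2' x) * (1 - x ^+ 2)
  - x * (A1 x ^+ 2 + A2 x ^+ 2) + H x * H' x = 0.
Proof.
rewrite /profA1 /profA2 /profH /profA1' /profA2' /profH' -/D kE.
have D0' := D0; move: D0'; rewrite DE => D0'.
field: cE aE.
by rewrite D0' ?an0 ?bn0.
Qed.

Lemma profile_dsphereB : (B1 x * B1' x + B2 x * B2' x) * (1 - x ^+ 2)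
  - x * (B1 x ^+ 2 + B2 x ^+ 2) + K x * K' x = 0.
Proof.
rewrite /profB1 /profB2 /profK /profB1' /profB2' /profK' -/D kE.
have D0' := D0; move: D0'; rewrite DE => D0'.
field: cE aE.
by rewrite D0' ?an0 ?bn0.
Qed.

Lemma profile_ode :
  (A1' x ^+ 2 + A2' x ^+ 2 + B1' x ^+ 2 + B2' x ^+ 2) * (1 - x ^+ 2)
  - 2 * x * (A1 x * A1' x + A2 x * A2' x + B1 x * B1' x + B2 x * B2' x)
  + H' x ^+ 2 + K' x ^+ 2 = A1 x ^+ 2 + A2 x ^+ 2 + B1 x ^+ 2 + B2 x ^+ 2.
Proof.
rewrite /profA1 /profA2 /profH /profB1 /profB2 /profK /profA1' /profA2' /profH' /profB1' /profB2' /profK' -/D kE.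
have D0' := D0; move: D0'; rewrite DE => D0'.
field: cE aE.
by rewrite D0' ?an0 ?bn0.
Qed.

End ProfileIdentities.

Section ProfileTime.
Context {R : realType}.
Variables a b e : R.
Hypotheses (a0 : 0 < a) (b0 : 0 < b) (e0 : 0 < e) (eE : e ^+ 2 = a ^+ 2 - b ^+ 2).
Variables s c : R.
Hypothesis cE : c ^+ 2 = 1 + s ^+ 2.
Variable x : R.
Hypotheses (x1 : -1 <= x) (x2 : x <= 1).

Let aE : a ^+ 2 = b ^+ 2 + e ^+ 2. Proof. by rewrite eE; ring. Qed.
Let D := DD a b s c x.
Let D0 : D != 0. Proof. by rewrite gt_eqF// (DD_gt0 e0 eE cE). Qed.
Let DE : D = b ^+ 2 * (1 - x ^+ 2) + e ^+ 2 * (1 + s ^+ 2) + (e * s * x) ^+ 2.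
Proof. by rewrite /D /DD cE aE; ring. Qed.
Let D0' : b ^+ 2 * (1 - x ^+ 2) + e ^+ 2 * (1 + s ^+ 2) + (e * s * x) ^+ 2 != 0.
Proof. by rewrite -DE D0. Qed.
Let kE : kap a b s c = e ^+ 2 * s ^+ 2 - b ^+ 2.
Proof. by rewrite /kap cE aE; ring. Qed.
Let an0 : a != 0. Proof. by rewrite gt_eqF. Qed.
Let bn0 : b != 0. Proof. by rewrite gt_eqF. Qed.
Let u0 : 1 + x ^+ 2 != 0.
Proof. by rewrite gt_eqF//; have := sqr_ge0 x; lra. Qed.
Let C0 : 1 + 2 * s ^+ 2 != 0.
Proof. by rewrite gt_eqF//; have := sqr_ge0 s; lra. Qed.

Notation A1 := (profA1 a b e s c).
Notation A2 := (profA2 a b e s c).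
Notation H := (profH a b s c).
Notation B1 := (profB1 a b e s c).
Notation B2 := (profB2 a b e s c).
Notation K := (profK a b s c).
Notation A1' := (profA1' a b e s c).
Notation A2' := (profA2' a b e s c).
Notation H' := (profH' a b e s c).
Notation B1' := (profB1' a b e s c).
Notation B2' := (profB2' a b e s c).
Notation K' := (profK' a b e s c).

Definition dt_DD (x : R) := 2 * e ^+ 2 * s * c * (1 + x ^+ 2).
Definition dt_profA1 (x : R) := 2 * e * (c * DD a b s c x - s * dt_DD x) / DD a b s c x ^+ 2.
Definition dt_profA2 (x : R) := 2 * e * x * (s * DD a b s c x - c * dt_DD x) / DD a b s c x ^+ 2.
Definition dt_profH (x : R) := 2 * a * (1 - x ^+ 2) * dt_DD x / DD a b s c x ^+ 2.
Definition dt_profB1 (x : R) := 2 * e * (s * DD a b s c x - c * dt_DD x) / DD a b s c x ^+ 2.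
Definition dt_profB2 (x : R) := 2 * e * x * (c * DD a b s c x - s * dt_DD x) / DD a b s c x ^+ 2.
Definition dt_profK (x : R) := 2 * b * (1 - x ^+ 2) * dt_DD x / DD a b s c x ^+ 2.

(** With E the height gradient and T the rotation field, the velocity of
    the family is dF(Y) + J dF(X) for X = coefX E and
    Y = coefY_meridian E + coefY_rotation T. *)
Definition coefX (x : R) := (1 - x ^+ 2) / (1 + x ^+ 2).
Definition coefY_meridian (x : R) := 4 * s * c * x / ((1 + x ^+ 2) * (1 + 2 * s ^+ 2)).
Definition coefY_rotation (x : R) := - (2 * x) / ((1 + x ^+ 2) * (1 + 2 * s ^+ 2)).

Ltac solve_profile :=
  rewrite /dt_profA1 /dt_profA2 /dt_profH /dt_profB1 /dt_profB2 /dt_profK /dt_DD /coefX /coefY_meridian /coefY_rotation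
    /profA1 /profA2 /profH /profB1 /profB2 /profK /profA1' /profA2' /profH' /profB1' /profB2' /profK' -/D kE;
  rewrite DE; field: cE aE;
  rewrite ?D0' ?an0 ?bn0 ?u0 ?C0 //.

(** The coefficients of z, and the heights, in the decomposition of
    the velocity: there is one identity for each of the six profiles. *)
Lemma profile_dtA1 : dt_profA1 x
  - coefX x * a * (A2 x * (H' x * (1 - x ^+ 2)) - H x * (A2' x * (1 - x ^+ 2) - x * A2 x))
  = coefY_meridian x * (A1' x * (1 - x ^+ 2) - x * A1 x) + coefY_rotation x * (- A2 x).
Proof. solve_profile. Qed.

Lemma profile_dtA2 : dt_profA2 x
  + coefX x * a * (A1 x * (H' x * (1 - x ^+ 2)) - H x * (A1' x * (1 - x ^+ 2) - x * A1 x))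
  = coefY_meridian x * (A2' x * (1 - x ^+ 2) - x * A2 x) + coefY_rotation x * A1 x.
Proof. solve_profile. Qed.

Lemma profile_dtH : dt_profH x
  - coefX x * a * ((A1 x * (A2' x * (1 - x ^+ 2) - x * A2 x)
                 - A2 x * (A1' x * (1 - x ^+ 2) - x * A1 x)) * (1 - x ^+ 2))
  = coefY_meridian x * (H' x * (1 - x ^+ 2)).
Proof. solve_profile. Qed.

Lemma profile_dtB1 : dt_profB1 x
  - coefX x * b * (B2 x * (K' x * (1 - x ^+ 2)) - K x * (B2' x * (1 - x ^+ 2) - x * B2 x))
  = coefY_meridian x * (B1' x * (1 - x ^+ 2) - x * B1 x) + coefY_rotation x * B2 x.
Proof. solve_profile. Qed.

Lemma profile_dtB2 : dt_profB2 x
  + coefX x * b * (B1 x * (K' x * (1 - x ^+ 2)) - K x * (B1' x * (1 - x ^+ 2) - x * B1 x))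
  = coefY_meridian x * (B2' x * (1 - x ^+ 2) - x * B2 x) + coefY_rotation x * (- B1 x).
Proof. solve_profile. Qed.

Lemma profile_dtK : dt_profK x
  - coefX x * b * ((B1 x * (B2' x * (1 - x ^+ 2) - x * B2 x)
                 - B2 x * (B1' x * (1 - x ^+ 2) - x * B1 x)) * (1 - x ^+ 2))
  = coefY_meridian x * (K' x * (1 - x ^+ 2)).
Proof. solve_profile. Qed.

End ProfileTime.

(** * Primitives and hyperbolic functions *)

Section Primitive.
Context {R : realType}.

(** Extending g from [-1, 1] by constants makes it continuous
    everywhere, so that the derivative of its integral exists at the end points
    as well. *)
Lemma derives_primitive (g : R -> R) :
  (forall x, -1 <= x -> x <= 1 -> {for x, continuous g}) ->
  exists P : R -> R, derives_on P g.
Proof.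
move=> cg.
(* clamping to [-1, 1] *)
pose cl (y : R) : R := Num.max (-1) (Num.min y 1).
have clitv y : -1 <= cl y <= 1.
  by rewrite /cl le_max lexx ge_max ge_min lexx orbT andbT; lra.
have ccl : continuous cl.
  move=> y; apply: (@continuous_max R R (fun=> -1) (fun y => Num.min y 1) y).
    exact: cvg_cst.
  by apply: (@continuous_min R R (fun y => y) (fun=> 1) y);
    [exact: cvg_id|exact: cvg_cst].
have cgcl : continuous (g \o cl).
  move=> y; apply: continuous_comp; first exact: ccl.
  by have /andP[? ?] := clitv y; exact: cg.
exists (fun x => \int[lebesgue_measure]_(t in `[-2, x]) (g \o cl) t)%R.
move=> x x1 x2.
have igc : lebesgue_measure.-integrable `[(-2 : R), 2] (EFin \o (g \o cl)).
  apply: continuous_compact_integrable; first exact: segment_compact.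
  exact: continuous_subspaceT.
have x22 : x < 2 by lra.
have xm2 : -2 < x by lra.
have [dP P'] := continuous_FTC1_closed x22 igc xm2 (cgcl x).
apply: DeriveDef => //; rewrite -derive1E P' /= /cl.
by congr g; rewrite min_l// max_r.
Qed.

End Primitive.

Section Hyperbolic.
Context {R : realType}.
Implicit Types t : R.

Lemma cosh2 t : cosh t ^+ 2 = 1 + sinh t ^+ 2.
Proof.
have h : expR t * expR (- t) = 1 by rewrite -expRD subrr expR0.
by rewrite /cosh /sinh; apply: (lincomb1 1 h); field.
Qed.

Lemma is_derive_expRN t : is_derive t (1 : R) (fun s => expR (- s)) (- expR (- t)).
Proof.
have h := @is_derive1_comp R expR -%R t _ _ (is_derive_expR _) (is_deriveNid _ _).
by apply: (is_derive_eq (f := fun s => expR (- s)) h); rewrite mulrN1.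
Qed.

Lemma is_derive_sinh t : is_derive t (1 : R) sinh (cosh t).
Proof.
have := is_derive_expRN t => h; rewrite /sinh; apply: is_derive_eq.
by rewrite /GRing.scale /= /cosh; field.
Qed.

Lemma is_derive_cosh t : is_derive t (1 : R) cosh (sinh t).
Proof.
have := is_derive_expRN t => h; rewrite /cosh; apply: is_derive_eq.
by rewrite /GRing.scale /= /sinh; field.
Qed.

Lemma sinh0 : sinh 0 = 0 :> R.
Proof. by rewrite /sinh oppr0 subrr mul0r. Qed.

Lemma cosh0 : cosh 0 = 1 :> R.
Proof. by rewrite /cosh oppr0 expR0; field. Qed.

End Hyperbolic.

(** * The family of Lagrangian immersions *)

Section Family.
Context {R : realType}.
Variables a b e : R.
Hypotheses (a0 : 0 < a) (b0 : 0 < b) (e0 : 0 < e) (eE : e ^+ 2 = a ^+ 2 - b ^+ 2).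
Implicit Types (p q u v w : E3 R) (t s c k : R).

Let an0 : a != 0. Proof. by rewrite gt_eqF. Qed.
Let bn0 : b != 0. Proof. by rewrite gt_eqF. Qed.
Let en0 : e != 0. Proof. by rewrite gt_eqF. Qed.

Lemma sqrt_a : Num.sqrt (a ^+ 2) = a.
Proof. by rewrite sqrtr_sqr gtr0_norm. Qed.
Lemma sqrt_b : Num.sqrt (b ^+ 2) = b.
Proof. by rewrite sqrtr_sqr gtr0_norm. Qed.
Lemma sqrt_e : Num.sqrt (a ^+ 2 - b ^+ 2) = e.
Proof. by rewrite -eE sqrtr_sqr gtr0_norm. Qed.

Definition phimap s c := rotmap (profA1 a b e s c) (profA2 a b e s c) (profH a b s c)
  (profB1 a b e s c) (profB2 a b e s c) (profK a b s c).
Definition dphimap s c := drot (profA1 a b e s c) (profA2 a b e s c)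
  (profB1 a b e s c) (profB2 a b e s c) (profA1' a b e s c) (profA2' a b e s c)
  (profH' a b e s c) (profB1' a b e s c) (profB2' a b e s c) (profK' a b e s c).

Notation F := (Phi (a ^+ 2) (b ^+ 2)).

Lemma PhiE t p : sphere 1 p -> F t p = phimap (sinh t) (cosh t) p.
Proof.
move=> Sp; have /andP[x1 x2] := sphere_itv Sp.
have D0 : DD a b (sinh t) (cosh t) (p 0 2) != 0.
  by rewrite gt_eqF// (DD_gt0 e0 eE (cosh2 t)).
rewrite /Phi /phi /psi /phimap /rotmap /rotv /pt sqrt_a sqrt_b sqrt_e.
rewrite /Dfun /xcoord -/(DD a b (sinh t) (cosh t) (p 0 2)).
move: (cosh2 t) D0; move: (sinh t) (cosh t) => s c cE D0.
have vecE (z : R[i]) (x : R) : vec z x = pt3 (complex.Re z) (complex.Im z) x.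
  by case: z.
congr pair; rewrite vecE pt3Z.
  rewrite /profA1 /profA2 /profH /=.
  congr pt3; try by field.
  have -> : a ^+ 2 * c ^+ 2 - 2 * a ^+ 2 - b ^+ 2 * s ^+ 2 +
     (a ^+ 2 * s ^+ 2 + 2 * a ^+ 2 - b ^+ 2 * c ^+ 2) * p 0 2 ^+ 2
     = DD a b s c (p 0 2) - 2 * a ^+ 2 * (1 - p 0 2 ^+ 2) by rewrite /DD; ring.
  by field; rewrite D0 an0 en0.
rewrite /profB1 /profB2 /profK /=.
congr pt3; try by field.
have -> : a ^+ 2 * c ^+ 2 - 2 * b ^+ 2 - b ^+ 2 * s ^+ 2 +
   (a ^+ 2 * s ^+ 2 + 2 * b ^+ 2 - b ^+ 2 * c ^+ 2) * p 0 2 ^+ 2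
   = DD a b s c (p 0 2) - 2 * b ^+ 2 * (1 - p 0 2 ^+ 2) by rewrite /DD; ring.
by field; rewrite D0 bn0 en0.
Qed.

Lemma is_derive_phimap s c (q : R -> E3 R) (q' : E3 R) (r : R) : c ^+ 2 = 1 + s ^+ 2 ->
  sphere 1 (q r) ->
  (forall j, is_derive r (1 : R) (fun r => q r 0 j) (q' 0 j)) ->
  is_derive r (1 : R) (fun r => phimap s c (q r)) (dphimap s c (q r) q').
Proof.
move=> cE Sq dq.
exact: (is_derive_rotmap (derives_A1 e0 eE cE) (derives_A2 e0 eE cE)
  (derives_H e0 eE cE) (derives_B1 e0 eE cE) (derives_B2 e0 eE cE)
  (derives_K e0 eE cE) Sq dq).
Qed.

Lemma dS_phimap s c p v : c ^+ 2 = 1 + s ^+ 2 -> sphere 1 p -> tangent p v ->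
  dS (phimap s c) p v = dphimap s c p v.
Proof.
move=> cE Sp Tv.
exact: (dS_rotmap (derives_A1 e0 eE cE) (derives_A2 e0 eE cE)
  (derives_H e0 eE cE) (derives_B1 e0 eE cE) (derives_B2 e0 eE cE)
  (derives_K e0 eE cE) Sp Tv).
Qed.

Lemma dS_Phi t p v : sphere 1 p -> tangent p v ->
  dS (F t) p v = dphimap (sinh t) (cosh t) p v.
Proof.
move=> Sp Tv; apply: etrans (dS_phimap (cosh2 t) Sp Tv).
exact: (dS_eq v (PhiE t) Sp).
Qed.

Lemma mfac_gt0 s c p : c ^+ 2 = 1 + s ^+ 2 -> sphere 1 p ->
  0 < mfac a b e s c (p 0 2).
Proof.
move=> cE /sphere_itv/andP[x1 x2]; rewrite /mfac.
have D0 := DD_gt0 e0 eE cE x1 x2.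
rewrite divr_gt0 ?exprn_gt0// !mulr_gt0 ?exprn_gt0//.
  by rewrite cE; have := sqr_ge0 s; lra.
by have := sqr_ge0 (p 0 2); lra.
Qed.

Lemma conformal_phimap s c p v w : c ^+ 2 = 1 + s ^+ 2 ->
  sphere 1 p -> tangent p v -> tangent p w ->
  dot2 (dphimap s c p v) (dphimap s c p w) = mfac a b e s c (p 0 2) * dot v w.
Proof.
move=> cE Sp Tv Tw; have /andP[x1 x2] := sphere_itv Sp.
rewrite -(profile_m e0 eE cE x1 x2).
exact: (dot2_drot (profile_im e0 eE cE x1 x2) (profile_ode e0 eE cE x1 x2)
  Sp Tv Tw).
Qed.

Lemma phimap_M s c p : c ^+ 2 = 1 + s ^+ 2 -> sphere 1 p ->
  M (a ^+ 2) (b ^+ 2) (phimap s c p).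
Proof.
move=> cE Sp; have /andP[x1 x2] := sphere_itv Sp; have hp := sphereE Sp.
have hA := profile_sphereA a0 e0 eE cE x1 x2.
have hB := profile_sphereB b0 e0 eE cE x1 x2.
rewrite /phimap /rotmap /rotv /M /sphere /= !dotE !pt3E; split.
- rewrite -hA; move: (profA1 _ _ _ _ _ _) (profA2 _ _ _ _ _ _) (profH _ _ _ _ _) => A1 A2 H.
  by apply: (lincomb1 (A1 ^+ 2 + A2 ^+ 2) hp); ring.
- rewrite -hB; move: (profB1 _ _ _ _ _ _) (profB2 _ _ _ _ _ _) (profK _ _ _ _ _) => A1 A2 H.
  by apply: (lincomb1 (A1 ^+ 2 + A2 ^+ 2) hp); ring.
Qed.

Lemma lagrangian_phimap s c p v w : c ^+ 2 = 1 + s ^+ 2 ->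
  sphere 1 p -> tangent p v -> tangent p w ->
  omega (a ^+ 2) (b ^+ 2) (phimap s c p) (dphimap s c p v) (dphimap s c p w) = 0.
Proof.
move=> cE Sp Tv Tw; have /andP[x1 x2] := sphere_itv Sp.
have D0 : DD a b s c (p 0 2) != 0 by rewrite gt_eqF// (DD_gt0 e0 eE cE).
apply: (omega_drot (p := p) (profile_sphereA a0 e0 eE cE x1 x2)
  (profile_dsphereA a0 e0 eE cE x1 x2)
  (profile_sphereB b0 e0 eE cE x1 x2)
  (profile_dsphereB b0 e0 eE cE x1 x2)) => //.
by rewrite sqrt_a sqrt_b /profH' /profK'; field; rewrite D0 an0 bn0.
Qed.

End Family.

(** * Smoothness of the family *)

Section SmoothFamily.
Context {R : realType}.

Lemma smoothR_linear (V : normedModType R) (U : set V) (f : V -> R) :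
  linear (f : V -> R^o) -> continuous (f : V -> R^o) -> smoothR U f.
Proof.
move=> lf cf n.
pose L := GRing.isLinear.Build R V R^o *:%R (f : V -> R^o) lf.
pose g : {linear V -> R^o} := HB.pack (f : V -> R^o) L.
exact: (@Cn_lin _ _ R^o n U g).
Qed.

Variables a b e : R.
Hypotheses (a0 : 0 < a) (b0 : 0 < b) (e0 : 0 < e) (eE : e ^+ 2 = a ^+ 2 - b ^+ 2).
Notation F := (Phi (a ^+ 2) (b ^+ 2)).

Section Radial.
Variables (V : normedModType R) (U : set V) (oU : open U).
Variables (T : V -> R) (Q : V -> E3 R).
Hypotheses (sT : smoothR U T) (sQ : forall j, smoothR U (fun u => Q u 0 j))
  (Q0 : forall u, U u -> Q u != 0).

Let sM f g := @smoothRM R V U oU f g.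
Let sD f g := @smoothRD R V U oU f g.
Let sB f g := @smoothRB R V U oU f g.
Let sC r : smoothR U (fun=> r) := @smoothR_cst R V U r.

(** The variables Q and T let the same argument serve the maps
    with t fixed and the whole family. *)
Lemma smooth_normalize j : smoothR U (fun u => normalize (Q u) 0 j).
Proof.
have sd : smoothR U (fun u => dot (Q u) (Q u)).
  apply: smoothR_eq oU _ _ _ _; last first.
    exact: (sD (sD (sM (sQ 0) (sQ 0)) (sM (sQ 1) (sQ 1))) (sM (sQ 2) (sQ 2))).
  by move=> u _ /=; rewrite dotE.
have ss : smoothR U (fun u => (Num.sqrt (dot (Q u) (Q u)))^-1).
  apply: smoothRV => //.
    by move=> u /Q0 q0; rewrite gt_eqF// sqrtr_gt0 dot_gt0.
  by apply: smoothR_sqrt => // u /Q0; exact: dot_gt0.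
apply: smoothR_eq oU _ _ _ (sM ss (sQ j)) => u _.
by rewrite /normalize mxE.
Qed.

Lemma smooth_sinh : smoothR U (fun u => sinh (T u)).
Proof.
apply: sM (sC _); apply: sB; apply: smoothR_exp => //.
exact: smoothRN.
Qed.

Lemma smooth_cosh : smoothR U (fun u => cosh (T u)).
Proof.
apply: sM (sC _); apply: sD; apply: smoothR_exp => //.
exact: smoothRN.
Qed.

Let x u := normalize (Q u) 0 2.
Let D u := DD a b (sinh (T u)) (cosh (T u)) (x u).

Lemma smooth_DDV : smoothR U (fun u => (D u)^-1).
Proof.
have sX := smoothRX oU.
have ss := smooth_sinh; have sc := smooth_cosh; have sx := smooth_normalize 2.
apply: smoothRV => //.
  move=> u /Q0 q0.
  have /andP[x1 x2] := sphere_itv (normalize_sphere q0).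
  by rewrite gt_eqF// /D (DD_gt0 e0 eE (cosh2 _)).
by apply: sD; [apply: sB|apply: sM; [apply: sB|exact: sX]]; apply: sM => //; exact: sX.
Qed.

Lemma smooth_radial_Phi : smooth_on U (fun u => radial (F (T u)) (Q u)).
Proof.
apply: (@smooth_on_eq R V _ U (fun u => phimap a b e (sinh (T u)) (cosh (T u)) (normalize (Q u)))) => //.
  move=> u /Q0 q0; rewrite /radial (PhiE a0 b0 e0 eE)//.
  exact: normalize_sphere.
have ss := smooth_sinh; have sc := smooth_cosh; have sx := smooth_normalize.
have sDV := smooth_DDV; have sX := smoothRX oU.
have sA1 : smoothR U (fun u => profA1 a b e (sinh (T u)) (cosh (T u)) (x u)).
  by apply: sM sDV; apply: sM.
have sA2 : smoothR U (fun u => profA2 a b e (sinh (T u)) (cosh (T u)) (x u)).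
  by apply: sM sDV; apply: sM (sx _); apply: sM.
have sH : smoothR U (fun u => profH a b (sinh (T u)) (cosh (T u)) (x u)).
  by apply: sB => //; apply: sM sDV; apply: sM => //; apply: sB => //; exact: sX (sx 2).
have sB1 : smoothR U (fun u => profB1 a b e (sinh (T u)) (cosh (T u)) (x u)).
  by apply: sM sDV; apply: sM.
have sB2 : smoothR U (fun u => profB2 a b e (sinh (T u)) (cosh (T u)) (x u)).
  by apply: sM sDV; apply: sM (sx _); apply: sM.
have sK : smoothR U (fun u => profK a b (sinh (T u)) (cosh (T u)) (x u)).
  by apply: sB => //; apply: sM sDV; apply: sM => //; apply: sB => //; exact: sX (sx 2).
apply: smooth_pt => //.
- by apply: sB; apply: sM.
- by apply: sD; apply: sM.
- by apply: sD; apply: sM.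
- by apply: sB; apply: sM.
Qed.

End Radial.

Lemma coord_linear (V : normedModType R) (f : V -> E3 R) j : linear f ->
  linear ((fun u => f u 0 j) : V -> R^o).
Proof. by move=> lf k u v; rewrite lf !mxE. Qed.

Lemma smoothR_coord j (U : set (E3 R)) : smoothR U (fun u : E3 R => u 0 j).
Proof.
apply: smoothR_linear; first exact: coord_linear.
exact: coord_continuous.
Qed.

Lemma smoothS_Phi t : smoothS (F t).
Proof.
apply: (@smooth_radial_Phi _ _ _ (fun=> t) id) => //.
- exact: open_neq0.
- exact: smoothR_cst.
- by move=> j; exact: smoothR_coord.
Qed.

Lemma smooth_family_Phi (k : R) : smooth_family (fun t => F (k * t)).
Proof.
have cfst : continuous (@fst R^o (E3 R)) by move=> ?; exact: cvg_fst.
have csnd : continuous (@snd R^o (E3 R)) by move=> ?; exact: cvg_snd.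
have oU : open [set u : (R^o * E3 R)%type | u.2 != 0].
  exact: (open_comp (fun u _ => csnd u) (@open_neq0 _ (E3 R))).
apply: (@smooth_radial_Phi _ _ oU (fun u => k * u.1) snd) => //.
- apply: smoothRM => //; first exact: smoothR_cst.
  by apply: smoothR_linear.
- move=> j; apply: smoothR_linear; first exact: coord_linear.
  move=> u; apply: (@continuous_comp _ _ _ (@snd R^o (E3 R)) (fun M : E3 R => M 0 j)).
    exact: csnd.
  exact: coord_continuous.
Qed.

End SmoothFamily.

(** * The Hamiltonian potential *)

Section HamiltonianVariation.
Context {R : realType}.
Implicit Types (p q u v w : E3 R).

(** The gradient on the unit sphere of the height. *)
Definition meridian_field p := pt3 (- (p 0 2 * p 0 0)) (- (p 0 2 * p 0 1)) (1 - p 0 2 ^+ 2).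
Definition rotation_field p := pt3 (- p 0 1) (p 0 0) 0.

Lemma tangent_fields p k l : sphere 1 p -> tangent p (k *: meridian_field p + l *: rotation_field p).
Proof.
move=> /sphereE hp; rewrite /tangent /= dotE !pt3Z pt3D !pt3E.
by apply: (lincomb1 (- (k * p 0 2)) hp); ring.
Qed.

Lemma dot_meridian_field p v k : tangent p v -> dot (k *: meridian_field p) v = k * v 0 2.
Proof.
move=> /tangentE hv; rewrite dotE pt3Z !pt3E.
by apply: (lincomb1 (- (k * p 0 2)) hv); ring.
Qed.

(** The cross product of (alpha z, H) and (xi z, h) is
    (- i (alpha h - H xi) z, Im (conj(alpha) xi) |z|^2). *)
Lemma J_rotv (c1 c2 a b A1 A2 H B1 B2 K X1 X2 h Y1 Y2 k p0 p1 n : R) :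
  Num.sqrt c1 = a -> Num.sqrt c2 = b -> p0 ^+ 2 + p1 ^+ 2 = n ->
  J c1 c2 (rotv A1 A2 H B1 B2 K p0 p1) (rotv X1 X2 h Y1 Y2 k p0 p1)
  = rotv (a * (A2 * h - H * X2)) (- (a * (A1 * h - H * X1)))
      (a * ((A1 * X2 - A2 * X1) * n))
      (b * (B2 * k - K * Y2)) (- (b * (B1 * k - K * Y1)))
      (b * ((B1 * Y2 - B2 * Y1) * n)) p0 p1.
Proof.
move=> sa sb <-; rewrite /J /rotv /pt /= sa sb !crossE !pt3Z !pt3E.
by congr pair; congr pt3; ring.
Qed.

Lemma rotvD A1 A2 H B1 B2 K A1' A2' H' B1' B2' K' (y0 y1 : R) :
  rotv A1 A2 H B1 B2 K y0 y1 + rotv A1' A2' H' B1' B2' K' y0 y1 =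
  rotv (A1 + A1') (A2 + A2') (H + H') (B1 + B1') (B2 + B2') (K + K') y0 y1.
Proof. by rewrite /rotv ptD; congr pt; ring. Qed.

Lemma rotvN A1 A2 H B1 B2 K (y0 y1 : R) :
  - rotv A1 A2 H B1 B2 K y0 y1 =
  rotv (- A1) (- A2) (- H) (- B1) (- B2) (- K) y0 y1.
Proof. by rewrite /rotv ptN; congr pt; ring. Qed.

Lemma rotvZ k A1 A2 H B1 B2 K (y0 y1 : R) :
  k *: rotv A1 A2 H B1 B2 K y0 y1 =
  rotv (k * A1) (k * A2) (k * H) (k * B1) (k * B2) (k * K) y0 y1.
Proof. by rewrite /rotv ptZ; congr pt; ring. Qed.

Lemma drot_fields (A1 A2 B1 B2 A1' A2' H' B1' B2' K' : R -> R) p k l :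
  let x := p 0 2 in
  drot A1 A2 B1 B2 A1' A2' H' B1' B2' K' p (k *: meridian_field p + l *: rotation_field p) =
  rotv (k * (A1' x * (1 - x ^+ 2) - x * A1 x) + l * (- A2 x))
       (k * (A2' x * (1 - x ^+ 2) - x * A2 x) + l * A1 x)
       (k * (H' x * (1 - x ^+ 2)))
       (k * (B1' x * (1 - x ^+ 2) - x * B1 x) + l * B2 x)
       (k * (B2' x * (1 - x ^+ 2) - x * B2 x) + l * (- B1 x))
       (k * (K' x * (1 - x ^+ 2))) (p 0 0) (p 0 1).
Proof.
by move=> x; rewrite /drot !pt3Z pt3D !pt3E -/x /rotv ptD; congr pt; ring.
Qed.

Variables a b e : R.
Hypotheses (a0 : 0 < a) (b0 : 0 < b) (e0 : 0 < e) (eE : e ^+ 2 = a ^+ 2 - b ^+ 2).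
Notation F := (Phi (a ^+ 2) (b ^+ 2)).

Lemma lagrangian_immersion_Phi t : lagrangian_immersion (a ^+ 2) (b ^+ 2) (F t).
Proof.
split; first split.
- exact: smoothS_Phi e0 eE _.
- by move=> p Sp; rewrite (PhiE a0 b0 e0 eE)//; apply: (phimap_M a0 b0 e0 eE (cosh2 t)).
- move=> p v Sp Tv dv0; apply: dot_eq0.
  have h := conformal_phimap e0 eE (cosh2 t) Sp Tv Tv.
  have m0 := mfac_gt0 e0 eE (cosh2 t) Sp.
  have dv0' : dphimap a b e (sinh t) (cosh t) p v = 0.
    exact: etrans (esym (dS_Phi a0 b0 e0 eE t Sp Tv)) dv0.
  move: h; rewrite dv0' pt0 dot2_pt !mulr0 !addr0 => /esym/eqP.
  by rewrite mulf_eq0 gt_eqF//= => /eqP.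
- move=> p v w Sp Tv Tw.
  rewrite (dS_Phi a0 b0 e0 eE t Sp Tv) (dS_Phi a0 b0 e0 eE t Sp Tw) (PhiE a0 b0 e0 eE)//.
  exact: (lagrangian_phimap a0 b0 e0 eE (cosh2 t)).
Qed.

Lemma is_derive_DDt (x k t : R) : is_derive t (1 : R)
  (fun r => DD a b (sinh (k * r)) (cosh (k * r)) x)
  (k * dt_DD e (sinh (k * t)) (cosh (k * t)) x).
Proof.
have dk : is_derive t (1 : R) (fun r => k * r) k.
  by apply: is_derive_eq; rewrite /GRing.scale /= mulr1.
have ds := is_derive1_comp (is_derive_sinh (k * t)) dk.
have dc := is_derive1_comp (is_derive_cosh (k * t)) dk.
rewrite /DD; apply: is_derive_eq.
by rewrite /GRing.scale /= /dt_DD eE; ring.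
Qed.

Lemma is_derive_Phi_t p k t : sphere 1 p ->
  let s := sinh (k * t) in let c := cosh (k * t) in let x := p 0 2 in
  is_derive t (1 : R) (fun r => F (k * r) p)
    (k *: rotv (dt_profA1 a b e s c x) (dt_profA2 a b e s c x) (dt_profH a b e s c x)
       (dt_profB1 a b e s c x) (dt_profB2 a b e s c x) (dt_profK a b e s c x) (p 0 0) (p 0 1)).
Proof.
move=> Sp s c x; have /andP[x1 x2] := sphere_itv Sp.
have -> : (fun r => F (k * r) p) = (fun r => phimap a b e (sinh (k * r)) (cosh (k * r)) p).
  by apply/funext => r; rewrite (PhiE a0 b0 e0 eE).
have D0 : DD a b s c x != 0 by rewrite gt_eqF// (DD_gt0 e0 eE (cosh2 _)).
have dk : is_derive t (1 : R) (fun r => k * r) k.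
  by apply: is_derive_eq; rewrite /GRing.scale /= mulr1.
have ds : is_derive t (1 : R) (fun r => sinh (k * r)) (c * k).
  exact: is_derive1_comp (is_derive_sinh (k * t)) dk.
have dc : is_derive t (1 : R) (fun r => cosh (k * r)) (s * k).
  exact: is_derive1_comp (is_derive_cosh (k * t)) dk.
have dD := is_derive_DDt x k t.
have dV : is_derive t (1 : R) (fun r => (DD a b (sinh (k * r)) (cosh (k * r)) x)^-1)
    (- (k * dt_DD e s c x) / DD a b s c x ^+ 2).
  have h := @is_deriveV _ (fun r => DD a b (sinh (k * r)) (cosh (k * r)) x) t _ 1 D0 dD.
  by apply: is_derive_eq h _; rewrite /GRing.scale /=; field.
rewrite rotvZ -[X in is_derive _ _ _ X]addr0.
have dcst (r : R) : is_derive t (1 : R) (fun=> r : R) 0 by exact: is_derive_cst.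
have -> : (0 : E6 R) = rotv (profA1 a b e s c x) (profA2 a b e s c x) 0
    (profB1 a b e s c x) (profB2 a b e s c x) 0 0 0.
  by rewrite pt0 /rotv; congr pt; ring.
apply: is_derive_rotv; try exact: dcst; rewrite -/x.
- rewrite /profA1; apply: is_derive_eq.
  by rewrite /GRing.scale /= /dt_profA1 -/s -/c; field.
- rewrite /profA2; apply: is_derive_eq.
  by rewrite /GRing.scale /= /dt_profA2 -/s -/c; field.
- rewrite /profH; apply: is_derive_eq.
  by rewrite /GRing.scale /= /dt_profH -/s -/c; field.
- rewrite /profB1; apply: is_derive_eq.
  by rewrite /GRing.scale /= /dt_profB1 -/s -/c; field.
- rewrite /profB2; apply: is_derive_eq.
  by rewrite /GRing.scale /= /dt_profB2 -/s -/c; field.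
- rewrite /profK; apply: is_derive_eq.
  by rewrite /GRing.scale /= /dt_profK -/s -/c; field.
Qed.

End HamiltonianVariation.

Section Hamiltonian.
Context {R : realType}.
Implicit Types (p q u v w : E3 R).
Variables a b e : R.
Hypotheses (a0 : 0 < a) (b0 : 0 < b) (e0 : 0 < e) (eE : e ^+ 2 = a ^+ 2 - b ^+ 2).
Notation F := (Phi (a ^+ 2) (b ^+ 2)).

(** The derivative, with respect to the height, of the Hamiltonian
    potential. *)
Definition dpot (s c x : R) :=
  4 * e ^+ 2 * (c ^+ 2 + s ^+ 2) * (1 - x ^+ 2) / DD a b s c x ^+ 2.

Lemma cont_DDV s c x : c ^+ 2 = 1 + s ^+ 2 -> -1 <= x -> x <= 1 ->
  {for x, continuous (fun y => (DD a b s c y)^-1)}.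
Proof.
move=> cE x1 x2; have D0 : DD a b s c x != 0 by rewrite gt_eqF// (DD_gt0 e0 eE cE).
have h := is_derive_quot e0 eE cE x1 x2 (is_derive_cst (1 : R) x (1 : R)).
have [dh _] := h.
have -> : (fun y => (DD a b s c y)^-1) = (fun y => (1 : R) / DD a b s c y).
  by apply/funext => y; rewrite mul1r.
by apply: differentiable_continuous; apply/derivable1_diffP.
Qed.

Lemma cont_dpot s c x : c ^+ 2 = 1 + s ^+ 2 -> -1 <= x -> x <= 1 ->
  {for x, continuous (dpot s c)}.
Proof.
move=> cE x1 x2; have h := cont_DDV cE x1 x2.
have -> : dpot s c = (fun y => (4 * e ^+ 2 * (c ^+ 2 + s ^+ 2) * (1 - y ^+ 2)) *
    ((DD a b s c y)^-1 * (DD a b s c y)^-1)).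
  by apply/funext => y; rewrite /dpot expr2 invfM.
apply: cvgM; last exact: cvgM.
apply: cvgM; first exact: cvg_cst.
apply: cvgB; first exact: cvg_cst.
exact: exprn_continuous.
Qed.

Lemma smoothS_potential t k (P : R -> R) : derives_on P (dpot (sinh t) (cosh t)) ->
  smoothS ((fun p : E3 R => k * P (p 0 2)) : E3 R -> R^o).
Proof.
move=> dP; pose U := [set q : E3 R | q != 0]; have oU : open U by exact: open_neq0.
have sx : smoothR U (fun q => normalize q 0 2).
  by apply: (@smooth_normalize _ _ _ oU id) => // j; exact: smoothR_coord.
have sP : smoothR U (fun q => P (normalize q 0 2)).
  apply: (@smoothR_comp _ _ _ oU P (dpot (sinh t) (cosh t)) (fun q => normalize q 0 2)) => //.
    move=> q q0; have /andP[x1 x2] := sphere_itv (normalize_sphere q0).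
    exact: dP.
  have sD : smoothR U (fun q =>
      (DD a b (sinh t) (cosh t) (normalize q 0 2))^-1).
    apply: (@smooth_DDV _ _ _ _ e0 eE _ _ oU (fun=> t) id) => //.
      exact: smoothR_cst.
    by move=> j; exact: smoothR_coord.
  move=> n _.
  move: n; rewrite -/(smoothR U _).
  apply: smoothR_eq oU _ _ _ (smoothRM oU (smoothRM oU (smoothR_cst _ (4 * e ^+ 2 * (cosh t ^+ 2 + sinh t ^+ 2)))
    (smoothRB oU (smoothR_cst _ 1) (smoothRX oU 2 sx))) (smoothRX oU 2 sD)).
  by move=> q _ /=; rewrite /dpot exprVn.
by apply: Cn_smooth => n; apply: (smoothRM oU (smoothR_cst _ k) sP).
Qed.

Lemma dS_potential (g P : R -> R) k p v : derives_on P g ->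
  sphere 1 p -> tangent p v ->
  dS ((fun p : E3 R => k * P (p 0 2)) : E3 R -> R^o) p v = k * (g (p 0 2) * v 0 2).
Proof.
move=> dP Sp Tv; rewrite dS_great_circle.
have Sg := great_circle_sphere 0 Sp Tv.
have h := derives_curve dP (sphere_itv Sg) (is_derive_great_circle 0 2 Sp Tv).
have h' : is_derive (0 : R) (1 : R) (fun s => k * P (great_circle p v s 0 2))
    (k * (g (p 0 2) * v 0 2)).
  apply: is_derive_eq; rewrite great_circle0// dgreat_circle0 /GRing.scale /=; ring.
by have [] := h'.
Qed.

(** The factor k is used at the end to reach every
    member of the family at time 1. *)
Theorem hamiltonian_variation_Phi k :
  hamiltonian_variation (a ^+ 2) (b ^+ 2) (fun t => F (k * t)).
Proof.
split.
- exact: smooth_family_Phi a0 b0 e0 eE k.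
- by move=> t; exact: lagrangian_immersion_Phi a0 b0 e0 eE _.
move=> t0; set t := k * t0; set s := sinh t; set c := cosh t.
have cE : c ^+ 2 = 1 + s ^+ 2 := cosh2 t.
have [P dP] : exists P : R -> R, derives_on P (dpot s c).
  by apply: derives_primitive => x; exact: cont_dpot.
exists (fun p => k * P (p 0 2)); first exact: (@smoothS_potential t).
move=> p Sp; pose x := p 0 2.
have /andP[x1 x2] := sphere_itv Sp.
have D0 : DD a b s c x != 0 by rewrite gt_eqF// (DD_gt0 e0 eE cE).
have u0 : 1 + x ^+ 2 != 0 by rewrite gt_eqF//; have := sqr_ge0 x; lra.
pose X := (k * coefX x) *: meridian_field p + 0 *: rotation_field p.
pose Y := (k * coefY_meridian s c x) *: meridian_field p + (k * coefY_rotation s x) *: rotation_field p.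
have TX : tangent p X by exact: tangent_fields.
have TY : tangent p Y by exact: tangent_fields.
exists X.
  split=> // v Tv; rewrite (dS_potential k dP Sp Tv).
  rewrite (dS_Phi a0 b0 e0 eE t Sp TX) (dS_Phi a0 b0 e0 eE t Sp Tv).
  rewrite (conformal_phimap e0 eE cE Sp TX Tv) /X scale0r addr0 dot_meridian_field//.
  by rewrite /mfac /dpot /coefX -/x; field; rewrite D0 u0.
split.
  exists Y => //.
  have [_ W] := is_derive_Phi_t a0 b0 e0 eE k t0 Sp.
  rewrite (derive1E (fun r => F (k * r) p)) W -/t -/s -/c -/x.
  rewrite (dS_Phi a0 b0 e0 eE t Sp TX) (dS_Phi a0 b0 e0 eE t Sp TY).
  rewrite (PhiE a0 b0 e0 eE)// -/s -/c /dphimap /X /Y !drot_fields /phimap /rotmap -/x.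
  have hn : p 0 0 ^+ 2 + p 0 1 ^+ 2 = 1 - x ^+ 2.
    by rewrite -(sphereE Sp) -/x; ring.
  rewrite (J_rotv _ _ _ _ _ _ _ _ _ _ _ _ (sqrt_a a0) (sqrt_b b0) hn).
  rewrite rotvZ rotvN rotvD.
  have e1 := profile_dtA1 a0 e0 eE cE x1 x2; have e2 := profile_dtA2 a0 e0 eE cE x1 x2.
  have e3 := profile_dtH e0 eE cE x1 x2; have e4 := profile_dtB1 b0 e0 eE cE x1 x2.
  have e5 := profile_dtB2 b0 e0 eE cE x1 x2; have e6 := profile_dtK e0 eE cE x1 x2.
  rewrite -/x in e1 e2 e3 e4 e5 e6.
  congr (rotv _ _ _ _ _ _ _ _).
  - by apply: (lincomb1 k e1); ring.
  - by apply: (lincomb1 k e2); ring.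
  - by apply: (lincomb1 k e3); ring.
  - by apply: (lincomb1 k e4); ring.
  - by apply: (lincomb1 k e5); ring.
  - by apply: (lincomb1 k e6); ring.
move=> v Tv.
have [_ L] := lagrangian_immersion_Phi a0 b0 e0 eE t.
exact: L.
Qed.

End Hamiltonian.

(** * Integrals of bounded functions *)

Section IntegralBounds.
Import HBNNSimple.
Context {R : realType}.
Local Notation mu := (@lebesgue_measure R).

(** The integral of a nonnegative function is the
    supremum of the integrals of the simple functions below it, which is monotone
    in the function. *)
Lemma ge0_le_integral_nomeas (D : set R) (f g : R -> \bar R) :
  (forall x, D x -> 0 <= f x)%E -> (forall x, D x -> f x <= g x)%E ->
  (\int[mu]_(x in D) f x <= \int[mu]_(x in D) g x)%E.
Proof.
move=> f0 fg.
have g0 x : D x -> (0 <= g x)%E by move=> Dx; exact: le_trans (f0 x Dx) (fg x Dx).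
rewrite !ge0_integralE//; apply: le_ereal_sup => _ [h hf <-].
exists h => // x.
exact: le_trans (hf x) (lee_restrict fg x).
Qed.

(** Two-sided bounds for a bounded nonnegative function; they
    also show that its integral is finite. *)
Lemma Rintegral_bounds (f : R -> R) (l r l' r' m B : R) :
  l <= l' -> l' <= r' -> r' <= r -> 0 <= m ->
  (forall x, l <= x <= r -> 0 <= f x <= B) ->
  (forall x, l' <= x <= r' -> m <= f x) ->
  m * (r' - l') <= \int[mu]_(x in `[l, r]) f x <= B * (r - l).
Proof.
move=> ll' lr' rr' m0 fB mf.
have lr : l <= r by lra.
have B0 : 0 <= B.
  have /andP[h1 h2] : 0 <= f l <= B by apply: fB; rewrite lexx.
  exact: le_trans h1 h2.
have f0 x : `[l, r]%classic x -> (0 <= (f x)%:E)%E.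
  by rewrite /= in_itv/= => /fB/andP[? _]; rewrite lee_fin.
have mlr (k l0 r0 : R) : l0 <= r0 ->
    (\int[mu]_(x in `[l0, r0]) k%:E = (k * (r0 - l0))%:E)%E.
  move=> lr0; rewrite integral_cst//= lebesgue_measure_itv/= lte_fin.
  by case: ltgtP lr0 => // -> _; rewrite subrr mulr0 mule0.
have up : (\int[mu]_(x in `[l, r]) (f x)%:E <= (B * (r - l))%:E)%E.
  rewrite -mlr//; apply: ge0_le_integral_nomeas => // x.
  by rewrite /= in_itv/= => /fB/andP[_ ?]; rewrite lee_fin.
have low : ((m * (r' - l'))%:E <= \int[mu]_(x in `[l, r]) (f x)%:E)%E.
  rewrite -mlr// integral_mkcond [leRHS]integral_mkcond.
  apply: ge0_le_integral_nomeas => x _; rewrite /patch.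
    by case: ifP => // _; rewrite lee_fin.
  have [xl'r'|_] := boolP (x \in `[l', r']%classic); last first.
    by case: ifP => //; rewrite inE => /f0.
  have : l' <= x <= r' by move: xl'r'; rewrite inE/= in_itv.
  move=> /[dup] /andP[x1 x2] /mf mfx.
  by rewrite ifT ?lee_fin// inE/= in_itv/=; apply/andP; split; lra.
rewrite /Rintegral; apply/andP; split.
  rewrite -lee_fin fineK// fin_numE; apply/andP; split.
    by rewrite gt_eqF// (lt_le_trans _ low)// ltNyr.
  by rewrite lt_eqF// (le_lt_trans up)// ltry.
rewrite -lee_fin fineK// fin_numE; apply/andP; split.
  by rewrite gt_eqF// (lt_le_trans _ low)// ltNyr.
by rewrite lt_eqF// (le_lt_trans up)// ltry.
Qed.

Lemma continuous_integrable (l r : R) (f : R -> R) : continuous f ->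
  mu.-integrable `[l, r] (EFin \o f).
Proof.
move=> cf; apply: continuous_compact_integrable; first exact: segment_compact.
exact: continuous_subspaceT.
Qed.

Lemma Rintegral_derive (F f : R -> R) (l r : R) : l < r -> continuous f ->
  (forall x, is_derive x (1 : R) F (f x)) ->
  \int[mu]_(x in `[l, r]) f x = F r - F l.
Proof.
move=> lr cf dF.
have cF x : {for x, continuous F}.
  by apply: differentiable_continuous; apply/derivable1_diffP; case: (dF x).
rewrite /Rintegral (@continuous_FTC2 _ f F) => //.
- exact: continuous_subspaceT.
- split.
  + by move=> x _; case: (dF x).
  + by apply: cvg_at_right_filter; exact: cF.
  + by apply: cvg_at_left_filter; exact: cF.
- by move=> x _; rewrite derive1E; case: (dF x).
Qed.

End IntegralBounds.

(** * The area integral *)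

Section AreaIntegral.
Context {R : realType}.
Local Notation mu := (@lebesgue_measure R).
Variable sg : R.
Hypothesis sg0 : 0 < sg.
Implicit Types k x th : R.

Definition areaD k th := k * (1 + cos th ^+ 2) + sg * (1 - cos th ^+ 2).
(** The area density at colatitude th, with k = (c1 - c2)
    cosh (2 t) and sg = c1 + c2. *)
Definition area_integrand k th := 16 * k * (1 + cos th ^+ 2) / areaD k th ^+ 2 * sin th.
(** Up to the factor 16 / sg, the amount by which the area integral
    falls short of its limit 16 / sg as k tends to 0. *)
Definition deficit k th := k ^+ 2 * (1 - cos th ^+ 2) / areaD k th ^+ 2 * sin th.
Definition ddeficit k th := 2 * sg * k * (1 - cos th ^+ 2) ^+ 2 / areaD k th ^+ 3 * sin th.

Lemma cos2_itv th : 0 <= cos th ^+ 2 <= 1.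
Proof.
by rewrite sqr_ge0 /=; have := cos2Dsin2 th; have := sqr_ge0 (sin th); lra.
Qed.

Lemma areaD_ge k th : 0 < k -> k <= areaD k th.
Proof.
move=> k0; have /andP[c0 c1] := cos2_itv th; rewrite /areaD.
have h1 : 0 <= k * cos th ^+ 2 by apply: mulr_ge0 => //; exact: ltW.
have h2 : 0 <= sg * (1 - cos th ^+ 2) by apply: mulr_ge0; [exact: ltW|lra].
lra.
Qed.

Lemma areaD_gt0 k th : 0 < k -> 0 < areaD k th.
Proof. by move=> k0; exact: lt_le_trans k0 (areaD_ge _ k0). Qed.

Lemma derivable_continuous (f : R -> R) :
  (forall x, derivable f x 1) -> continuous f.
Proof.
by move=> df x; apply: differentiable_continuous; apply/derivable1_diffP.
Qed.

Lemma is_derive_areaDV k th : 0 < k -> is_derive th (1 : R) (fun y => (areaD k y)^-1)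
   (2 * (k - sg) * cos th * sin th / areaD k th ^+ 2).
Proof.
move=> k0; have Q0 : areaD k th != 0 by rewrite gt_eqF// areaD_gt0.
have dQ : is_derive th (1 : R) (areaD k) (- (2 * (k - sg) * cos th * sin th)).
  by rewrite /areaD; apply: is_derive_eq; rewrite /GRing.scale /=; ring.
have h := @is_deriveV _ _ th _ 1 Q0 dQ.
by apply: is_derive_eq h _; rewrite /GRing.scale /=; field.
Qed.

Lemma cont_area_integrand k : 0 < k -> continuous (area_integrand k).
Proof.
move=> k0; apply: derivable_continuous => x.
have dV := is_derive_areaDV x k0.
have -> : area_integrand k = (fun th =>
    16 * k * (1 + cos th ^+ 2) * (areaD k th)^-1 ^+ 2 * sin th).
  by apply/funext => th; rewrite /area_integrand exprVn.
exact: ex_derive.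
Qed.

Lemma cont_deficit k : 0 < k -> continuous (deficit k).
Proof.
move=> k0; apply: derivable_continuous => x.
have dV := is_derive_areaDV x k0.
have -> : deficit k = (fun th =>
    k ^+ 2 * (1 - cos th ^+ 2) * (areaD k th)^-1 ^+ 2 * sin th).
  by apply/funext => th; rewrite /deficit exprVn.
exact: ex_derive.
Qed.

Lemma cont_ddeficit k : 0 < k -> continuous (ddeficit k).
Proof.
move=> k0; apply: derivable_continuous => x.
have dV := is_derive_areaDV x k0.
have -> : ddeficit k = (fun th =>
    2 * sg * k * (1 - cos th ^+ 2) ^+ 2 * (areaD k th)^-1 ^+ 3 * sin th).
  by apply/funext => th; rewrite /ddeficit exprVn.
exact: ex_derive.
Qed.

Definition int_deficit k := \int[mu]_(th in `[0, pi]) deficit k th.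
Definition int_ddeficit k := \int[mu]_(th in `[0, pi]) ddeficit k th.

(** The function cos th / areaD k th has derivative
    - (k v + sg u) sin th / areaD^2, and its values at 0 and pi differ by 1 / k. *)
Lemma int_area_integrand k : 0 < k ->
  \int[mu]_(th in `[0, pi]) area_integrand k th = 16 / sg * (1 - int_deficit k).
Proof.
move=> k0; have sn0 : sg != 0 by rewrite gt_eqF.
have cJ : continuous (fun th => 16 / sg * deficit k th).
  by move=> x; apply: cvgM; [exact: cvg_cst|exact: cont_deficit].
have cd : continuous (fun th => area_integrand k th + 16 / sg * deficit k th).
  by move=> x; apply: cvgD; [exact: cont_area_integrand|exact: cJ].
have dF th : is_derive th (1 : R) (fun y => - (16 / sg * k) * cos y * (areaD k y)^-1)
    (area_integrand k th + 16 / sg * deficit k th).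
  have dV := is_derive_areaDV th k0; apply: is_derive_eq.
  have Q0 : areaD k th != 0 by rewrite gt_eqF// areaD_gt0.
  have QE : areaD k th = k * (1 + cos th ^+ 2) + sg * (1 - cos th ^+ 2) by [].
  apply: (lincomb1 (16 * k / sg * sin th / areaD k th ^+ 2) QE).
  by rewrite /GRing.scale /= /area_integrand /deficit; field; rewrite Q0 sn0.
have := Rintegral_derive (pi_gt0 R) cd dF.
rewrite RintegralD//; last 2 first.
- exact/continuous_integrable/cont_area_integrand.
- exact: continuous_integrable.
rewrite RintegralZl//; last exact/continuous_integrable/cont_deficit.
have kn : k != 0 by rewrite gt_eqF.
have -> : - (16 / sg * k) * cos pi / areaD k pi - - (16 / sg * k) * cos 0 / areaD k 0
    = 16 / sg.
  by rewrite /areaD cospi cos0; field; rewrite sn0 kn.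
by rewrite -/(int_deficit k) => h; apply: (lincomb1 1 h); ring.
Qed.

(** The deficit is the product of (1 - cos^2 th) sin th and the
    square of k / areaD k th, which increases with k. *)
Lemma int_deficit_le k k' : 0 < k -> k <= k' -> int_deficit k <= int_deficit k'.
Proof.
move=> k0 kk'; have k'0 : 0 < k' by exact: lt_le_trans kk'.
apply: le_Rintegral => //.
- exact/continuous_integrable/cont_deficit.
- exact/continuous_integrable/cont_deficit.
move=> th; rewrite /= in_itv/= => /sin_ge0_pi s0.
have /andP[c0 c1] := cos2_itv th.
rewrite /deficit; apply: ler_wpM2r => //.
have Q0 := areaD_gt0 th k0; have Q'0 := areaD_gt0 th k'0.
have E l q : l ^+ 2 * (1 - cos th ^+ 2) / q ^+ 2 = (1 - cos th ^+ 2) * (l / q) ^+ 2.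
  by rewrite expr_div_n mulrA [(1 - _) * _]mulrC.
rewrite !E; apply: ler_wpM2l; first by lra.
rewrite ler_sqr ?nnegrE ?divr_ge0 ?(ltW k0) ?(ltW k'0) ?(ltW Q0) ?(ltW Q'0)//.
rewrite ler_pdivrMr// mulrAC ler_pdivlMr//.
have h : 0 <= sg * (1 - cos th ^+ 2) * (k' - k).
  by apply: mulr_ge0; [apply: mulr_ge0; [exact: ltW|lra]|lra].
by move: h; rewrite /areaD; lra.
Qed.

Lemma area_integrand_bounds k th : 0 < k -> 0 <= th <= pi -> 0 <= area_integrand k th <= 16 / k.
Proof.
move=> k0 /sin_ge0_pi s0; have /andP[c0 c1] := cos2_itv th.
have Q0 := areaD_gt0 th k0; have s1 := sin_le1 th.
have u0 : 0 <= 1 + cos th ^+ 2 by lra.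
apply/andP; split.
  by rewrite /area_integrand mulr_ge0// divr_ge0 ?sqr_ge0// mulr_ge0// mulr_ge0 ?ltW.
apply: (@le_trans _ _ (16 * k * (1 + cos th ^+ 2) / areaD k th ^+ 2)).
  by rewrite /area_integrand ler_piMr// divr_ge0 ?sqr_ge0// mulr_ge0// mulr_ge0 ?ltW.
rewrite ler_pdivrMr ?exprn_gt0// [leRHS]mulrAC ler_pdivlMr// -!mulrA.
apply: ler_wpM2l => //.
have kuQ : k * (1 + cos th ^+ 2) <= areaD k th.
  by rewrite /areaD lerDl; apply: mulr_ge0; [exact: ltW|lra].
have h : k * (1 + cos th ^+ 2) * k <= areaD k th * areaD k th.
  apply: ler_pM => //; [by apply: mulr_ge0 => //; exact: ltW|exact: ltW|exact: areaD_ge].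
by rewrite expr2; lra.
Qed.

Lemma is_derive_deficit k th : 0 < k -> is_derive k (1 : R) (deficit ^~ th) (ddeficit k th).
Proof.
move=> k0; have Q0 : areaD k th != 0 by rewrite gt_eqF// areaD_gt0.
have dQ : is_derive k (1 : R) (areaD ^~ th) (1 + cos th ^+ 2).
  by rewrite /areaD; apply: is_derive_eq; rewrite /GRing.scale /=; ring.
have h := @is_deriveV _ (areaD ^~ th) k _ 1 Q0 dQ.
have -> : deficit ^~ th = (fun k => k ^+ 2 * (1 - cos th ^+ 2) * (areaD k th)^-1 ^+ 2 * sin th).
  by apply/funext => k'; rewrite /deficit exprVn.
apply: is_derive_eq.
have QE : areaD k th = k * (1 + cos th ^+ 2) + sg * (1 - cos th ^+ 2) by [].
apply: (lincomb1 (2 * k * (1 - cos th ^+ 2) * sin th / areaD k th ^+ 3) QE).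
by rewrite /GRing.scale /= /ddeficit; field; rewrite Q0.
Qed.

Lemma ddeficit_bounds k th : 0 < k -> 0 <= th <= pi -> 0 <= ddeficit k th <= 2 * sg / k ^+ 2.
Proof.
move=> k0 /sin_ge0_pi s0; have /andP[c0 c1] := cos2_itv th.
have Q0 := areaD_gt0 th k0; have s1 := sin_le1 th.
have v0 : 0 <= (1 - cos th ^+ 2) ^+ 2 <= 1.
  by rewrite sqr_ge0 /= expr_le1//; lra.
case/andP: v0 => v0 v1.
have sk : 0 <= 2 * sg * k by rewrite !mulr_ge0 ?ltW.
apply/andP; split.
  by rewrite /ddeficit mulr_ge0// divr_ge0 ?exprn_ge0 ?(ltW Q0)// mulr_ge0.
apply: (@le_trans _ _ (2 * sg * k * (1 - cos th ^+ 2) ^+ 2 / areaD k th ^+ 3)).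
  by rewrite /ddeficit ler_piMr// divr_ge0 ?exprn_ge0 ?(ltW Q0)// mulr_ge0.
apply: (@le_trans _ _ (2 * sg * k / k ^+ 3)).
  apply: ler_pM => //.
  - by rewrite mulr_ge0.
  - by rewrite invr_ge0 exprn_ge0 ?ltW.
  - by rewrite ler_piMr.
  - rewrite lef_pV2 ?posrE ?exprn_gt0//.
    by apply: lerXn2r; rewrite ?nnegrE ?(ltW k0) ?(ltW Q0)// areaD_ge.
by rewrite le_eqVlt; apply/orP; left; apply/eqP; field; rewrite gt_eqF.
Qed.

Lemma near_itv k : 0 < k -> `]k / 2, (2 * k)[%classic k.
Proof. by move=> k0; rewrite /= in_itv/=; apply/andP; split; lra. Qed.

Lemma ddeficit_bound_itv k0 k th : 0 < k0 -> `]k0 / 2, (2 * k0)[%classic k ->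
  0 <= th <= pi -> `|ddeficit k th| <= 8 * sg / k0 ^+ 2.
Proof.
move=> k00; rewrite /= in_itv/= => /andP[k1 k2] thp.
have k0' : 0 < k by lra.
have /andP[h1 h2] := ddeficit_bounds k0' thp.
rewrite ger0_norm//; apply: le_trans h2 _.
have -> : 8 * sg / k0 ^+ 2 = 2 * sg / (k0 / 2) ^+ 2.
  by field; rewrite gt_eqF.
apply: ler_wpM2l; first by rewrite mulr_ge0// ltW.
rewrite lef_pV2 ?posrE ?exprn_gt0 ?divr_gt0//.
by apply: lerXn2r; rewrite ?nnegrE; lra.
Qed.

Lemma cst_integrable (B : R) : mu.-integrable `[0, pi] (EFin \o (fun=> B)).
Proof. by apply: continuous_integrable => x; exact: cvg_cst. Qed.

Lemma is_derive_int_deficit k : 0 < k -> is_derive k (1 : R) int_deficit (int_ddeficit k).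
Proof.
move=> k0; have mI : measurable (`[0, pi]%classic : set (measurableTypeR R)) by [].
have pos x : `]k / 2, (2 * k)[%classic x -> 0 < x.
  by rewrite /= in_itv/= => /andP[]; lra.
have iJ x : `]k / 2, (2 * k)[%classic x -> mu.-integrable `[0, pi] (EFin \o deficit x).
  by move=> /pos x0; exact/continuous_integrable/cont_deficit.
have dJ x y : `]k / 2, (2 * k)[%classic x -> `[0, pi]%classic y ->
    derivable (deficit ^~ y) x 1.
  by move=> /pos x0 _; have [] := is_derive_deficit y x0.
have G0 : forall y : R, 0 <= (fun=> 8 * sg / k ^+ 2 : R) y.
  by move=> _; rewrite divr_ge0 ?sqr_ge0// mulr_ge0// ltW.
have pJ x y : `]k / 2, (2 * k)[%classic x -> partial1of2 deficit x y = ddeficit x y.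
  by move=> /pos x0; rewrite partial1of2E; have [] := is_derive_deficit y x0.
have bJ x y : `]k / 2, (2 * k)[%classic x -> `[0, pi]%classic y ->
    `|partial1of2 deficit x y| <= (fun=> 8 * sg / k ^+ 2 : R) y.
  by move=> Ix Iy; rewrite pJ//; exact: ddeficit_bound_itv.
have kI := near_itv k0.
apply: DeriveDef.
  exact: (derivable_under_integral mI kI iJ dJ G0 (cst_integrable _) bJ).
rewrite -derive1E.
rewrite (differentiation_under_integral mI kI iJ dJ G0 (cst_integrable _) bJ).
by apply: eq_Rintegral => y _; rewrite pJ.
Qed.

Lemma cont_int_ddeficit k : 0 < k -> {for k, continuous int_ddeficit}.
Proof.
move=> k0; have mI : measurable (`[0, pi]%classic : set (measurableTypeR R)) by [].
have pos x : `]k / 2, (2 * k)[%classic x -> 0 < x.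
  by rewrite /= in_itv/= => /andP[]; lra.
apply: (@continuity_under_integral _ _ _ mu ddeficit _ mI (k / 2) (2 * k) _ _ 
  (fun=> 8 * sg / k ^+ 2) (cst_integrable _)).
- by move=> x /pos x0; exact/continuous_integrable/cont_ddeficit.
- apply: aeW => y _ x; rewrite inE => /pos x0.
  have Q0 : areaD x y != 0 by rewrite gt_eqF// areaD_gt0.
  have dQ : is_derive x (1 : R) (areaD ^~ y) (1 + cos y ^+ 2).
    by rewrite /areaD; apply: is_derive_eq; rewrite /GRing.scale /=; ring.
  have h := @is_deriveV _ (areaD ^~ y) x _ 1 Q0 dQ.
  apply: differentiable_continuous; apply/derivable1_diffP.
  have -> : ddeficit ^~ y = (fun k =>
    2 * sg * k * (1 - cos y ^+ 2) ^+ 2 * (areaD k y)^-1 ^+ 3 * sin y).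
    by apply/funext => th; rewrite /ddeficit exprVn.
  exact: ex_derive.
- by move=> x Ix; apply: aeW => y Iy; exact: ddeficit_bound_itv.
- by rewrite inE; exact: near_itv.
Qed.

Lemma int_ddeficit_gt0 k : 0 < k -> 0 < int_ddeficit k.
Proof.
move=> k0.
have pi0 : 0 < pi :> R := pi_gt0 R.
have l2 : pi / 4 <= 3 * pi / 4 :> R by lra.
have [th0 th0I mth] := EVT_min l2 (continuous_subspaceT (cont_ddeficit k0)).
move: th0I; rewrite in_itv/= => /andP[t1 t2].
have m0 : 0 < ddeficit k th0.
  have s0 : 0 < sin th0 by apply: sin_gt0_pi; apply/andP; split; lra.
  have v0 : 0 < 1 - cos th0 ^+ 2.
    by have := cos2Dsin2 th0; have := exprn_gt0 2 s0; lra.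
  by rewrite /ddeficit !mulr_gt0 ?invr_gt0 ?exprn_gt0 ?areaD_gt0.
have h1 : 0 <= pi / 4 :> R by lra.
have h2 : 3 * pi / 4 <= pi :> R by lra.
have /andP[h _] := Rintegral_bounds h1 l2 h2 (ltW m0)
  (fun th => ddeficit_bounds k0) (fun th => fun hth => mth th hth).
apply: lt_le_trans h; rewrite mulr_gt0//; lra.
Qed.

End AreaIntegral.

(** * Area along the family *)

Section AreaFamily.
Context {R : realType}.
Local Notation mu := (@lebesgue_measure R).
Variables a b e : R.
Hypotheses (a0 : 0 < a) (b0 : 0 < b) (e0 : 0 < e) (eE : e ^+ 2 = a ^+ 2 - b ^+ 2).
Notation F := (Phi (a ^+ 2) (b ^+ 2)).
Implicit Types t th ph : R.

Definition spherical_dth th ph : E3 R := pt3 (cos th * cos ph) (cos th * sin ph) (- sin th).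
Definition spherical_dph th ph : E3 R := pt3 (- (sin th * sin ph)) (sin th * cos ph) 0.

Lemma sphericalE th ph :
  spherical th ph = pt3 (sin th * cos ph) (sin th * sin ph) (cos th).
Proof. by []. Qed.

Lemma spherical_sphere th ph : sphere 1 (spherical th ph).
Proof.
rewrite /sphere /= sphericalE dotE !pt3E invr1.
apply: (lincomb2 (sin th ^+ 2) 1 (cos2Dsin2 ph) (cos2Dsin2 th)); ring.
Qed.

Lemma tangent_spherical_dth th ph : tangent (spherical th ph) (spherical_dth th ph).
Proof.
rewrite /tangent /= sphericalE dotE !pt3E.
apply: (lincomb1 (sin th * cos th) (cos2Dsin2 ph)); ring.
Qed.

Lemma tangent_spherical_dph th ph : tangent (spherical th ph) (spherical_dph th ph).
Proof. by rewrite /tangent /= sphericalE dotE !pt3E; ring. Qed.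

Lemma is_derive_spherical_th th ph j :
  is_derive th (1 : R) (fun r => spherical r ph 0 j) (spherical_dth th ph 0 j).
Proof.
have [->|->|->] := ord3P j; rewrite /spherical_dth pt3E;
  under eq_fun do rewrite sphericalE pt3E.
- by apply: is_derive_eq; rewrite /GRing.scale /=; ring.
- by apply: is_derive_eq; rewrite /GRing.scale /=; ring.
- exact: is_derive_cos.
Qed.

Lemma is_derive_spherical_ph th ph j :
  is_derive ph (1 : R) (fun r => spherical th r 0 j) (spherical_dph th ph 0 j).
Proof.
have [->|->|->] := ord3P j; rewrite /spherical_dph pt3E;
  under eq_fun do rewrite sphericalE pt3E.
- by apply: is_derive_eq; rewrite /GRing.scale /=; ring.
- by apply: is_derive_eq; rewrite /GRing.scale /=; ring.
- exact: is_derive_cst.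
Qed.

Definition stretch t := e ^+ 2 * (cosh t ^+ 2 + sinh t ^+ 2).

Lemma stretch_gt0 t : 0 < stretch t.
Proof.
by rewrite mulr_gt0 ?exprn_gt0// cosh2; have := sqr_ge0 (sinh t); lra.
Qed.

Lemma stretch_ge t : e ^+ 2 <= stretch t.
Proof.
rewrite /stretch cosh2 ler_peMr ?sqr_ge0//; have := sqr_ge0 (sinh t); lra.
Qed.

Let sg := a ^+ 2 + b ^+ 2.
Let sg0 : 0 < sg. Proof. by rewrite addr_gt0 ?exprn_gt0. Qed.

(** By conformality the coordinate fields are orthogonal with
    squared lengths m and m sin^2 th. *)
Lemma area_density_Phi t th ph : 0 <= th <= pi ->
  area_density (F t) th ph = area_integrand sg (stretch t) th.
Proof.
move=> /sin_ge0_pi s0.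
have Sp := spherical_sphere th ph.
have T1 := tangent_spherical_dth th ph; have T2 := tangent_spherical_dph th ph.
have FE r r' : F t (spherical r r') = phimap a b e (sinh t) (cosh t) (spherical r r').
  exact: (PhiE a0 b0 e0 eE t (spherical_sphere _ _)).
have cE := cosh2 t.
have d1 : derive1 (fun s => F t (spherical s ph)) th
    = dphimap a b e (sinh t) (cosh t) (spherical th ph) (spherical_dth th ph).
  have -> : (fun s => F t (spherical s ph)) =
      (fun s => phimap a b e (sinh t) (cosh t) (spherical s ph)) by apply/funext.
  rewrite derive1E.
  have [_ h] := is_derive_phimap (q := fun r => spherical r ph) (r := th) e0 eE cE Sp
    (fun j => is_derive_spherical_th th ph j).
  exact: h.
have d2 : derive1 (fun s => F t (spherical th s)) ph
    = dphimap a b e (sinh t) (cosh t) (spherical th ph) (spherical_dph th ph).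
  have -> : (fun s => F t (spherical th s)) =
      (fun s => phimap a b e (sinh t) (cosh t) (spherical th s)) by apply/funext.
  rewrite derive1E.
  have [_ h] := is_derive_phimap (q := fun r => spherical th r) (r := ph) e0 eE cE Sp
    (fun j => is_derive_spherical_ph th ph j).
  exact: h.
rewrite /area_density /= d1 d2.
rewrite (conformal_phimap e0 eE cE Sp T1 T1) (conformal_phimap e0 eE cE Sp T2 T2)
  (conformal_phimap e0 eE cE Sp T1 T2).
have m0 := mfac_gt0 e0 eE cE Sp.
have -> : dot (spherical_dth th ph) (spherical_dth th ph) = 1.
  rewrite dotE !pt3E.
  apply: (lincomb2 (cos th ^+ 2) 1 (cos2Dsin2 ph) (cos2Dsin2 th)); ring.
have -> : dot (spherical_dph th ph) (spherical_dph th ph) = sin th ^+ 2.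
  rewrite dotE !pt3E.
  apply: (lincomb1 (sin th ^+ 2) (cos2Dsin2 ph)); ring.
have -> : dot (spherical_dth th ph) (spherical_dph th ph) = 0.
  by rewrite dotE !pt3E; ring.
set m := mfac _ _ _ _ _ _ in m0 *.
have -> : m * 1 * (m * sin th ^+ 2) - (m * 0) ^+ 2 = (m * sin th) ^+ 2 by ring.
rewrite sqrtr_sqr ger0_norm; last by rewrite mulr_ge0// ltW.
rewrite /area_integrand; congr (_ * _); rewrite /m /mfac sphericalE pt3E.
have /andP[x1 x2] := sphere_itv Sp; move: x1 x2; rewrite sphericalE pt3E => x1 x2.
have D0 := DD_gt0 e0 eE cE x1 x2.
have DE : areaD sg (stretch t) th = 2 * DD a b (sinh t) (cosh t) (cos th).
  by rewrite (DD_uv eE cE).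
by rewrite DE /stretch; field; rewrite gt_eqF.
Qed.

Lemma area_Phi t : area (F t) = 32 * pi / sg * (1 - int_deficit sg (stretch t)).
Proof.
have k0 := stretch_gt0 t.
rewrite /area.
transitivity (\int[mu]_(ph in `[0, 2 * pi]) (16 / sg * (1 - int_deficit sg (stretch t)))).
  apply: eq_Rintegral => ph _; rewrite -int_area_integrand//.
  apply: eq_Rintegral => th; rewrite inE /= in_itv/= => thp.
  exact: area_density_Phi.
rewrite Rintegral_cst//= lebesgue_measure_itv/= lte_fin.
rewrite mulr_gt0 ?pi_gt0//= subr0; field.
by rewrite gt_eqF.
Qed.

Lemma area_Phi_max t : area (F t) <= area (F 0).
Proof.
rewrite !area_Phi; apply: ler_wpM2l.
  by rewrite divr_ge0 ?(ltW sg0)// mulr_ge0// pi_ge0.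
apply: lerB => //; apply: int_deficit_le => //; first exact: stretch_gt0.
by rewrite {1}/stretch cosh0 sinh0 expr1n expr0n /= addr0 mulr1 stretch_ge.
Qed.

Lemma area_Phi_bound t : 0 <= area (F t) <= 32 * pi ^+ 2 / stretch t.
Proof.
have k0 := stretch_gt0 t; have pi0 : 0 < pi :> R := pi_gt0 R.
have h : area (F t) = 2 * pi * \int[mu]_(th in `[0, pi]) area_integrand sg (stretch t) th.
  by rewrite int_area_integrand// area_Phi; field; rewrite gt_eqF.
have l1 : 0 <= 0 :> R by [].
have l2 : 0 <= pi :> R by exact: pi_ge0.
have l3 : pi <= pi :> R by [].
have /andP[h1 h2] := Rintegral_bounds l1 l2 l3 (lexx 0)
  (fun th => area_integrand_bounds sg0 k0) (fun th hth => (andP (area_integrand_bounds sg0 k0 hth)).1).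
rewrite h; apply/andP; split.
  by rewrite mulr_ge0 ?mulr_ge0//; move: h1; rewrite mul0r.
have -> : 32 * pi ^+ 2 / stretch t = 2 * pi * (16 / stretch t * (pi - 0)).
  by field; rewrite gt_eqF.
by rewrite ler_wpM2l// mulr_ge0.
Qed.

Lemma stretch_ge_lin t : 0 <= t -> e ^+ 2 * t <= stretch t.
Proof.
move=> t0; rewrite /stretch ler_pM2l ?exprn_gt0//.
have h : t <= cosh t ^+ 2 + sinh t ^+ 2.
  have h1 := expR_ge1Dx t; have h2 := expR_gt0 (- t).
  have h3 : cosh t ^+ 2 + sinh t ^+ 2 = (expR t ^+ 2 + expR (- t) ^+ 2) / 2.
    by rewrite /cosh /sinh; field.
  have h4 := sqr_ge0 (expR (- t)).
  rewrite h3 ler_pdivlMr//; nra.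
exact: h.
Qed.

Lemma area_Phi_cvg0 : area (F t) @[t --> +oo] --> (0 : R).
Proof.
apply/cvgrPdist_le => eps eps0.
(* the area is at most 32 pi^2 / (e^2 t) for t > 0 *)
pose B := 32 * pi ^+ 2 / (e ^+ 2 * eps).
have B0 : 0 < B by rewrite divr_gt0 ?mulr_gt0 ?exprn_gt0 ?pi_gt0.
near=> t.
have tB : B <= t by near: t; apply: nbhs_pinfty_ge; exact: num_real.
have t0 : 0 < t by exact: lt_le_trans tB.
have /andP[h1 h2] := area_Phi_bound t.
rewrite sub0r normrN ger0_norm//; apply: le_trans h2 _.
have k0 := stretch_gt0 t.
rewrite ler_pdivrMr//.
have h : e ^+ 2 * t <= stretch t by apply: stretch_ge_lin; exact: ltW.
apply: (@le_trans _ _ (eps * (e ^+ 2 * B))).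
  by rewrite /B le_eqVlt; apply/orP; left; apply/eqP; field; rewrite !gt_eqF.
rewrite ler_wpM2l ?(ltW eps0)//; apply: le_trans h.
by rewrite ler_wpM2l// sqr_ge0.
Unshelve. all: by end_near. Qed.

(** Where the first factor vanishes, the product rule only
    needs continuity of the second one. *)
Lemma derive_mul_vanishing (f g : R -> R) (x f' : R) : f x = 0 ->
  is_derive x (1 : R) f f' -> {for x, continuous g} ->
  is_derive x (1 : R) (fun y => f y * g y) (f' * g x).
Proof.
move=> fx0 [df <-] cg.
have cv : h^-1 *: (f (h *: 1 + x) * g (h *: 1 + x) - f x * g x) @[h --> 0^'] -->
    'D_1 f x * g x.
  rewrite fx0 mul0r.
  have -> : (fun h : R => h^-1 *: (f (h *: 1 + x) * g (h *: 1 + x) - 0)) =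
      (fun h : R => h^-1 *: (f (h *: 1 + x) - f x) * g (h *: 1 + x)).
    by apply/funext => h; rewrite fx0 !subr0 /GRing.scale /= mulrA.
  apply: cvgM; first exact: df.
  apply: (@cvg_comp _ _ _ (fun h : R => h *: 1 + x) g _ (nbhs x)); last exact: cg.
  apply: cvg_trans (_ : (fun h : R => h *: 1 + x) @ (0 : R) --> x).
    by apply: cvg_app; exact: nbhs_dnbhs.
  rewrite -[X in _ --> X]add0r -[X in _ --> X + _](scale0r (1 : R)).
  apply: cvgD; last exact: cvg_cst.
  by apply: cvgZr_tmp; exact: cvg_id.
apply: DeriveDef; first by apply/cvg_ex; exists ('D_1 f x * g x).
exact: cvg_lim cv.
Qed.

Lemma is_derive_stretch t : is_derive t (1 : R) stretch (4 * e ^+ 2 * (sinh t * cosh t)).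
Proof.
have h1 := is_derive_sinh t; have h2 := is_derive_cosh t.
by rewrite /stretch; apply: is_derive_eq; rewrite /GRing.scale /=; ring.
Qed.

(** The derivative of the area is
    - C sinh t cosh t I'(k(t)) with C > 0, whose first factor vanishes at 0 with
    slope 1. *)
Lemma area_Phi_derive2 : derive1n 2 (fun t => area (F t)) 0 < 0.
Proof.
have sn0 : sg != 0 by rewrite gt_eqF.
have d1 : derive1 (fun t => area (F t)) =
    (fun t => - (128 * pi * e ^+ 2 / sg) * (sinh t * cosh t) * int_ddeficit sg (stretch t)).
  apply/funext => t; rewrite derive1E.
  have -> : (fun t => area (F t)) = (fun t => 32 * pi / sg * (1 - int_deficit sg (stretch t))).
    by apply/funext => r; exact: area_Phi.
  have dI : is_derive t (1 : R) (fun r => int_deficit sg (stretch r))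
      (int_ddeficit sg (stretch t) * (4 * e ^+ 2 * (sinh t * cosh t))).
    exact: is_derive1_comp (is_derive_int_deficit sg0 (stretch_gt0 t)) (is_derive_stretch t).
  have h : is_derive t (1 : R) (fun t => 32 * pi / sg * (1 - int_deficit sg (stretch t)))
    (- (128 * pi * e ^+ 2 / sg) * (sinh t * cosh t) * int_ddeficit sg (stretch t)).
    by apply: is_derive_eq; rewrite /GRing.scale /=; field.
  by have [_] := h.
rewrite derive1nS derive1n1 d1 derive1E.
have h1 := is_derive_sinh (0 : R); have h2 := is_derive_cosh (0 : R).
pose f (t : R) := - (128 * pi * e ^+ 2 / sg) * (sinh t * cosh t).
have df : is_derive (0 : R) (1 : R) f (- (128 * pi * e ^+ 2 / sg)).
  rewrite /f; apply: is_derive_eq.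
  by rewrite /GRing.scale /= sinh0 cosh0; ring.
have f0 : f 0 = 0 by rewrite /f sinh0 mul0r mulr0.
have cg : {for 0, continuous (fun t : R => int_ddeficit sg (stretch t))}.
  have [dk _] := is_derive_stretch 0.
  have ck : {for 0, continuous stretch}.
    by apply: differentiable_continuous; apply/derivable1_diffP.
  exact: (@cvg_comp _ _ _ stretch (int_ddeficit sg) _ _ _ ck (cont_int_ddeficit sg0 (stretch_gt0 0))).
have [_ ->] := derive_mul_vanishing f0 df cg.
rewrite mulNr oppr_lt0 mulr_gt0 ?int_ddeficit_gt0 ?stretch_gt0//.
by rewrite divr_gt0// !mulr_gt0 ?pi_gt0 ?exprn_gt0.
Qed.

Lemma unstable_Phi0 : unstable (a ^+ 2) (b ^+ 2) (F 0).
Proof.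
exists F; split => //; last exact: area_Phi_derive2.
have := hamiltonian_variation_Phi a0 b0 e0 eE 1.
by under eq_fun do rewrite mul1r.
Qed.

End AreaFamily.

(** * Mean curvature of conformal immersions *)

Section Stationary.
Context {R : realType}.
Implicit Types (p q u v w : E3 R).

(** The projection removes the multiples of the position in each
    factor, hence preserves the form of these vectors. *)
Lemma projTM_rotv (c1 c2 A1 A2 H B1 B2 K X1 X2 h Y1 Y2 k p0 p1 n : R) :
  p0 ^+ 2 + p1 ^+ 2 = n ->
  let qA := c1 * ((A1 * X1 + A2 * X2) * n + H * h) in
  let qB := c2 * ((B1 * Y1 + B2 * Y2) * n + K * k) in
  projTM c1 c2 (rotv A1 A2 H B1 B2 K p0 p1) (rotv X1 X2 h Y1 Y2 k p0 p1)
  = rotv (X1 - qA * A1) (X2 - qA * A2) (h - qA * H)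
      (Y1 - qB * B1) (Y2 - qB * B2) (k - qB * K) p0 p1.
Proof.
move=> <- qA qB; rewrite /projTM /rotv /pt /= !dotE !pt3E !pt3Z !pt3N !pt3D /qA /qB.
by congr pair; congr pt3; ring.
Qed.

Lemma dot2C (U V : E6 R) : dot2 U V = dot2 V U.
Proof. by rewrite (E6_pt U) (E6_pt V) !dot2_pt; ring. Qed.

Lemma dot2Dl (U V W : E6 R) : dot2 (U + V) W = dot2 U W + dot2 V W.
Proof.
by rewrite (E6_pt U) (E6_pt V) (E6_pt W) ptD !dot2_pt; ring.
Qed.

Lemma dot2Nl (U W : E6 R) : dot2 (- U) W = - dot2 U W.
Proof. by rewrite (E6_pt U) (E6_pt W) ptN !dot2_pt; ring. Qed.

Lemma dot2Zl k (U W : E6 R) : dot2 (k *: U) W = k * dot2 U W.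
Proof. by rewrite (E6_pt U) (E6_pt W) ptZ !dot2_pt; ring. Qed.

Lemma projTMD c1 c2 (P U V : E6 R) :
  projTM c1 c2 P (U + V) = projTM c1 c2 P U + projTM c1 c2 P V.
Proof.
rewrite (E6_pt P) (E6_pt U) (E6_pt V) ptD /projTM /pt /=.
by rewrite !dotE !pt3E !pt3Z !pt3N !pt3D; congr pair; rewrite !pt3D; congr pt3; ring.
Qed.

Lemma drotD (A1 A2 B1 B2 A1' A2' H' B1' B2' K' : R -> R) p k l v w :
  drot A1 A2 B1 B2 A1' A2' H' B1' B2' K' p (k *: v + l *: w) =
  k *: drot A1 A2 B1 B2 A1' A2' H' B1' B2' K' p v
  + l *: drot A1 A2 B1 B2 A1' A2' H' B1' B2' K' p w.
Proof.
by rewrite /drot !mxE /rotv !ptD !ptZ !ptD; congr pt; ring.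
Qed.

Lemma tangentD p k l v w : tangent p v -> tangent p w ->
  tangent p (k *: v + l *: w).
Proof.
move=> /tangentE hv /tangentE hw; rewrite /tangent /= dotE !mxE.
by apply: (lincomb2 k l hv hw); ring.
Qed.

Section FrameSums.
Variables (p e1 e2 : E3 R) (m : R).
Hypotheses (m0 : 0 < m) (Sp : sphere 1 p).
Hypothesis fs : forall j k,
  e1 0 j * e1 0 k + e2 0 j * e2 0 k = m^-1 * ((j == k)%:R - p 0 j * p 0 k).

(** An orthonormal basis of the metric m g_0 reconstructs tangent
    vectors from their inner products with its members. *)
Lemma frame_decomp v : tangent p v ->
  v = (m * dot e1 v) *: e1 + (m * dot e2 v) *: e2.
Proof.
move=> /tangentE hv; have mn : m != 0 by rewrite gt_eqF.
have fs' j k : m * (e1 0 j * e1 0 k + e2 0 j * e2 0 k) = (j == k)%:R - p 0 j * p 0 k.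
  by rewrite fs mulrA mulfV// mul1r.
apply/rowP => j; rewrite !mxE !dotE.
transitivity (\sum_(k < 3) (m * (e1 0 j * e1 0 k + e2 0 j * e2 0 k)) * v 0 k);
  last by rewrite sum3; ring.
transitivity (\sum_(k < 3) (j == k)%:R * v 0 k - p 0 j * \sum_(k < 3) p 0 k * v 0 k).
  rewrite (sum3 (fun k => p 0 k * v 0 k)) hv mulr0 subr0 (bigD1 j)//= eqxx mul1r.
  by rewrite big1 ?addr0// => k /negPf; rewrite eq_sym => ->; rewrite mul0r.
by rewrite mulr_sumr -sumrB; apply: eq_bigr => k _; rewrite fs' mulrBl mulrA.
Qed.

Lemma frame_trace : dot e1 e1 + dot e2 e2 = 2 / m.
Proof.
have mn : m != 0 by rewrite gt_eqF.
have f0 := fs 0 0; have f1 := fs 1 1; have f2 := fs 2 2.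
rewrite !eqxx /= mulr1n in f0 f1 f2; rewrite !dotE.
transitivity (m^-1 * (3 - (p 0 0 ^+ 2 + p 0 1 ^+ 2 + p 0 2 ^+ 2))).
  by apply: (lincomb3 1 1 1 f0 f1 f2); ring.
by rewrite (sphereE Sp); field.
Qed.

End FrameSums.

Section MeanCurvature.
Variables (c1 c2 : R) (F : E3 R -> E6 R) (p e1 e2 : E3 R) (m : R).
Variable dF : E3 R -> E6 R.
Hypotheses (m0 : 0 < m) (Sp : sphere 1 p).
Hypothesis dFE : forall v, tangent p v -> dS F p v = dF v.
Hypothesis dFD : forall k l v w, dF (k *: v + l *: w) = k *: dF v + l *: dF w.
Hypothesis conf : forall v w, tangent p v -> tangent p w ->
  dot2 (dF v) (dF w) = m * dot v w.
Hypothesis fr : frame F p e1 e2.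

Lemma conformal_frame_sum j k :
  e1 0 j * e1 0 k + e2 0 j * e2 0 k = m^-1 * ((j == k)%:R - p 0 j * p 0 k).
Proof.
apply: (frame_sum m0 Sp _ fr) => v w Tv Tw.
by apply: etrans (conf Tv Tw); congr dot2; exact: dFE.
Qed.

Definition tproj W := dot2 W (dF e1) *: dF e1 + dot2 W (dF e2) *: dF e2.

(** The tangential part of W is the sum of its components
    along the images of the frame. *)
Lemma normal_part_tproj W : is_normal_part F p W (W - tproj W).
Proof.
have [T1 T2 _ _ _] := fr; split.
  exists (dot2 W (dF e1) *: e1 + dot2 W (dF e2) *: e2); first exact: tangentD.
  rewrite dFE; last exact: tangentD.
  by rewrite dFD opprB addrC subrK.
move=> v Tv; rewrite dFE//.
rewrite dot2Dl dot2Nl /tproj dot2Dl !dot2Zl !conf//.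
rewrite {1}(frame_decomp m0 conformal_frame_sum Tv) dFD dot2C dot2Dl !dot2Zl.
rewrite ![dot2 _ W]dot2C; ring.
Qed.

(** If the projection onto T M of the trace L of the second
    derivative is already normal to the surface, the tangential parts of the
    two terms cancel. *)
Lemma mean_curvature_pt (H : E6 R) (L : E6 R) :
  d2S F p e1 e1 + d2S F p e2 e2 = L ->
  (forall v, tangent p v -> dot2 (projTM c1 c2 (F p) L) (dF v) = 0) ->
  H = 2^-1 *: projTM c1 c2 (F p) L ->
  exists h1 h2, [/\ is_second_form c1 c2 F p e1 e1 h1,
    is_second_form c1 c2 F p e2 e2 h2 & H = 2^-1 *: (h1 + h2)].
Proof.
move=> dL orth ->; have [T1 T2 _ _ _] := fr.
pose W1 := projTM c1 c2 (F p) (d2S F p e1 e1).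
pose W2 := projTM c1 c2 (F p) (d2S F p e2 e2).
exists (W1 - tproj W1), (W2 - tproj W2); split; try exact: normal_part_tproj.
have hW : W1 + W2 = projTM c1 c2 (F p) L by rewrite -dL projTMD.
have ht : tproj W1 + tproj W2 = 0.
  rewrite /tproj addrACA -!scalerDl -!dot2Dl hW !orth//.
  by rewrite !scale0r addr0.
by rewrite addrACA -opprD ht oppr0 addr0 hW.
Qed.

End MeanCurvature.

End Stationary.

(** * Stationarity at time zero *)

Section FrameLaplacian.
Context {R : realType}.
Implicit Types (p q u v w : E3 R).

(** The coefficient of z in the Laplacian on the unit sphere of f(x) z. *)
Definition lapZ (f f' f'' : R -> R) (x : R) :=
  (1 - x ^+ 2) * f'' x - 4 * x * f' x - 2 * f x.
(** The Laplacian on the unit sphere of h(x). *)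
Definition lapH (f' f'' : R -> R) (x : R) := (1 - x ^+ 2) * f'' x - 2 * x * f' x.

(** The trace over a frame of m g_0 is 1 / m times the Laplacian
    of the sphere. *)
Lemma d2rot_frame_sum (A1 A2 B1 B2 A1' A2' H' B1' B2' K'
    A1'' A2'' H'' B1'' B2'' K'' : R -> R) (p e1 e2 : E3 R) (m : R) :
  0 < m -> sphere 1 p ->
  (forall j k,
    e1 0 j * e1 0 k + e2 0 j * e2 0 k = m^-1 * ((j == k)%:R - p 0 j * p 0 k)) ->
  let x := p 0 2 in
  d2rot A1 A2 B1 B2 A1' A2' H' B1' B2' K' A1'' A2'' H'' B1'' B2'' K'' p e1
  + d2rot A1 A2 B1 B2 A1' A2' H' B1' B2' K' A1'' A2'' H'' B1'' B2'' K'' p e2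
  = m^-1 *: rotv (lapZ A1 A1' A1'' x) (lapZ A2 A2' A2'' x) (lapH H' H'' x)
    (lapZ B1 B1' B1'' x) (lapZ B2 B2' B2'' x) (lapH K' K'' x) (p 0 0) (p 0 1).
Proof.
move=> m0 Sp fs x.
have tr := frame_trace m0 Sp fs.
have s02 := fs 0 2; have s12 := fs 1 2; have s22 := fs 2 2.
rewrite /= mulr0n sub0r in s02; rewrite /= mulr0n sub0r in s12.
rewrite eqxx /= mulr1n in s22.
rewrite /d2rot /rotv !ptZ !ptN !ptD -/x; rewrite -/x in s02 s12 s22.
move: (dot e1 e1) (dot e2 e2) tr => d1 d2 tr.
move: (e1 0 0) (e1 0 1) (e1 0 2) (e2 0 0) (e2 0 1) (e2 0 2) s02 s12 s22.
move=> e10 e11 e12 e20 e21 e22 s02 s12 s22.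
rewrite /lapZ /lapH.
move: (A1 x) (A2 x) (B1 x) (B2 x) (A1' x) (A2' x) (H' x) (B1' x) (B2' x) (K' x)
  (A1'' x) (A2'' x) (H'' x) (B1'' x) (B2'' x) (K'' x) =>
  a1 a2 b1 b2 a1' a2' h' b1' b2' k' a1'' a2'' h'' b1'' b2'' k''.
congr pt.
- apply: (lincomb4 (a1'' * p 0 0 - a2'' * p 0 1)
    (- (a1' * x * p 0 0 - a2' * x * p 0 1) - (a1 * p 0 0 - a2 * p 0 1))
    (2 * a1') (- (2 * a2')) s22 tr s02 s12); ring.
- apply: (lincomb4 (a2'' * p 0 0 + a1'' * p 0 1)
    (- (a2' * x * p 0 0 + a1' * x * p 0 1) - (a2 * p 0 0 + a1 * p 0 1))
    (2 * a2') (2 * a1') s22 tr s02 s12); ring.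
- apply: (lincomb2 h'' (- (h' * x)) s22 tr); ring.
- apply: (lincomb4 (b1'' * p 0 0 + b2'' * p 0 1)
    (- (b1' * x * p 0 0 + b2' * x * p 0 1) - (b1 * p 0 0 + b2 * p 0 1))
    (2 * b1') (2 * b2') s22 tr s02 s12); ring.
- apply: (lincomb4 (b2'' * p 0 0 - b1'' * p 0 1)
    (- (b2' * x * p 0 0 - b1' * x * p 0 1) - (b2 * p 0 0 - b1 * p 0 1))
    (2 * b2') (- (2 * b1')) s22 tr s02 s12); ring.
- apply: (lincomb2 k'' (- (k' * x)) s22 tr); ring.
Qed.

End FrameLaplacian.

Section StationaryPhi0.
Context {R : realType}.
Implicit Types (p q u v w : E3 R).
Variables a b e : R.
Hypotheses (a0 : 0 < a) (b0 : 0 < b) (e0 : 0 < e) (eE : e ^+ 2 = a ^+ 2 - b ^+ 2).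
Notation F0 := (Phi (a ^+ 2) (b ^+ 2) 0).

Let aE : a ^+ 2 = b ^+ 2 + e ^+ 2. Proof. by rewrite eE; ring. Qed.
Let an0 : a != 0. Proof. by rewrite gt_eqF. Qed.
Let bn0 : b != 0. Proof. by rewrite gt_eqF. Qed.
Let cE : (1 : R) ^+ 2 = 1 + 0 ^+ 2. Proof. by rewrite expr0n addr0 expr1n. Qed.

Notation A1 := (profA1 a b e 0 1).
Notation A2 := (profA2 a b e 0 1).
Notation H := (profH a b 0 1).
Notation B1 := (profB1 a b e 0 1).
Notation B2 := (profB2 a b e 0 1).
Notation K := (profK a b 0 1).
Notation A1' := (profA1' a b e 0 1).
Notation A2' := (profA2' a b e 0 1).
Notation H' := (profH' a b e 0 1).
Notation B1' := (profB1' a b e 0 1).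
Notation B2' := (profB2' a b e 0 1).
Notation K' := (profK' a b e 0 1).
Notation D := (DD a b 0 1).

Definition profA2'' (x : R) := 4 * e * b ^+ 2 * x * (3 * a ^+ 2 + b ^+ 2 * x ^+ 2) / D x ^+ 3.
Definition profB1'' (x : R) := 4 * e * b ^+ 2 * (a ^+ 2 + 3 * b ^+ 2 * x ^+ 2) / D x ^+ 3.
Definition profH'' (x : R) := 4 * a * e ^+ 2 * (a ^+ 2 + 3 * b ^+ 2 * x ^+ 2) / D x ^+ 3.
Definition profK'' (x : R) := 4 * b * e ^+ 2 * (a ^+ 2 + 3 * b ^+ 2 * x ^+ 2) / D x ^+ 3.

Lemma D01E x : D x = a ^+ 2 - (b * x) ^+ 2.
Proof. by rewrite /DD; ring. Qed.

Lemma D01_neq0 x : -1 <= x -> x <= 1 -> a ^+ 2 - (b * x) ^+ 2 != 0.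
Proof. by move=> x1 x2; rewrite -D01E gt_eqF// (DD_gt0 e0 eE cE). Qed.

Lemma A1_0 : A1 = (fun=> 0). Proof. by apply/funext => x; rewrite /profA1 mulr0 mul0r. Qed.
Lemma B2_0 : B2 = (fun=> 0). Proof. by apply/funext => x; rewrite /profB2 mulr0 !mul0r. Qed.
Lemma A1'_0 : A1' = (fun=> 0).
Proof. by apply/funext => x; rewrite /profA1' mulr0 !mul0r oppr0 mul0r. Qed.
Lemma B2'_0 : B2' = (fun=> 0). Proof. by apply/funext => x; rewrite /profB2' mulr0 !mul0r. Qed.

Lemma derives_quot2 (N N' : R -> R) (x : R) : -1 <= x -> x <= 1 ->
  is_derive x (1 : R) N (N' x) ->
  is_derive x (1 : R) (fun y => N y / D y ^+ 2)
    ((N' x * D x + 4 * b ^+ 2 * x * N x) / D x ^+ 3).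
Proof.
move=> x1 x2 dN; have D0 := D01_neq0 x1 x2; rewrite -D01E in D0.
have dV := is_derive_quot e0 eE cE x1 x2 dN.
have dW := is_derive_quot e0 eE cE x1 x2 (is_derive_cst (1 : R) x (1 : R)).
have -> : (fun y => N y / D y ^+ 2) = (fun y => N y / D y * (1 / D y)).
  by apply/funext => y; rewrite mul1r expr2 invfM mulrA.
apply: is_derive_eq; rewrite /GRing.scale /= /kap; field.
by rewrite D0.
Qed.

Lemma derives_A2' : derives_on A2' profA2''.
Proof.
move=> x x1 x2; have D0 := D01_neq0 x1 x2.
have dN : is_derive x (1 : R)
    (fun x => 2 * e * 1 * (D x - 2 * kap a b 0 1 * x ^+ 2)) (4 * e * b ^+ 2 * x).
  by rewrite /DD /kap; apply: is_derive_eq; rewrite /GRing.scale /=; ring.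
apply: (is_derive_eq (f := A2') (derives_quot2 (N' := fun x => 4 * e * b ^+ 2 * x) x1 x2 dN)).
by rewrite /profA2'' /kap !D01E; field.
Qed.

Lemma derives_B1' : derives_on B1' profB1''.
Proof.
move=> x x1 x2; have D0 := D01_neq0 x1 x2.
have dN : is_derive x (1 : R)
    (fun x => - (4 * e * 1 * kap a b 0 1 * x)) (4 * e * b ^+ 2).
  by rewrite /kap; apply: is_derive_eq; rewrite /GRing.scale /=; ring.
apply: (is_derive_eq (f := B1') (derives_quot2 (N' := fun=> 4 * e * b ^+ 2) x1 x2 dN)).
by rewrite /profB1'' /kap !D01E; field.
Qed.

Lemma derives_H' : derives_on H' profH''.
Proof.
move=> x x1 x2; have D0 := D01_neq0 x1 x2.
have dN : is_derive x (1 : R)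
    (fun x => 4 * a * e ^+ 2 * (1 ^+ 2 + 0 ^+ 2) * x) (4 * a * e ^+ 2).
  by apply: is_derive_eq; rewrite /GRing.scale /=; ring.
apply: (is_derive_eq (f := H') (derives_quot2 (N' := fun=> 4 * a * e ^+ 2) x1 x2 dN)).
by rewrite /profH'' !D01E; field.
Qed.

Lemma derives_K' : derives_on K' profK''.
Proof.
move=> x x1 x2; have D0 := D01_neq0 x1 x2.
have dN : is_derive x (1 : R)
    (fun x => 4 * b * e ^+ 2 * (1 ^+ 2 + 0 ^+ 2) * x) (4 * b * e ^+ 2).
  by apply: is_derive_eq; rewrite /GRing.scale /=; ring.
apply: (is_derive_eq (f := K') (derives_quot2 (N' := fun=> 4 * b * e ^+ 2) x1 x2 dN)).
by rewrite /profK'' !D01E; field.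
Qed.

Definition LA2 := lapZ A2 A2' profA2''.
Definition LB1 := lapZ B1 B1' profB1''.
Definition LH := lapH H' profH''.
Definition LK := lapH K' profK''.

(** The Laplacian of a conformal immersion of a surface is orthogonal
    to the surface. *)
Lemma lap_orth (x : R) : -1 <= x -> x <= 1 ->
  (LA2 x * A2' x + LB1 x * B1' x) * (1 - x ^+ 2)
  - x * (LA2 x * A2 x + LB1 x * B1 x) + LH x * H' x + LK x * K' x = 0.
Proof.
move=> x1 x2; have D0 := D01_neq0 x1 x2.
rewrite /LA2 /LB1 /LH /LK /lapZ /lapH /profA2'' /profB1'' /profH'' /profK'' /profA2 /profB1 /profA2' /profB1' /profH' /profK' /kap !D01E.
field: aE.
by rewrite D0.
Qed.

(** This and the next identity say that JH is the image of the rotation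
    field with coefficient D / (4 (1 + x^2)). *)
Lemma lap_JA (x : R) : -1 <= x -> x <= 1 ->
  a * (A2 x * LH x - H x * LA2 x) = - (2 * mfac a b e 0 1 x) * (e * x / (2 * (1 + x ^+ 2))).
Proof.
move=> x1 x2; have D0 := D01_neq0 x1 x2.
have u0 : 1 + x ^+ 2 != 0 by rewrite gt_eqF//; have := sqr_ge0 x; lra.
rewrite /LA2 /LH /lapZ /lapH /mfac /profA2'' /profH'' /profA2 /profH /profA2' /profH' /kap !D01E.
field: aE.
by rewrite D0 an0 u0.
Qed.

Lemma lap_JB (x : R) : -1 <= x -> x <= 1 ->
  b * (B1 x * LK x - K x * LB1 x) = 2 * mfac a b e 0 1 x * (e / (2 * (1 + x ^+ 2))).
Proof.
move=> x1 x2; have D0 := D01_neq0 x1 x2.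
have u0 : 1 + x ^+ 2 != 0 by rewrite gt_eqF//; have := sqr_ge0 x; lra.
rewrite /LB1 /LK /lapZ /lapH /mfac /profB1'' /profK'' /profB1 /profK /profB1' /profK' /kap !D01E.
field: aE.
by rewrite D0 bn0 u0.
Qed.
End StationaryPhi0.

Section StationaryAssembly.
Context {R : realType}.
Implicit Types (p q u v w : E3 R).

Lemma projTMZ c1 c2 k (P U : E6 R) :
  projTM c1 c2 P (k *: U) = k *: projTM c1 c2 P U.
Proof.
rewrite (E6_pt P) (E6_pt U) ptZ /projTM /pt /=.
by rewrite !dotE !pt3E !pt3Z !pt3N !pt3D -![(pt3 _ _ _, _)]/(pt _ _ _ _ _ _) ptZ;
  congr pt; ring.
Qed.

Lemma dot_rotv_drot (X2 h Y1 k A2 B1 A2' H' B1' K' p0 p1 x v0 v1 xi : R) :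
  p0 ^+ 2 + p1 ^+ 2 + x ^+ 2 = 1 -> p0 * v0 + p1 * v1 + x * xi = 0 ->
  (X2 * A2' + Y1 * B1') * (1 - x ^+ 2) - x * (X2 * A2 + Y1 * B1)
    + h * H' + k * K' = 0 ->
  dot2 (rotv 0 X2 h Y1 0 k p0 p1)
    (rotv 0 (A2' * xi) (H' * xi) (B1' * xi) 0 (K' * xi) p0 p1
     + rotv 0 A2 0 B1 0 0 v0 v1) = 0.
Proof.
move=> hp hv ho; rewrite /rotv ptD dot2_pt.
by apply: (lincomb3 ((X2 * A2' + Y1 * B1') * xi) (X2 * A2 + Y1 * B1) xi hp hv ho); ring.
Qed.

Variables a b e : R.
Hypotheses (a0 : 0 < a) (b0 : 0 < b) (e0 : 0 < e) (eE : e ^+ 2 = a ^+ 2 - b ^+ 2).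
Notation F0 := (Phi (a ^+ 2) (b ^+ 2) 0).
Let cE : (1 : R) ^+ 2 = 1 + 0 ^+ 2. Proof. by rewrite expr0n addr0 expr1n. Qed.

Notation A2 := (profA2 a b e 0 1).
Notation H := (profH a b 0 1).
Notation B1 := (profB1 a b e 0 1).
Notation K := (profK a b 0 1).
Notation A2' := (profA2' a b e 0 1).
Notation H' := (profH' a b e 0 1).
Notation B1' := (profB1' a b e 0 1).
Notation K' := (profK' a b e 0 1).
Notation m := (mfac a b e 0 1).

Lemma phimap0E p : phimap a b e 0 1 p = rotv 0 (A2 (p 0 2)) (H (p 0 2)) (B1 (p 0 2)) 0
  (K (p 0 2)) (p 0 0) (p 0 1).
Proof. by rewrite /phimap /rotmap A1_0 B2_0. Qed.

Lemma dphimap0E p v : dphimap a b e 0 1 p v =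
  rotv 0 (A2' (p 0 2) * v 0 2) (H' (p 0 2) * v 0 2) (B1' (p 0 2) * v 0 2) 0
    (K' (p 0 2) * v 0 2) (p 0 0) (p 0 1)
  + rotv 0 (A2 (p 0 2)) 0 (B1 (p 0 2)) 0 0 (v 0 0) (v 0 1).
Proof. by rewrite /dphimap /drot A1_0 B2_0 A1'_0 B2'_0 !mul0r. Qed.

Lemma Phi0E p : sphere 1 p -> F0 p = phimap a b e 0 1 p.
Proof. by move=> Sp; rewrite (PhiE a0 b0 e0 eE)// sinh0 cosh0. Qed.

Lemma dS_Phi0 p v : sphere 1 p -> tangent p v -> dS F0 p v = dphimap a b e 0 1 p v.
Proof.
move=> Sp Tv; have := dS_Phi a0 b0 e0 eE 0 Sp Tv.
by rewrite sinh0 cosh0.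
Qed.

Definition laplacian p := rotv 0 (LA2 a b e (p 0 2)) (LH a b e (p 0 2))
  (LB1 a b e (p 0 2)) 0 (LK a b e (p 0 2)) (p 0 0) (p 0 1).

Definition mean_curvature_field p :=
  (2 * m (p 0 2))^-1 *: projTM (a ^+ 2) (b ^+ 2) (F0 p) (laplacian p).

Lemma sphere_n p : sphere 1 p -> p 0 0 ^+ 2 + p 0 1 ^+ 2 = 1 - p 0 2 ^+ 2.
Proof. by move=> /sphereE <-; ring. Qed.

Lemma laplacian_orth p v : sphere 1 p -> tangent p v ->
  dot2 (projTM (a ^+ 2) (b ^+ 2) (F0 p) (laplacian p)) (dphimap a b e 0 1 p v) = 0.
Proof.
move=> Sp Tv; have /andP[x1 x2] := sphere_itv Sp.
rewrite Phi0E// phimap0E dphimap0E /laplacian (projTM_rotv _ _ _ _ _ _ _ _ _ _ _ _ _ _ (sphere_n Sp)).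
rewrite !mulr0 !subr0.
apply: dot_rotv_drot (sphereE Sp) (tangentE Tv) _.
have ho := lap_orth e0 eE x1 x2.
have hA := profile_dsphereA a0 e0 eE cE x1 x2.
have hB := profile_dsphereB b0 e0 eE cE x1 x2.
rewrite A1_0 in hA; rewrite B2_0 in hB.
set qA := _ * (_ * _ + _) in |- *.
set qB := b ^+ 2 * _ in |- *.
by apply: (lincomb3 1 (- qA) (- qB) ho hA hB); ring.
Qed.

Lemma mean_curvature_Phi0 : is_mean_curvature (a ^+ 2) (b ^+ 2) F0 mean_curvature_field.
Proof.
move=> p e1 e2 Sp fr; have /andP[x1 x2] := sphere_itv Sp.
have m0 := mfac_gt0 e0 eE cE Sp.
have dFE v : tangent p v -> dS F0 p v = dphimap a b e 0 1 p v by exact: dS_Phi0.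
have dFD k l v w : dphimap a b e 0 1 p (k *: v + l *: w) =
    k *: dphimap a b e 0 1 p v + l *: dphimap a b e 0 1 p w by exact: drotD.
have cf v w : tangent p v -> tangent p w ->
    dot2 (dphimap a b e 0 1 p v) (dphimap a b e 0 1 p w) = m (p 0 2) * dot v w.
  by move=> Tv Tw; exact: (conformal_phimap e0 eE cE Sp Tv Tw).
have fs := conformal_frame_sum m0 Sp dFE cf fr.
have [T1 T2 _ _ _] := fr.
apply: (mean_curvature_pt (L := (m (p 0 2))^-1 *: laplacian p) m0 Sp dFE dFD cf fr).
- have z : derives_on (fun=> 0 : R) (fun=> 0) by move=> x _ _; exact: is_derive_cst.
  have zA : derives_on (profA1' a b e 0 1) (fun=> 0) by rewrite A1'_0.
  have zB : derives_on (profB2' a b e 0 1) (fun=> 0) by rewrite B2'_0.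
  have d2 v : tangent p v -> d2S F0 p v v =
     d2rot (profA1 a b e 0 1) A2 B1 (profB2 a b e 0 1) (profA1' a b e 0 1) A2' H' B1'
      (profB2' a b e 0 1) K' (fun=> 0) (profA2'' a b e) (profH'' a b e) (profB1'' a b e) (fun=> 0)
      (profK'' a b e) p v.
    move=> Tv; apply: etrans (d2S_eq v v Phi0E Sp) _.
    exact: (d2S_rotmap (derives_A1 e0 eE cE) (derives_A2 e0 eE cE)
      (derives_H e0 eE cE) (derives_B1 e0 eE cE) (derives_B2 e0 eE cE)
      (derives_K e0 eE cE) zA (derives_A2' e0 eE) (derives_H' e0 eE)
      (derives_B1' e0 eE) zB (derives_K' e0 eE) Sp Tv).
  rewrite (d2 _ T1) (d2 _ T2) (d2rot_frame_sum _ _ _ _ _ _ _ _ _ _ _ _ _ _ _ _ m0 Sp fs).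
  rewrite /laplacian; congr (_ *: rotv _ _ _ _ _ _ _ _).
    by rewrite /lapZ A1_0 A1'_0 !mulr0 !subr0.
  by rewrite /lapZ B2_0 B2'_0 !mulr0 !subr0.
- by move=> v Tv; rewrite projTMZ dot2Zl laplacian_orth// mulr0.
- by rewrite projTMZ scalerA -invfM mulrC invfM mulrC /mean_curvature_field invfM.
Qed.

(** The profiles of JH: the coefficients of z and conj(z). *)
Definition VA (x : R) := - (e * x / (2 * (1 + x ^+ 2))).
Definition VB (x : R) := - (e / (2 * (1 + x ^+ 2))).
Definition VA' (x : R) := - (e * (1 - x ^+ 2) / (2 * (1 + x ^+ 2) ^+ 2)).
Definition VB' (x : R) := e * x / (1 + x ^+ 2) ^+ 2.
Definition JHmap := rotmap VA (fun=> 0) (fun=> 0) (fun=> 0) VB (fun=> 0).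

Lemma J_mean_curvature_field p : sphere 1 p -> J (a ^+ 2) (b ^+ 2) (F0 p) (mean_curvature_field p) = JHmap p.
Proof.
move=> Sp; have /andP[x1 x2] := sphere_itv Sp.
have m0 := mfac_gt0 e0 eE cE Sp.
have mn : m (p 0 2) != 0 by rewrite gt_eqF.
have hA := lap_JA a0 e0 eE x1 x2; have hB := lap_JB b0 e0 eE x1 x2.
rewrite /mean_curvature_field Phi0E// phimap0E /laplacian (projTM_rotv _ _ _ _ _ _ _ _ _ _ _ _ _ _ (sphere_n Sp)).
rewrite rotvZ (J_rotv _ _ _ _ _ _ _ _ _ _ _ _ (sqrt_a a0) (sqrt_b b0) (sphere_n Sp)).
rewrite /JHmap /rotmap /VA /VB.
set x := p 0 2 in x1 x2 m0 mn hA hB *.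
have u0 : 1 + x ^+ 2 != 0 by rewrite gt_eqF//; have := sqr_ge0 x; lra.
congr (rotv _ _ _ _ _ _ _ _).
- transitivity ((2 * m x)^-1 * (a * (A2 x * LH a b e x - H x * LA2 a b e x))); first by ring.
  by rewrite hA; field; rewrite mn u0.
- by ring.
- by ring.
- by ring.
- transitivity (- ((2 * m x)^-1 * (b * (B1 x * LK a b e x - K x * LB1 a b e x)))); first by ring.
  by rewrite hB; field; rewrite mn u0.
- by ring.
Qed.

Lemma derives_VA : derives_on VA VA'.
Proof.
move=> x _ _; have u0 : 1 + x ^+ 2 != 0 by rewrite gt_eqF//; have := sqr_ge0 x; lra.
have du : is_derive x (1 : R) (fun x => 1 + x ^+ 2) (2 * x).
  by apply: is_derive_eq; rewrite /GRing.scale /=; ring.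
have dV := @is_deriveV _ (fun x => 1 + x ^+ 2) x _ 1 u0 du.
have -> : VA = (fun x => - (e / 2) * (x * (1 + x ^+ 2)^-1)).
  by apply/funext => y; rewrite /VA invfM; ring.
by apply: is_derive_eq; rewrite /GRing.scale /= /VA'; field.
Qed.

Lemma derives_VB : derives_on VB VB'.
Proof.
move=> x _ _; have u0 : 1 + x ^+ 2 != 0 by rewrite gt_eqF//; have := sqr_ge0 x; lra.
have du : is_derive x (1 : R) (fun x => 1 + x ^+ 2) (2 * x).
  by apply: is_derive_eq; rewrite /GRing.scale /=; ring.
have dV := @is_deriveV _ (fun x => 1 + x ^+ 2) x _ 1 u0 du.
have -> : VB = (fun x => - (e / 2) * (1 + x ^+ 2)^-1).
  by apply/funext => y; rewrite /VB invfM; ring.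
by apply: is_derive_eq; rewrite /GRing.scale /= /VB'; field.
Qed.

(** Summed over a frame, the second factor becomes a multiple of
    p0 (p1 x) - p1 (p0 x) = 0. *)
Lemma dot_JH p w : let x := p 0 2 in
  dot2 (drot VA (fun=> 0) (fun=> 0) VB VA' (fun=> 0) (fun=> 0) (fun=> 0) VB'
          (fun=> 0) p w) (dphimap a b e 0 1 p w) =
  (VA x * A2' x - VA' x * A2 x + VB x * B1' x - VB' x * B1 x)
  * (p 0 0 * (w 0 1 * w 0 2) - p 0 1 * (w 0 0 * w 0 2)).
Proof.
move=> x; rewrite dphimap0E /drot /rotv -/x !ptD dot2_pt.
move: (VA x) (VA' x) (VB x) (VB' x) (A2 x) (A2' x) (B1 x) (B1' x) (H' x) (K' x).
move=> *; ring.
Qed.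

Lemma hamiltonian_stationary_Phi0 :
  hamiltonian_stationary (a ^+ 2) (b ^+ 2) F0.
Proof.
exists mean_curvature_field; first exact: mean_curvature_Phi0.
move=> p e1 e2 Sp fr.
have m0 := mfac_gt0 e0 eE cE Sp.
have dFE v : tangent p v -> dS F0 p v = dphimap a b e 0 1 p v by exact: dS_Phi0.
have cf v w : tangent p v -> tangent p w ->
    dot2 (dphimap a b e 0 1 p v) (dphimap a b e 0 1 p w) = m (p 0 2) * dot v w.
  by move=> Tv Tw; exact: (conformal_phimap e0 eE cE Sp Tv Tw).
have fs := conformal_frame_sum m0 Sp dFE cf fr.
have [T1 T2 _ _ _] := fr.
have z : derives_on (fun=> 0 : R) (fun=> 0) by move=> x _ _; exact: is_derive_cst.
have dV w : tangent p w -> dS (fun q => J (a ^+ 2) (b ^+ 2) (F0 q) (mean_curvature_field q)) p w =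
   drot VA (fun=> 0) (fun=> 0) VB VA' (fun=> 0) (fun=> 0) (fun=> 0) VB' (fun=> 0) p w.
  move=> Tw; apply: etrans (dS_eq w J_mean_curvature_field Sp) _.
  exact: (dS_rotmap derives_VA z z z derives_VB z Sp Tw).
rewrite /divergence (dV _ T1) (dV _ T2) (dFE _ T1) (dFE _ T2) !dot_JH.
have s02 := fs 0 2; have s12 := fs 1 2.
rewrite /= mulr0n sub0r in s02; rewrite /= mulr0n sub0r in s12.
rewrite -mulrDr; set Q := (X in X * _).
apply: (lincomb2 (Q * p 0 0) (- (Q * p 0 1)) s12 s02); ring.
Qed.

End StationaryAssembly.

(** * Immersed spheres have positive area *)

Section AreaPositive.
Context {R : realType}.
Implicit Types (p q u v w : E3 R).
Local Notation mu := (@lebesgue_measure R).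

Lemma dot_comb k l u v w :
  dot (k *: u + l *: v) w = k * dot u w + l * dot v w.
Proof. by rewrite !dotE !mxE; ring. Qed.

Lemma dot2_ge0 (W : E6 R) : 0 <= dot2 W W.
Proof. by rewrite /dot2 addr_ge0// dot_ge0. Qed.

Lemma dot2_eq0 (W : E6 R) : dot2 W W = 0 -> W = 0.
Proof.
rewrite /dot2 => h; have h1 := dot_ge0 W.1; have h2 := dot_ge0 W.2.
have w1 : W.1 = 0 by apply: dot_eq0; lra.
have w2 : W.2 = 0 by apply: dot_eq0; lra.
by case: W {h h1 h2} w1 w2 => W1 W2 /= -> ->.
Qed.

Lemma cont_dot2 (T : topologicalType) (U V : T -> E6 R) x :
  {for x, continuous U} -> {for x, continuous V} ->
  {for x, continuous (fun y => dot2 (U y) (V y))}.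
Proof.
move=> cU cV.
have cfst : continuous (@fst (E3 R) (E3 R)) by move=> ?; exact: cvg_fst.
have csnd : continuous (@snd (E3 R) (E3 R)) by move=> ?; exact: cvg_snd.
have c1 (W : T -> E6 R) j : {for x, continuous W} -> {for x, continuous (fun y => (W y).1 0 j)}.
  move=> cW; apply: (@cvg_comp _ _ _ (fun y => (W y).1) (fun M : E3 R => M 0 j) _ (nbhs (W x).1)).
    exact: (continuous_comp cW (cfst _)).
  exact: coord_continuous.
have c2 (W : T -> E6 R) j : {for x, continuous W} -> {for x, continuous (fun y => (W y).2 0 j)}.
  move=> cW; apply: (@cvg_comp _ _ _ (fun y => (W y).2) (fun M : E3 R => M 0 j) _ (nbhs (W x).2)).
    exact: (continuous_comp cW (csnd _)).
  exact: coord_continuous.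
have -> : (fun y => dot2 (U y) (V y)) = (fun y =>
    (U y).1 0 0 * (V y).1 0 0 + (U y).1 0 1 * (V y).1 0 1 + (U y).1 0 2 * (V y).1 0 2
  + ((U y).2 0 0 * (V y).2 0 0 + (U y).2 0 1 * (V y).2 0 1 + (U y).2 0 2 * (V y).2 0 2)).
  by apply/funext => y; rewrite /dot2 !dotE.
by apply: cvgD; (apply: cvgD; [apply: cvgD|]); apply: cvgM; (exact: c1 || exact: c2).
Qed.

Variables (c1 c2 : R) (F : E3 R -> E6 R).
Hypothesis immF : immersion c1 c2 F.

Let diffF p : sphere 1 p -> differentiable (radial F) p.
Proof. by move=> /sphere_neq0 p0; have [sF _ _] := immF; exact: (sF [::] p p0). Qed.

Let diffDF p v : sphere 1 p -> differentiable ('D_v (radial F)) p.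
Proof. by move=> /sphere_neq0 p0; have [sF _ _] := immF; exact: (sF [:: v] p p0). Qed.

Lemma dS_lin p k l v w : sphere 1 p ->
  dS F p (k *: v + l *: w) = k *: dS F p v + l *: dS F p w.
Proof.
by move=> Sp; rewrite /dS !deriveE ?linearP ?linearZ//; exact: diffF.
Qed.

(** Expressing dS through the three partial derivatives gives its joint
    continuity in the point and the vector. *)
Lemma dS_coord p v : sphere 1 p -> dS F p v =
  v 0 0 *: dS F p (pt3 1 0 0) + v 0 1 *: dS F p (pt3 0 1 0) + v 0 2 *: dS F p (pt3 0 0 1).
Proof.
move=> Sp.
have {1}-> : v = 1 *: (v 0 0 *: pt3 1 0 0 + v 0 1 *: pt3 0 1 0) + v 0 2 *: pt3 0 0 1.
  by rewrite !pt3Z !pt3D pt3Z pt3D; apply: E3P; rewrite pt3E; ring.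
by rewrite !dS_lin// scale1r.
Qed.

Lemma derive_curve_F (q : R -> E3 R) (q' : E3 R) (s : R) :
  (forall r, sphere 1 (q r)) ->
  (forall j, is_derive s (1 : R) (fun r => q r 0 j) (q' 0 j)) ->
  derive1 (fun r => F (q r)) s = dS F (q s) q'.
Proof.
move=> Sq dq.
have dq1 : derivable q s 1.
  by apply/derivable_mxP => i j; rewrite (ord1 i); case: (dq j).
have qE : 'D_1 q s = q'.
  rewrite derive_mx//; apply/rowP => j; rewrite mxE; by case: (dq j).
have -> : (fun r => F (q r)) = radial F \o q.
  by apply/funext => r; rewrite /radial /= normalize_id.
have dq2 : differentiable q s by apply/derivable1_diffP.
rewrite derive1E deriveE; last by apply: differentiable_comp => //; exact: diffF.
rewrite diff_comp//; last exact: diffF.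
have -> : dS F (q s) q' = 'd (radial F) (q s) q'.
  by rewrite /dS deriveE//; exact: diffF.
by rewrite -qE deriveE.
Qed.

Let Fth (ab : R * R) := dS F (spherical ab.1 ab.2) (spherical_dth ab.1 ab.2).
Let Fph (ab : R * R) := dS F (spherical ab.1 ab.2) (spherical_dph ab.1 ab.2).
Let gram (ab : R * R) := dot2 (Fth ab) (Fth ab) * dot2 (Fph ab) (Fph ab)
  - dot2 (Fth ab) (Fph ab) ^+ 2.

Lemma area_densityE th ph : area_density F th ph = Num.sqrt (gram (th, ph)).
Proof.
rewrite /area_density /gram /Fth /Fph /=.
rewrite (derive_curve_F (q := fun s => spherical s ph) (fun r => spherical_sphere r ph)
  (is_derive_spherical_th th ph)).
by rewrite (derive_curve_F (q := fun s => spherical th s) (fun r => spherical_sphere th r)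
  (is_derive_spherical_ph th ph)).
Qed.

(** The coordinate fields V and W of the image are independent, since
    the immersion is injective on tangent vectors.  With
    Z = (V.V) W - (V.W) V the Gram determinant times V.V equals Z.Z > 0. *)
Lemma gram_gt0 th ph : 0 < sin th -> 0 < gram (th, ph).
Proof.
move=> s0; rewrite /gram /Fth /Fph /=.
set p := spherical th ph; set v := spherical_dth th ph; set w := spherical_dph th ph.
have Sp : sphere 1 p by exact: spherical_sphere.
have Tv : tangent p v by exact: tangent_spherical_dth.
have Tw : tangent p w by exact: tangent_spherical_dph.
have [_ _ inj] := immF.
have vv : dot v v = 1.
  rewrite dotE !pt3E.
  by apply: (lincomb2 (cos th ^+ 2) 1 (cos2Dsin2 ph) (cos2Dsin2 th)); ring.
have ww : dot w w = sin th ^+ 2.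
  by rewrite dotE !pt3E; apply: (lincomb1 (sin th ^+ 2) (cos2Dsin2 ph)); ring.
have vw : dot v w = 0 by rewrite dotE !pt3E; ring.
clearbody p v w.
set V := dS F p v; set W := dS F p w.
have V0 : 0 < dot2 V V.
  rewrite lt_neqAle dot2_ge0 andbT eq_sym; apply/eqP => /dot2_eq0 /(inj p v Sp Tv) v0.
  by move: vv; rewrite v0 dotE !mxE !mulr0 !addr0 => /eqP; rewrite eq_sym oner_eq0.
(* z is chosen so that its image is orthogonal to V *)
pose z := dot2 V V *: w + (- dot2 V W) *: v.
have Tz : tangent p z by exact: tangentD.
have zE : dS F p z = dot2 V V *: W + (- dot2 V W) *: V by exact: dS_lin.
have zw' : dot z w = dot2 V V * dot w w + (- dot2 V W) * dot v w by exact: dot_comb.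
clearbody z V W.
have Z0 : 0 < dot2 (dS F p z) (dS F p z).
  rewrite lt_neqAle dot2_ge0 andbT eq_sym; apply/eqP => /dot2_eq0 /(inj p z Sp Tz) z0.
  have zw : dot z w = 0 by rewrite z0 dotE !mxE !mul0r !addr0.
  move: zw' V0; rewrite zw vw ww.
  move: (dot2 V V) (dot2 V W) => k l; rewrite mulr0 addr0 => h k0.
  by have := mulr_gt0 k0 (exprn_gt0 2 s0); rewrite -h ltxx.
move: Z0; rewrite zE dot2Dl !dot2Zl ![dot2 _ (_ + _)]dot2C !dot2Dl !dot2Zl [dot2 W V]dot2C.
move: (dot2 V V) (dot2 V W) (dot2 W W) V0 => x y t x0.
have -> : x * (x * t + - y * y)
  + - y * (x * y + - y * x)
  = x * (x * t - y ^+ 2) by ring.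
by rewrite pmulr_rgt0.
Qed.

Lemma continuous_mul_coords (f : R -> R) (g : R -> R) : continuous f -> continuous g ->
  continuous (fun ab : R * R => f ab.1 * g ab.2).
Proof.
move=> cf cg ab.
have cfst : continuous (@fst R R) by move=> ?; exact: cvg_fst.
have csnd : continuous (@snd R R) by move=> ?; exact: cvg_snd.
apply: cvgM.
  exact: (continuous_comp (cfst ab) (cf _)).
exact: (continuous_comp (csnd ab) (cg _)).
Qed.

Lemma cont_pt3 (T : topologicalType) (f g h : T -> R) x :
  {for x, continuous f} -> {for x, continuous g} -> {for x, continuous h} ->
  {for x, continuous (fun y => pt3 (f y) (g y) (h y))}.
Proof.
move=> cf cg ch.
have E r r' r'' : pt3 r r' r'' = r *: pt3 1 0 0 + r' *: pt3 0 1 0 + r'' *: pt3 0 0 1 :> E3 R.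
  by rewrite !pt3Z !pt3D; congr pt3; ring.
have -> : (fun y => pt3 (f y) (g y) (h y)) =
    (fun y => f y *: pt3 1 0 0 + g y *: pt3 0 1 0 + h y *: pt3 0 0 1).
  by apply/funext => y; rewrite -E.
by apply: cvgD; [apply: cvgD|]; apply: cvgZr_tmp.
Qed.

Lemma cont_dS (q v : R * R -> E3 R) : continuous q -> continuous v ->
  (forall ab, sphere 1 (q ab)) -> continuous (fun ab => dS F (q ab) (v ab)).
Proof.
move=> cq cv Sq ab.
have -> : (fun ab => dS F (q ab) (v ab)) = (fun ab =>
    v ab 0 0 *: dS F (q ab) (pt3 1 0 0) + v ab 0 1 *: dS F (q ab) (pt3 0 1 0)
    + v ab 0 2 *: dS F (q ab) (pt3 0 0 1)).
  by apply/funext => x; exact: dS_coord.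
have cw w : {for ab, continuous (fun ab => dS F (q ab) w)}.
  apply: (@continuous_comp _ _ _ q (fun p => dS F p w) ab (cq ab)).
  exact: (differentiable_continuous (diffDF w (Sq ab))).
have cj j : {for ab, continuous (fun ab => v ab 0 j)}.
  apply: (@continuous_comp _ _ _ v (fun M : E3 R => M 0 j) ab (cv ab)).
  exact: coord_continuous.
by apply: cvgD; [apply: cvgD|]; apply: cvgZ; (exact: cw || exact: cj).
Qed.

Lemma continuous_area_density :
  continuous (fun ab : R * R => Num.sqrt (gram ab)).
Proof.
have cs := @continuous_sin R; have cc := @continuous_cos R.
have cone : continuous ((fun=> 1) : R -> R) by move=> x; exact: cvg_cst.
have cfst1 (f : R -> R) : continuous f -> continuous (fun ab : R * R => f ab.1).
  move=> cf; have -> : (fun ab : R * R => f ab.1) = (fun ab => f ab.1 * (fun=> 1) ab.2).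
    by apply/funext => ab; rewrite mulr1.
  exact: (continuous_mul_coords cf cone).
have cN (f : R * R -> R) : continuous f -> continuous (fun ab => - f ab).
  by move=> cf ab; apply: cvgN; exact: cf.
have cS : continuous (fun ab : R * R => spherical ab.1 ab.2).
  move=> ab; exact: (cont_pt3 (@continuous_mul_coords _ _ cs cc ab) (@continuous_mul_coords _ _ cs cs ab) (cfst1 _ cc ab)).
have cth : continuous Fth.
  apply: cont_dS => // [ab|ab]; last exact: spherical_sphere.
  exact: (cont_pt3 (@continuous_mul_coords _ _ cc cc ab) (@continuous_mul_coords _ _ cc cs ab) (cN _ (cfst1 _ cs) ab)).
have cph : continuous Fph.
  apply: cont_dS => // [ab|ab]; last exact: spherical_sphere.
  exact: (cont_pt3 (cN _ (@continuous_mul_coords _ _ cs cs) ab) (@continuous_mul_coords _ _ cs cc ab) (cvg_cst _)).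
move=> ab; apply: (@continuous_comp _ _ _ gram Num.sqrt); last exact: sqrt_continuous.
have -> : gram = (fun ab => dot2 (Fth ab) (Fth ab) * dot2 (Fph ab) (Fph ab)
  - dot2 (Fth ab) (Fph ab) * dot2 (Fth ab) (Fph ab)).
  by apply/funext => x; rewrite /gram expr2.
have c11 := cont_dot2 (cth ab) (cth ab); have c22 := cont_dot2 (cph ab) (cph ab).
have c12 := cont_dot2 (cth ab) (cph ab).
exact: (cvgB (cvgM c11 c22) (cvgM c12 c12)).
Qed.

(** The density is continuous on the compact rectangle
    of coordinates, and vanishes only at the poles, so it has a positive minimum
    for colatitudes in [pi / 4, 3 pi / 4]. *)
Lemma meridian_integral_bounds : exists m B : R, 0 < m /\
  forall ph, 0 <= ph <= 2 * pi ->
    m <= \int[mu]_(th in `[0, pi]) area_density F th ph <= B.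
Proof.
have pi0 : 0 < pi :> R := pi_gt0 R.
pose f (ab : R * R) := Num.sqrt (gram ab).
have cf : continuous f := continuous_area_density.
pose B1 : set (R * R) := `[0, pi]%classic `*` `[0, 2 * pi]%classic.
pose B2 : set (R * R) := `[pi / 4, 3 * pi / 4]%classic `*` `[0, 2 * pi]%classic.
have cB1 : compact B1 by apply: compact_setX; exact: segment_compact.
have cB2 : compact B2 by apply: compact_setX; exact: segment_compact.
have n1 : B1 !=set0.
  by exists (0, 0); split; rewrite /= in_itv/=; apply/andP; split; lra.
have n2 : B2 !=set0.
  by exists (pi / 4, 0); split; rewrite /= in_itv/=; apply/andP; split; lra.
have [m1 _ M1] := compact_EVT_max n1 cB1 (continuous_subspaceT cf).
have [m2 m2B M2] := compact_EVT_min n2 cB2 (continuous_subspaceT cf).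
have m20 : 0 < f m2.
  move: m2B; rewrite inE => -[]; case: m2 {M2} => th ph /=.
  rewrite !in_itv/= => /andP[t1 t2] _.
  by rewrite sqrtr_gt0 gram_gt0// sin_gt0_pi//; apply/andP; split; lra.
exists (f m2 * (3 * pi / 4 - pi / 4)), (f m1 * (pi - 0)); split.
  by apply: mulr_gt0; [exact: m20|lra].
move=> ph hph; apply: Rintegral_bounds; try lra.
  move=> th hth; rewrite area_densityE sqrtr_ge0 /=.
  by apply: M1; rewrite inE; split; rewrite /= in_itv.
move=> th hth; rewrite area_densityE.
by apply: M2; rewrite inE; split; rewrite /= in_itv.
Qed.

Lemma area_gt0 : 0 < area F.
Proof.
have pi0 : 0 < pi :> R := pi_gt0 R.
have pi2 : 0 <= 2 * pi :> R by lra.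
have [m [B [m0 mB]]] := meridian_integral_bounds.
have fB ph : 0 <= ph <= 2 * pi ->
    0 <= \int[mu]_(th in `[0, pi]) area_density F th ph <= B.
  by move=> /mB/andP[h1 ->]; rewrite andbT (le_trans _ h1)// ltW.
have fm ph : 0 <= ph <= 2 * pi ->
    m <= \int[mu]_(th in `[0, pi]) area_density F th ph.
  by move=> /mB/andP[].
have /andP[h _] := Rintegral_bounds (lexx 0) pi2 (lexx _) (ltW m0) fB fm.
by apply: lt_le_trans h; apply: mulr_gt0 => //; lra.
Qed.

End AreaPositive.

(** * The theorem *)

Section MainNormalized.
Context {R : realType}.
Variables a b e : R.
Hypotheses (a0 : 0 < a) (b0 : 0 < b) (e0 : 0 < e) (eE : e ^+ 2 = a ^+ 2 - b ^+ 2).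
Notation F := (Phi (a ^+ 2) (b ^+ 2)).

Lemma isotopy_class_Phi T : isotopy_class (a ^+ 2) (b ^+ 2) (F 0) (F T).
Proof.
split; first exact: lagrangian_immersion_Phi a0 b0 e0 eE T.
exists (fun t => F (T * t)); first exact: hamiltonian_variation_Phi a0 b0 e0 eE T.
by move=> p _; rewrite mulr0 mulr1.
Qed.

Lemma no_minimizer :
  ~ (exists Psi, is_minimizer (isotopy_class (a ^+ 2) (b ^+ 2) (F 0)) Psi).
Proof.
move=> [Psi [[[immP _] _] minP]].
have A0 := area_gt0 immP.
have /cvgrPdist_lt/(_ _ A0) near_small := area_Phi_cvg0 a0 b0 e0 eE.
near (+oo : set_system R) => T.
have : `|0 - area (F T)| < area Psi by near: T.
rewrite sub0r normrN => small.
have := minP _ (isotopy_class_Phi T).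
by rewrite leNgt (le_lt_trans (ler_norm _) small).
Unshelve. all: by end_near. Qed.

End MainNormalized.

Theorem mainTheorem3 (R : realType) (c1 c2 : R) (hc2 : 0 < c2)
    (hc12 : c2 < c1) :
  hamiltonian_variation c1 c2 (Phi c1 c2) /\
  (forall t : R, area (Phi c1 c2 t) <= area (Phi c1 c2 0)) /\
  (area (Phi c1 c2 t) @[t --> +oo] --> (0 : R)) /\
  (hamiltonian_stationary c1 c2 (Phi c1 c2 0) /\
   unstable c1 c2 (Phi c1 c2 0)) /\
  ~ (exists Psi, is_minimizer (isotopy_class c1 c2 (Phi c1 c2 0)) Psi).
Proof.
have hc1 : 0 < c1 by exact: lt_trans hc12.
have a0 : 0 < Num.sqrt c1 by rewrite sqrtr_gt0.
have b0 : 0 < Num.sqrt c2 by rewrite sqrtr_gt0.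
have e0 : 0 < Num.sqrt (c1 - c2) by rewrite sqrtr_gt0 subr_gt0.
have aE : Num.sqrt c1 ^+ 2 = c1 by rewrite sqr_sqrtr// ltW.
have bE : Num.sqrt c2 ^+ 2 = c2 by rewrite sqr_sqrtr// ltW.
have eE : Num.sqrt (c1 - c2) ^+ 2 = Num.sqrt c1 ^+ 2 - Num.sqrt c2 ^+ 2.
  by rewrite aE bE sqr_sqrtr// subr_ge0 ltW.
have ham := hamiltonian_variation_Phi a0 b0 e0 eE 1.
have amax := area_Phi_max a0 b0 e0 eE.
have acvg := area_Phi_cvg0 a0 b0 e0 eE.
have stat := hamiltonian_stationary_Phi0 a0 b0 e0 eE.
have unst := unstable_Phi0 a0 b0 e0 eE.
have nomin := no_minimizer a0 b0 e0 eE.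
rewrite aE bE in ham amax acvg stat unst nomin.
have F1 : (fun t => Phi c1 c2 (1 * t)) = Phi c1 c2 by apply/funext => t; rewrite mul1r.
by rewrite F1 in ham.
Qed.
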